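(* Let $0<q<1$, $0<k_1\le k_2$, $m\in\mathbb{Z}$, $p\in\mathbb{Z}_{\ge0}$, $s\in\mathbb{R}$ with $|s|\ge q^{-1}$, and $\theta,\psi\in[0,\pi]$, such that none of the denominators below vanishes. Then $$ \sum_{n=0}^\infty c_n\, s_{n+m}\big(\cos\theta;sq^{2k_1-2k_2-2p},q^{2k_1+2k_2+2p}/s\,|\,q^2\big)\, s_n\big(\mu(q^{2k_2+2p}/s);sq^{-2k_2},q^{-2k_2}/s\,|\,q^{-2}\big) $$ $$ \times P_n\big(\cos\psi;q^{2k_1-2k_2+2m+1},q^{2k_1+2k_2-1},q^{2k_2-2k_1+1}\,|\,q^2\big) $$ $$ = p_p\big(\cos\psi;qe^{i\theta}/s,qe^{-i\theta}/s,q^{2k_2-2k_1+1},q^{2k_1+2k_2-1}\,|\,q^2\big)\; {}_2\varphi_2\!\left({qe^{i(\theta-\psi)}/s,\ qe^{i(\theta+\psi)}/s\atop q^2/s^2,\ q^{2k_2-2k_1-2m+2}e^{i\theta}/s};q^2,\,q^{2k_2-2k_1-2m+2}e^{-i\theta}/s\right), $$ where $$ c_n=\frac{(-1)^{n+m}q^{n(2k_2+1)}q^{n(n-1)-m(m-1)+2p(p-1)}}{(q^2,q^{4k_2},q^{4k_1+2m},q^{2+2m};q^2)_n}\,(sq^{2k_1-2k_2})^{-m}\,(s^2q^{2k_1-2k_2-3})^{-p} $$ $$ \times\frac{(q^{2+2m},q^{4k_1+2m};q^2)_\infty\,(q^{4k_2};q^2)_p}{(q^2/s^2,\,q^{2k_2-2k_1-2m+2}e^{i\theta}/s;q^2)_\infty}\left|\frac{(qe^{i(\psi+\theta)}/s,\,qe^{i(\psi-\theta)}/s;q^2)_\infty}{(q^{2k_1+2k_2+2p}e^{i\theta}/s,\,q^{2k_1-2k_2+2m+1}e^{i\psi};q^2)_\infty}\right|^2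 . $$ Here $s_{j}=0$ for negative integers $j$, so that for $m<0$ the sum starts at $n=-m$; the quotients $(q^{2+2m};q^2)_\infty/(q^{2+2m};q^2)_n$ and $(q^{4k_1+2m};q^2)_\infty/(q^{4k_1+2m};q^2)_n$ in $c_n$ are read as $(q^{2+2m+2n};q^2)_\infty$ and $(q^{4k_1+2m+2n};q^2)_\infty$.
   Context: Notation: $\mu(y)=\tfrac12(y+y^{-1})$. For a base $Q$, $(x;Q)_k=\prod_{j=0}^{k-1}(1-xQ^j)$ (with $k=\infty$ allowed if $|Q|<1$), and $(x_1,\dots,x_r;Q)_k=\prod_i(x_i;Q)_k$. $${}_2\varphi_2\!\left({A,B\atop C,D};Q,z\right)=\sum_{k=0}^\infty\frac{(A,B;Q)_k}{(Q,C,D;Q)_k}(-1)^kQ^{k(k-1)/2}z^k .$$ Askey-Wilson polynomials in base $Q$: $$p_n(\cos\phi;a,b,c,d|Q)=a^{-n}(ab,ac,ad;Q)_n\sum_{k=0}^n\frac{(Q^{-n},abcdQ^{n-1},ae^{i\phi},ae^{-i\phi};Q)_k}{(Q,ab,ac,ad;Q)_k}Q^k .$$ Here $\phi$ may be complex, $\cos\phi=\mu(e^{i\phi})$; $p_n$ is a polynomial in $\cos\phi$ and in the parameters, symmetric in $a,b,c,d$ (this defines it whenever a denominator above vanishes). Continuous dual $q$-Hahn polynomials: $P_n(x;a,b,c|Q)=p_n(x;a,b,c,0|Q)$. Al-Salam and Chihara polynomials: $s_n(x;a,b|Q)=p_n(x;a,b,0,0|Q)$, i.e. $$s_n(\cos\phi;a,b|Q)=a^{-n}(ab;Q)_n\sum_{k=0}^n\frac{(Q^{-n},ae^{i\phi},ae^{-i\phi};Q)_k}{(Q,ab;Q)_k}Q^k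 .$$ These are used both for $Q=q^2$ and for $Q=q^{-2}$. *)

(* Defs.v *)
From HB Require Import structures.
From mathcomp Require Import all_boot all_order all_algebra.
From mathcomp Require Import all_classical all_reals all_analysis.
From mathcomp Require Import complex ring.
Set Implicit Arguments.
Unset Strict Implicit.
Unset Printing Implicit Defensive.
Import Order.TTheory GRing.Theory Num.Theory.
Import numFieldNormedType.Exports.
Local Open Scope classical_set_scope.
Local Open Scope ring_scope.

(** Ascribing [R[i]] to [numClosedFieldType] makes it inherit the topology that
    MathComp-Analysis puts on every [numFieldType], i.e. the one given by the
    modulus; the bare type [R[i]] carries no topology. *)
Definition Cplx (R : realType) : numClosedFieldType := R[i].

Definition of_real {R : realType} (x : R) : Cplx R := Complex x 0.

(** e^(i t) for real t *)
Definition expi {R : realType} (t : R) : Cplx R := Complex (cos t) (sin t).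

Section QSeries.
Variable K : numFieldType.
Implicit Types (x y z a b c d A B C D Q : K) (xs : seq K) (n k : nat).

Definition mu y : K := (y + y^-1) / 2%:R.

(** (x; Q)_n and (x_1, ..., x_r; Q)_n *)
Definition qpoch x Q n : K := \prod_(j < n) (1 - x * Q ^+ j).

Definition qpochs xs Q n : K := \prod_(x <- xs) qpoch x Q n.

(** (x; Q)_oo and (x_1, ..., x_r; Q)_oo, for |Q| < 1 *)
Definition qpoch_inf x Q : K := lim (qpoch x Q @ \oo).

Definition qpochs_inf xs Q : K := \prod_(x <- xs) qpoch_inf x Q.

Definition phi22 A B C D Q z : K :=
  lim (series (fun k => qpochs [:: A; B] Q k / qpochs [:: Q; C; D] Q k
                        * (-1) ^+ k * Q ^+ 'C(k, 2) * z ^+ k) @ \oo).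

(** (a e^(i phi), a e^(-i phi); Q)_k as a function of x = cos phi, see
    [qpoch_pairE]. *)
Definition qpoch_pair a x Q k : K :=
  \prod_(j < k) (1 - 2%:R * a * x * Q ^+ j + a ^+ 2 * Q ^+ (2 * j)).

(** The Askey-Wilson polynomial p_n(x; a, b, c, d | Q), for a != 0.  The
    prefactor (ab, ac, ad; Q)_n is divided termwise by the denominators
    (ab, ac, ad; Q)_k, which leaves (ab Q^k, ac Q^k, ad Q^k; Q)_(n-k).  The
    result is polynomial in x, b, c, d and stays defined when one of ab, ac, ad
    is a power Q^(-j); [askey_wilsonE] is the usual expression. *)
Definition askey_wilson n x a b c d Q : K :=
  a ^- n * \sum_(k < n.+1)
    qpochs [:: Q ^- n; a * b * c * d * Q ^ (n%:Z - 1)] Q k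
    * qpoch_pair a x Q k
    * qpochs [:: a * b * Q ^+ k; a * c * Q ^+ k; a * d * Q ^+ k] Q (n - k)
    / qpoch Q Q k * Q ^+ k.

Definition cdual_qHahn n x a b c Q : K := askey_wilson n x a b c 0 Q.

(** Al-Salam and Chihara polynomials, with s_j = 0 for j < 0 *)
Definition al_salam_chihara (j : int) x a b Q : K :=
  if j is Posz n then askey_wilson n x a b 0 0 Q else 0.

Lemma qpoch_pairE a z Q k : z != 0 ->
  qpoch_pair a (mu z) Q k = qpochs [:: a * z; a / z] Q k.
Proof.
move=> z0; rewrite /qpochs !big_cons big_nil mulr1 /qpoch -big_split /=.
apply: eq_bigr => j _; rewrite mulnC exprM /mu.
by field; rewrite z0.
Qed.

Lemma qpochD x Q k n : qpoch x Q (k + n) = qpoch x Q k * qpoch (x * Q ^+ k) Q n.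
Proof.
rewrite /qpoch big_split_ord /=; congr (_ * _).
by apply: eq_bigr => j _; rewrite exprD mulrA.
Qed.

Lemma askey_wilsonE n z a b c d Q : z != 0 ->
  qpochs [:: a * b; a * c; a * d] Q n != 0 ->
  askey_wilson n (mu z) a b c d Q =
  a ^- n * qpochs [:: a * b; a * c; a * d] Q n * \sum_(k < n.+1)
    qpochs [:: Q ^- n; a * b * c * d * Q ^ (n%:Z - 1); a * z; a / z] Q k
    / qpochs [:: Q; a * b; a * c; a * d] Q k * Q ^+ k.
Proof.
move=> z0 nz; rewrite /askey_wilson -[RHS]mulrA; congr (_ * _).
rewrite mulr_sumr; apply: eq_bigr => -[k /=]; rewrite ltnS => kn _.
rewrite qpoch_pairE //; move: nz; rewrite /qpochs !big_cons !big_nil !mulr1.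
have E x : qpoch x Q n = qpoch x Q k * qpoch (x * Q ^+ k) Q (n - k).
  by rewrite -qpochD subnKC.
rewrite !E !mulf_eq0 !negb_or.
move=> /and3P[/andP[u _] /andP[v _] /andP[w _]].
have [->|qq] := eqVneq (qpoch Q Q k) 0; first by rewrite !mul0r invr0 !(mulr0, mul0r).
by field; rewrite u v w qq.
Qed.

End QSeries.

Section Coefficients.
Variable R : realType.

(** The coefficient c_n; the quotients (q^(2+2m); q^2)_oo / (q^(2+2m); q^2)_n and
    (q^(4 k1+2m); q^2)_oo / (q^(4 k1+2m); q^2)_n appear as
    (q^(2+2m+2n); q^2)_oo and (q^(4 k1+2m+2n); q^2)_oo. *)
Definition coef (q k1 k2 s theta psi : R) (m : int) (p n : nat) : Cplx R :=
  let Q := of_real (q ^+ 2) in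
  let M : R := m%:~R in
  let qr (x : R) := of_real (q `^ x) in
  let S := of_real s in
  (-1) ^ (n%:Z + m) * qr (n%:R * (2 * k2 + 1))
  * of_real (q ^ (n%:Z * (n%:Z - 1) - m * (m - 1) + 2 * (p%:Z * (p%:Z - 1))))
  / qpochs [:: Q; qr (4 * k2)] Q n
  * (S * qr (2 * k1 - 2 * k2)) ^ (- m)
  * (S ^+ 2 * qr (2 * k1 - 2 * k2 - 3)) ^- p
  * (qpochs_inf [:: qr (2 + 2 * M + 2 * n%:R);
                    qr (4 * k1 + 2 * M + 2 * n%:R)] Q
     * qpochs [:: qr (4 * k2)] Q p
     / qpochs_inf [:: Q / S ^+ 2;
                      qr (2 * k2 - 2 * k1 - 2 * M + 2) * expi theta / S] Q)
  * `| qpochs_inf [:: of_real q * expi (psi + theta) / S;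
                      of_real q * expi (psi - theta) / S] Q
       / qpochs_inf [:: qr (2 * k1 + 2 * k2 + 2 * p%:R) * expi theta / S;
                        qr (2 * k1 - 2 * k2 + 2 * M + 1) * expi psi] Q | ^+ 2.

End Coefficients.

(* Main.v *)
Require Import Defs.
From HB Require Import structures.
From mathcomp Require Import all_boot all_order all_algebra.
From mathcomp Require Import all_classical all_reals all_analysis.
From mathcomp Require Import complex.
From mathcomp Require Import ring lra zify.
Import Order.TTheory GRing.Theory Num.Theory.
Import numFieldNormedType.Exports.
Local Open Scope classical_set_scope.
Local Open Scope ring_scope.

Set Implicit Arguments.
Unset Strict Implicit.
Unset Printing Implicit Defensive.

(** Put Q = q^2, x = e^(i theta), y = e^(i psi), sg = q/s and
    A = s q^(2 k_1 - 2 k_2), and let al, b, ga be the parameters of P_n in the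
    order of the theorem.  Then al = A Q^m sg and ga = Q / (A sg) do not depend
    on b = q^(2 k_1 + 2 k_2 - 1), so b can be treated as a free variable.  With
    g_j(A, B) = s_j(x; A, B | Q) / (Q; Q)_j, and after the second family of
    polynomials is rewritten from base 1/Q to base Q ([asc_base_inv]), the n-th
    term of the series is, up to a factor that does not depend on n,

      sg^n g_(n+m)(A Q^(-p), b sg Q^p) P_n(y; al, b, ga) (al b Q^n; Q)_oo / (Q; Q)_n
        w_p(n),

    where w_p ([dual_poly]) is a polynomial of degree at most p in Q^n whose
    coefficients depend on b ga.  Let S_p(b) be the sum of these terms.  The
    argument compares S_p at b and at b Q: by contiguous relations for the three
    families of polynomials, the terms satisfy first order relations up to a
    telescoping difference.

    For p = 0 one has w_0 = 1.  The relations in b give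
    S_0(b) = (1 - b sg x) (1 - b sg / x) S_0(b Q) ([bil_step]); iterating and
    letting b Q^n tend to 0, by dominated convergence ([tannery]),
    S_0(b) = (b sg x, b sg / x; Q)_oo f with f independent of b ([bil_sum]).
    To find f take b = y.  Then P_n is a product of two q-shifted factorials
    ([cdqH_special]), and writing g_n as a convolution ([asc_convolution])
    turns S_0(y) into a double series; its inner sum is a q-Gauss sum
    ([gauss_int]) and the remaining 2phi1 is transformed into the 2phi2 of the
    theorem ([heine22]).

    For the passage from p to p + 1, contiguous relations for g, P_n and w_p
    express S_(p+1)(b) by S_p(b) and S_p(b Q) ([tri_step]).  The Askey-Wilson
    polynomials of degree p + 1 and p satisfy the same relation in their last
    parameter ([aw_rec]), so that S_p(b) is an explicit constant times
    an Askey-Wilson polynomial, an infinite product and f, for all b at once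
    ([tri_value]).

    The squared modulus in c_n is the product of the infinite products at x, y
    and at their conjugates 1/x, 1/y, and the prefactors cancel. *)

(** * Contiguous relations for the Askey-Wilson polynomials *)

Section AskeyWilson.
Variable K : numFieldType.
Implicit Types (x y z a b c d Q : K) (n k : nat).

Lemma qpoch0 x Q : qpoch x Q 0 = 1.
Proof. by rewrite /qpoch big_ord0. Qed.

Lemma qpochSr x Q n : qpoch x Q n.+1 = qpoch x Q n * (1 - x * Q ^+ n).
Proof. by rewrite /qpoch big_ord_recr. Qed.

Lemma qpochSl x Q n : qpoch x Q n.+1 = (1 - x) * qpoch (x * Q) Q n.
Proof. by rewrite -add1n qpochD expr1 qpochSr qpoch0 expr0 mulr1 mul1r. Qed.

Lemma qpoch_const0 Q n : qpoch 0 Q n = 1.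
Proof. by elim: n => [|n IH]; rewrite ?qpoch0 // qpochSr IH mul0r subr0 mulr1. Qed.

Lemma qpoch_terminates Q n k : Q != 0 -> (n < k)%N -> qpoch (Q ^- n) Q k = 0.
Proof.
move=> Q0 nk; rewrite -(subnKC nk) qpochD qpochSr mulVf ?expf_neq0 //.
by rewrite subrr mulr0 mul0r.
Qed.

(** The dependence of p_n on x sits entirely in the factors [qpoch_pair a x Q k],
    so relations between polynomials with the same a can be checked coefficient
    by coefficient. *)
Definition aw_coef n k a b c d Q : K :=
  a ^- n * (qpoch (Q ^- n) Q k * qpoch (a * b * c * d * Q ^ (n%:Z - 1)) Q k
    * (qpoch (a * b * Q ^+ k) Q (n - k) * qpoch (a * c * Q ^+ k) Q (n - k)
       * qpoch (a * d * Q ^+ k) Q (n - k)) / qpoch Q Q k * Q ^+ k).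

Lemma aw_sum n x a b c d Q : askey_wilson n x a b c d Q =
  \sum_(k < n.+1) aw_coef n k a b c d Q * qpoch_pair a x Q k.
Proof.
rewrite /askey_wilson mulr_sumr; apply: eq_bigr => k _.
rewrite /aw_coef /qpochs !big_cons !big_nil !mulr1; ring.
Qed.

Lemma aw_coef_gt n k a b c d Q : Q != 0 -> (n < k)%N -> aw_coef n k a b c d Q = 0.
Proof. by move=> *; rewrite /aw_coef qpoch_terminates // !mul0r mulr0. Qed.

Lemma qpoch_pairS a x Q k : qpoch_pair a x Q k.+1 =
  qpoch_pair a x Q k * (1 - 2%:R * a * x * Q ^+ k + a ^+ 2 * Q ^+ (2 * k)).
Proof. by rewrite /qpoch_pair big_ord_recr. Qed.

Lemma qpoch_pair0 a x Q : qpoch_pair a x Q 0 = 1.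
Proof. by rewrite /qpoch_pair big_ord0. Qed.

Lemma aw_perm_cd n x a b c d Q :
  askey_wilson n x a b c d Q = askey_wilson n x a b d c Q.
Proof.
by rewrite !aw_sum; apply: eq_bigr => k _; rewrite /aw_coef (mulrAC (a * b) c) (mulrAC (qpoch (a*b*_) _ _)).
Qed.

Lemma aw_perm_bc n x a b c d Q :
  askey_wilson n x a b c d Q = askey_wilson n x a c b d Q.
Proof.
rewrite !aw_sum; apply: eq_bigr => k _; rewrite /aw_coef (mulrAC a b).
by rewrite (mulrC (qpoch (a*b*_) _ _) (qpoch (a*c*_) _ _)).
Qed.

Lemma aw_coef_rec0 n a b c d Q : a != 0 -> Q != 0 ->
  d * aw_coef n.+1 0 a b c d Q =
  (1 - a * d * Q ^+ n) * (1 - b * d * Q ^+ n) * (1 - c * d * Q ^+ n)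
    * aw_coef n 0 a b c d Q
  - (1 - a * b * c * d * Q ^+ (2 * n)) *
    ((1 - d / a) * (1 - a * d) * aw_coef n 0 a b c (d * Q) Q).
Proof.
move=> a0 Q0; rewrite /aw_coef !qpoch0 !expr0 !subn0 !mulr1 invr1 !mulr1 !mul1r.
have -> : qpoch (a * d) Q n.+1 = qpoch (a * d) Q n * (1 - a * d * Q ^+ n) by rewrite qpochSr.
have E : (1 - a * d) * qpoch (a * (d * Q)) Q n = qpoch (a * d) Q n * (1 - a * d * Q ^+ n).
  by rewrite -qpochSr qpochSl mulrA.
rewrite !(qpochSr _ _ n).
transitivity ((1 - a * d * Q ^+ n) * (1 - b * d * Q ^+ n) * (1 - c * d * Q ^+ n)
  * (a ^- n * (qpoch (a * b) Q n * qpoch (a * c) Q n * qpoch (a * d) Q n))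
  - (1 - a * b * c * d * Q ^+ (2 * n)) * ((1 - d / a) * (a ^- n * (qpoch (a * b) Q n * qpoch (a * c) Q n *
     ((1 - a * d) * qpoch (a * (d * Q)) Q n))))); last by ring.
rewrite E [(2 * n)%N]mulnC exprM exprS invfM expr2.
set V := Q ^+ n; set W := a ^+ n.
have W0 : W != 0 by rewrite expf_neq0.
by field; rewrite W0 a0.
Qed.

(** The coefficient of [qpoch_pair a x Q k.+1] in [aw_rec].  Multiplying
    [qpoch_pair a x Q k] by 1 - 2dx + d^2 gives a combination of itself and of the
    next factor, whence the two terms of the last bracket. *)
Lemma aw_coef_recS n k a b c d Q : a != 0 -> Q != 0 -> qpoch Q Q k.+1 != 0 ->
  (k <= n)%N ->
  d * aw_coef n.+1 k.+1 a b c d Q =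
  (1 - a * d * Q ^+ n) * (1 - b * d * Q ^+ n) * (1 - c * d * Q ^+ n)
    * aw_coef n k.+1 a b c d Q
  - (1 - a * b * c * d * Q ^+ (2 * n)) *
    (d / (a * Q ^+ k) * aw_coef n k a b c (d * Q) Q
     + (1 - d / (a * Q ^+ k.+1)) * (1 - a * d * Q ^+ k.+1)
       * aw_coef n k.+1 a b c (d * Q) Q).
Proof.
move=> a0 Q0 nz; rewrite leq_eqVlt => /orP[/eqP <-|].
  (* k = n: the terms of index n + 1 on the right vanish *)
  rewrite (@aw_coef_gt k k.+1 a b c d) // (@aw_coef_gt k k.+1 a b c (d * Q)) //.
  rewrite !mulr0 addr0 sub0r /aw_coef !subnn !qpoch0 !mulr1.
  have -> : qpoch (Q ^- k.+1) Q k.+1 = (1 - Q ^- k.+1) * qpoch (Q ^- k) Q k.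
    by rewrite qpochSl exprS invfM -mulrA (mulrC _ Q) mulrA mulVf // mul1r.
  have -> : (k.+1%:Z - 1) = k%:Z by rewrite -addn1 PoszD addrK.
  have -> : a * b * c * (d * Q) * Q ^ (k%:Z - 1) = a * b * c * d * Q ^ k%:Z.
    by rewrite expfzDr // exprN1; field.
  rewrite -exprnP; move: nz; rewrite !(qpochSr _ _ k) -exprS mulf_eq0 negb_or => /andP[n1 n2].
  set E := qpoch (a * _ * _ * _ * _) Q k; set F := qpoch (Q ^- k) Q k.
  rewrite [(2 * k)%N]mulnC exprM expr2 !exprS; set G := qpoch Q Q k.
  rewrite -/G in n1; rewrite exprS in n2.
  move: n1 n2; move: E F G => E F G; set V := Q ^+ k; set W := a ^+ k => n1 n2.
  have W0 : W != 0 by rewrite expf_neq0.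
  have V0 : V != 0 by rewrite expf_neq0.
  by field; rewrite W0 a0 V0 Q0 n1 n2.
move=> kn; have [i Ei] : {i | n = (k + i).+1}%N by exists (n - k.+1)%N; lia.
subst n; clear kn; rewrite /aw_coef.
have -> : ((k + i).+2 - k.+1 = i.+1)%N by lia.
have -> : ((k + i).+1 - k.+1 = i)%N by lia.
have -> : ((k + i).+1 - k = i.+1)%N by lia.
have -> : qpoch (Q ^- (k + i).+2) Q k.+1 = (1 - Q ^- (k + i).+2) * qpoch (Q ^- (k + i).+1) Q k.
  by rewrite qpochSl exprS invfM -mulrA (mulrC _ Q) mulrA mulVf // mul1r.
have -> : ((k + i).+2%:Z - 1) = (k + i).+1%:Z by rewrite -addn1 PoszD addrK.
have -> : a * b * c * (d * Q) * Q ^ ((k + i).+1%:Z - 1) = a * b * c * d * Q ^+ (k + i).+1.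
  by rewrite expfzDr // exprN1 -exprnP; field.
have -> : ((k + i).+1%:Z - 1) = (k + i)%:Z by rewrite -addn1 PoszD addrK.
rewrite -!exprnP.
have -> : qpoch (a * b * c * d * Q ^+ (k + i)) Q k.+1 =
  (1 - a * b * c * d * Q ^+ (k + i)) * qpoch (a * b * c * d * Q ^+ (k + i).+1) Q k.
  by rewrite qpochSl exprSr !mulrA.
have ES u : qpoch (u * Q ^+ k) Q i.+1 = (1 - u * Q ^+ k) * qpoch (u * Q ^+ k.+1) Q i.
  by rewrite qpochSl exprSr !mulrA.
rewrite !(ES (a * b)) !(ES (a * c)).
have Ed : a * (d * Q) * Q ^+ k = a * d * Q ^+ k.+1 by rewrite exprS; ring.
rewrite Ed.
set D0 := qpoch (a * d * Q ^+ k.+1) Q i.+1.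
have -> : D0 = qpoch (a * d * Q ^+ k.+1) Q i * (1 - a * d * Q ^+ k.+1 * Q ^+ i) by rewrite /D0 qpochSr.
(* (a d Q^(k+1))_(i+1), split off at either end, links the factorials in d Q to
   those in d *)
have ED : (1 - a * d * Q ^+ k.+1) * qpoch (a * (d * Q) * Q ^+ k.+1) Q i =
   qpoch (a * d * Q ^+ k.+1) Q i * (1 - a * d * Q ^+ k.+1 * Q ^+ i).
  rewrite -qpochSr qpochSl; congr (_ * qpoch _ _ _); ring.
move: ED; set D1 := qpoch (a * (d * Q) * _) Q i => ED.
rewrite !(qpochSr (a * b * _)) !(qpochSr (a * c * _)).
rewrite !(qpochSr _ _ k).
move: nz; rewrite qpochSr mulf_eq0 negb_or => /andP[n1 n2].
move: ED; set Dd := qpoch (a * d * _) Q i; set G := qpoch Q Q k.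
set Ee := qpoch (a * b * c * d * _) Q k; set Bb := qpoch (a * b * _) Q i; set Cc := qpoch (a * c * _) Q i.
set F := qpoch (Q ^- _) Q k => ED; rewrite -/G in n1.
have E2 : (Q ^+ (2 * (k + i).+1) = Q ^+ (k+i).+1 * Q ^+ (k + i).+1) by rewrite mulnC exprM expr2.
have X1 u : u ^+ (k + i).+1 = u * u ^+ k * u ^+ i by rewrite exprS exprD mulrA.
have X2 u : u ^+ (k + i).+2 = u * (u * u ^+ k * u ^+ i) by rewrite exprS X1.
rewrite E2 !X2 !X1 !exprD !exprS.
rewrite !exprS in ED.
move: n1 n2 ED; move: D1 Dd G Ee Bb Cc F => D1 Dd G Ee Bb Cc F.
set V := Q ^+ k; set Z := Q ^+ i; set W := a ^+ k; set T := a ^+ i => n1 n2 ED.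
have W0 : W != 0 by rewrite expf_neq0.
have V0 : V != 0 by rewrite expf_neq0.
have T0 : T != 0 by rewrite expf_neq0.
have Z0 : Z != 0 by rewrite expf_neq0.
transitivity ((1 - a * d * (Q * V * Z)) * (1 - b * d * (Q * V * Z)) *
(1 - c * d * (Q * V * Z)) *
((a * W * T)^-1 * (F * (1 - (Q * V * Z)^-1 * V) *
  ((1 - a * b * c * d * (V * Z)) * Ee) * (Bb * Cc * Dd) / (G * (1 - Q * V)) * (Q * V))) -
(1 - a * b * c * d * (Q * V * Z * (Q * V * Z))) *
(d / (a * V) * ((a * W * T)^-1 * (F * Ee *
   ((1 - a * b * V) * Bb * ((1 - a * c * V) * Cc) * (Dd * (1 - a * d * (Q * V) * Z))) / G * V)) +
 (1 - d / (a * (Q * V))) *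
 ((a * W * T)^-1 * (F * (1 - (Q * V * Z)^-1 * V) * (Ee * (1 - a * b * c * d * (Q * V * Z) * V)) *
   (Bb * Cc * ((1 - a * d * (Q * V)) * D1)) / (G * (1 - Q * V)) * (Q * V))))); last by ring.
rewrite ED.
by field; rewrite W0 a0 V0 Q0 n1 n2 T0 Z0.
Qed.

Lemma aw_sum_ext N n x a b c d Q : Q != 0 -> (n < N)%N -> askey_wilson n x a b c d Q =
  \sum_(k < N) aw_coef n k a b c d Q * qpoch_pair a x Q k.
Proof.
move=> Q0 nN; rewrite aw_sum -(subnKC nN) big_split_ord /= [X in _ + X]big1 ?addr0 // => i _.
by rewrite aw_coef_gt ?mul0r // ltnS leq_addr.
Qed.

(** A recurrence that moves only d: as 1 - 2dx + d^2 = (1 - d z) (1 - d/z) for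
    x = mu z, the last term is compatible with the shift of d in
    (d z, d/z; Q)_oo.  It is the source of the relations below that raise the degree,
    and the recurrence by which the right-hand side of the theorem is recognised
    in the induction on p. *)
Lemma aw_rec n x a b c d Q : a != 0 -> Q != 0 -> (forall k, qpoch Q Q k != 0) ->
  d * askey_wilson n.+1 x a b c d Q =
  (1 - a * d * Q ^+ n) * (1 - b * d * Q ^+ n) * (1 - c * d * Q ^+ n)
    * askey_wilson n x a b c d Q
  - (1 - a * b * c * d * Q ^+ (2 * n)) * (1 - 2%:R * d * x + d ^+ 2)
    * askey_wilson n x a b c (d * Q) Q.
Proof.
move=> a0 Q0 nz.
pose f k := aw_coef n k a b c (d * Q) Q.
have step k : (1 - 2%:R * d * x + d ^+ 2) * qpoch_pair a x Q k =
    d / (a * Q ^+ k) * qpoch_pair a x Q k.+1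
    + (1 - d / (a * Q ^+ k)) * (1 - a * d * Q ^+ k) * qpoch_pair a x Q k.
  rewrite qpoch_pairS [(2 * k)%N]mulnC exprM expr2.
  have := expf_neq0 k Q0; move: (Q ^+ k) => V V0; field; by rewrite V0 a0.
have -> : (1 - a * b * c * d * Q ^+ (2 * n)) * (1 - 2%:R * d * x + d ^+ 2)
    * askey_wilson n x a b c (d * Q) Q =
  \sum_(k < n.+1) (1 - a * b * c * d * Q ^+ (2 * n)) * (d / (a * Q ^+ k) * f k) * qpoch_pair a x Q k.+1
  + \sum_(k < n.+2) (1 - a * b * c * d * Q ^+ (2 * n)) *
       ((1 - d / (a * Q ^+ k)) * (1 - a * d * Q ^+ k) * f k) * qpoch_pair a x Q k.
  have f0 : f n.+1 = 0 by exact: aw_coef_gt.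
  rewrite (big_ord_recr n.+1) /= f0 !(mulr0, mul0r) addr0 -big_split /=.
  rewrite aw_sum mulr_sumr; apply: eq_bigr => k _.
  rewrite -/(f k) mulrCA -(mulrA _ (1 - 2%:R * d * x + d ^+ 2)) step; ring.
rewrite !(@aw_sum_ext n.+2 _ _ _ _ _ _ Q) // !mulr_sumr !(big_ord_recl n.+1) /=.
rewrite qpoch_pair0 !mulr1 aw_coef_rec0 // /f.
set S1 := \sum_(i < n.+1) _; set S2 := \sum_(i < n.+1) _.
set S3 := \sum_(i < n.+1) _; set S4 := \sum_(i < n.+1) _.
suff -> : S1 = S2 - S3 - S4 by ring.
rewrite /S1 /S2 /S3 /S4 -!sumrB; apply: eq_bigr => i _; rewrite /bump /= add1n.
rewrite mulrA aw_coef_recS //; last by rewrite -ltnS.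
by ring.
Qed.

Lemma aw0 x a b c d Q : askey_wilson 0 x a b c d Q = 1.
Proof.
rewrite aw_sum big_ord_recl big_ord0 /aw_coef /= !qpoch0 qpoch_pair0.
by rewrite !expr0 invr1 !(mulr1, addr0).
Qed.

(** For d = 0 the factor abcd Q^(n-1) disappears and b occurs in one factor of
    each coefficient only, so that shifting b is a first order relation. *)
Lemma cdqH_shift n x a b c Q : a != 0 -> Q != 0 ->
  cdual_qHahn n.+1 x a b c Q = cdual_qHahn n.+1 x a (b * Q) c Q
   - b * (1 - Q ^+ n.+1) * (1 - a * c * Q ^+ n) * cdual_qHahn n x a (b * Q) c Q.
Proof.
move=> a0 Q0; rewrite /cdual_qHahn !(@aw_sum_ext n.+2) // mulr_sumr -sumrB.
apply: eq_bigr => -[k /= kn] _; rewrite mulrA -mulrBl; congr (_ * _).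
rewrite /aw_coef !(mulr0, mul0r) !qpoch_const0 !mulr1.
have [->|kn'] := eqVneq k n.+1.
  rewrite subnn !qpoch0 (@qpoch_terminates _ n) // !(mul0r, mulr0, mulr1, subr0) //.
have {kn kn'} [i ->] : {i | n = k + i}%N by exists (n - k)%N; lia.
have -> : ((k + i).+1 - k = i.+1)%N by lia.
have -> : ((k + i) - k = i)%N by lia.
have -> : a * (b * Q) * Q ^+ k = a * b * Q ^+ k * Q by ring.
rewrite (qpochSl (a * b * _)) (qpochSr (a * b * _ * _)) (qpochSr (a * c * _)).
have E : qpoch (Q ^- (k + i).+1) Q k * (Q ^+ k - Q ^+ (k + i).+1) =
   (1 - Q ^+ (k + i).+1) * qpoch (Q ^- (k + i)) Q k.
  have -> : Q ^- (k + i) = Q ^- (k + i).+1 * Q.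
    by rewrite exprS invfM mulrAC mulVf // mul1r.
  have := qpochSl (Q ^- (k + i).+1) Q k; rewrite qpochSr => E0.
  have -> : Q ^+ k - Q ^+ (k + i).+1 = - Q ^+ (k + i).+1 * (1 - Q ^- (k + i).+1 * Q ^+ k).
    by rewrite mulrBr mulr1 mulNr mulrA mulfV ?expf_neq0 //; ring.
  rewrite mulrCA E0 mulNr mulrA mulrBr mulr1 mulfV ?expf_neq0 // -mulNr opprB //.
have X1 u : u ^+ (k + i).+1 = u * u ^+ k * u ^+ i by rewrite exprS exprD mulrA.
move: E; move: (qpoch (Q ^- (k + i).+1) Q k) (qpoch (Q ^- (k + i)) Q k) => E1 E2.
rewrite !X1 !exprD; have := expf_neq0 k a0; have := expf_neq0 i a0.
move: (Q ^+ k) (Q ^+ i) (a ^+ k) (a ^+ i) => V Z W T T0 W0 E.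
set q1 := qpoch _ Q i; set q2 := qpoch _ Q i.
transitivity ((a * W * T)^-1 * (E1 * ((1 - a * b * V * Q * Z) * q1 * (q2 * (1 - a * c * V * Z)))
   / qpoch Q Q k * V) - a * b * ((a * W * T)^-1 * (E1 * (V - Q * V * Z) * (q1 * (q2 * (1 - a * c * V * Z)))
   / qpoch Q Q k * V))); first by ring.
rewrite E; move: (qpoch Q Q k)^-1 => G; field; by rewrite W0 T0 a0.
Qed.

End AskeyWilson.

(** * Continuous dual q-Hahn and Al-Salam-Chihara polynomials *)

Section QHahn.
Variable K : numFieldType.
Variable Q : K.
Hypothesis Q0 : Q != 0.
Hypothesis nz : forall k, qpoch Q Q k != 0.
Implicit Types (x y z a b c d : K) (n k : nat) (j : int).

Lemma cdqH_rec n x a b c : a != 0 ->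
  b * cdual_qHahn n.+1 x a b c Q =
  (1 - a * b * Q ^+ n) * (1 - b * c * Q ^+ n) * cdual_qHahn n x a b c Q
  - (1 - 2%:R * b * x + b ^+ 2) * cdual_qHahn n x a (b * Q) c Q.
Proof.
move=> a0; rewrite /cdual_qHahn !(aw_perm_bc _ _ _ _ c) !(aw_perm_cd _ _ _ _ _ 0).
rewrite aw_rec //; ring.
Qed.

Lemma cdqH0 x a b c : cdual_qHahn 0 x a b c Q = 1.
Proof. exact: aw0. Qed.

(** At b = z the factor 1 - 2bx + b^2 of [cdqH_rec] vanishes, which leaves a first
    order recurrence in n. *)
Lemma cdqH_special n z a c : a != 0 -> z != 0 ->
  cdual_qHahn n (mu z) a z c Q = z ^- n * qpoch (a * z) Q n * qpoch (c * z) Q n.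
Proof.
move=> a0 z0; elim: n => [|n IH]; first by rewrite cdqH0 !qpoch0 expr0 invr1 !mulr1.
apply: (mulfI z0); rewrite cdqH_rec // IH !qpochSr.
have -> : 1 - 2%:R * z * mu z + z ^+ 2 = 0 by rewrite /mu; field.
have := expf_neq0 n z0; rewrite exprS; move: (z ^+ n) => W W0; field; by rewrite W0 z0.
Qed.

(** Dividing by (Q; Q)_j makes the relations below hold for all integers j; in
    [asc_normed_rec] the factor 1 - Q^(j+1) takes care of j = -1. *)
Definition asc_normed j x a b : K := al_salam_chihara j x a b Q / qpoch Q Q `|j|%N.

Lemma asc_recN n x a b : a != 0 ->
  b * al_salam_chihara n.+1 x a b Q = (1 - a * b * Q ^+ n) * al_salam_chihara n x a b Q
  - (1 - 2%:R * b * x + b ^+ 2) * al_salam_chihara n x a (b * Q) Q.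
Proof. by move=> a0; have := cdqH_rec n x b 0 a0; rewrite mulr0 mul0r subr0 mulr1. Qed.

Lemma asc_shiftN n x a b : a != 0 ->
  al_salam_chihara n.+1 x a b Q = al_salam_chihara n.+1 x a (b * Q) Q
   - b * (1 - Q ^+ n.+1) * al_salam_chihara n x a (b * Q) Q.
Proof.
by move=> a0; have := @cdqH_shift K n x a b 0 Q a0 Q0; rewrite mulr0 mul0r subr0 mulr1.
Qed.

Lemma asc0 x a b : al_salam_chihara 0 x a b Q = 1.
Proof. exact: aw0. Qed.

Lemma asc1 x a b : a != 0 -> b != 0 -> al_salam_chihara 1 x a b Q = 2%:R * x - (a + b).
Proof.
move=> a0 b0; apply: (mulfI b0); rewrite (@asc_recN 0) // !asc0 expr0; ring.
Qed.

(** Eliminating the shift of b between [asc_recN] and [asc_shiftN] at b / Q gives a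
    recurrence whose coefficients are symmetric in a and b. *)
Lemma asc_three_term n x a b : a != 0 -> b != 0 ->
  al_salam_chihara n.+2 x a b Q = (2%:R * x - (a + b) * Q ^+ n.+1) * al_salam_chihara n.+1 x a b Q
  - (1 - a * b * Q ^+ n) * (1 - Q ^+ n.+1) * al_salam_chihara n x a b Q.
Proof.
move=> a0 b0; have c0 : b / Q != 0 by rewrite mulf_neq0 ?invr_eq0.
apply: (mulfI c0).
have := @asc_recN n.+1 x a (b / Q) a0.
rewrite !(asc_shiftN _ _ (b / Q)) // !(divfK Q0) !exprS => E.
move: (al_salam_chihara n.+2 _ _ _ _) (al_salam_chihara n.+1 _ _ _ _)
  (al_salam_chihara n _ _ _ _) E => s2 s1 s0 E.
transitivity (b / Q * (s2 - b / Q * (1 - Q * (Q * Q ^+ n)) * s1)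
   + b / Q * (b / Q * (1 - Q * (Q * Q ^+ n)) * s1)); first by ring.
by rewrite E; field.
Qed.

Lemma ascC n x a b : a != 0 -> b != 0 ->
  al_salam_chihara n x a b Q = al_salam_chihara n x b a Q.
Proof.
move=> a0 b0; suff: al_salam_chihara n x a b Q = al_salam_chihara n x b a Q /\
  al_salam_chihara n.+1 x a b Q = al_salam_chihara n.+1 x b a Q by case.
elim: n => [|n [IH1 IH2]]; first by rewrite !asc0 !asc1 // [b + a]addrC.
split=> //; rewrite !asc_three_term // IH1 IH2 (addrC a) (mulrC a) //.
Qed.

Lemma nzS n : 1 - Q ^+ n.+1 != 0.
Proof.
by have := nz n.+1; rewrite qpochSr -exprS mulf_eq0 negb_or => /andP[].
Qed.

Lemma asc_normed_rec j x a b : a != 0 ->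
  b * (1 - Q ^ (j + 1)) * asc_normed (j + 1) x a b =
  (1 - a * b * Q ^ j) * asc_normed j x a b
  - (1 - 2%:R * b * x + b ^+ 2) * asc_normed j x a (b * Q).
Proof.
move=> a0; case: j => [n|[|n]].
- have -> : Posz n + 1 = n.+1 by rewrite -PoszD addn1.
  rewrite /asc_normed -!exprnP !absz_nat (qpochSr Q Q) -exprS.
  have n1 := nz n; have n2 := nzS n.
  have := @asc_recN n x a b a0; move: (al_salam_chihara _ _ _ _ _) => u E.
  transitivity (b * u / qpoch Q Q n); first by field; rewrite n1 n2.
  by rewrite E; field.
- by rewrite /asc_normed /= expr0z subrr !(mul0r, mulr0) subrr.
- have -> : Negz n.+1 + 1 = Negz n by lia.
  by rewrite /asc_normed /= !(mul0r, mulr0) subrr.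
Qed.

Lemma asc_normed_shift j x a b : a != 0 ->
  asc_normed j x a b = asc_normed j x a (b * Q) - b * asc_normed (j - 1) x a (b * Q).
Proof.
move=> a0; case: j => [[|n]|n].
- by rewrite /asc_normed !asc0 absz_nat /= mul0r mulr0 subr0.
- have -> : Posz n.+1 - 1 = n by rewrite -addn1 PoszD addrK.
  rewrite /asc_normed asc_shiftN // !absz_nat (qpochSr Q Q) -exprS.
  by have n1 := nz n; have n2 := nzS n; field; rewrite n1 n2.
- have -> : Negz n - 1 = Negz n.+1 by lia.
  by rewrite /asc_normed /= !(mul0r, mulr0) subrr.
Qed.

Lemma asc_normedC j x a b : a != 0 -> b != 0 -> asc_normed j x a b = asc_normed j x b a.
Proof. by case: j => // n a0 b0; rewrite /asc_normed ascC. Qed.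

Lemma asc_normed_shiftl j x a b : a != 0 -> b != 0 ->
  asc_normed j x a b = asc_normed j x (a * Q) b - a * asc_normed (j - 1) x (a * Q) b.
Proof.
move=> a0 b0; have aQ : a * Q != 0 by rewrite mulf_neq0.
by rewrite asc_normedC // asc_normed_shift // !(@asc_normedC _ x b).
Qed.

Definition qbin a n : K := qpoch a Q n / qpoch Q Q n.

Lemma qbinS a n : (1 - Q ^+ n.+1) * qbin a n.+1 = (1 - a * Q ^+ n) * qbin a n.
Proof.
rewrite /qbin !qpochSr -exprS; have n1 := nz n; have n2 := nzS n; field.
by rewrite n1 n2.
Qed.

Lemma qbin0 a : qbin a 0 = 1.
Proof. by rewrite /qbin !qpoch0 divr1. Qed.

(** Coefficientwise form of the generating function
    (at, bt; Q)_oo / (zt, t/z; Q)_oo of s_n / (Q; Q)_n, where each factor (at)/(zt)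
    and (bt)/(t/z) is expanded by the q-binomial theorem.  The induction lowers n
    by [asc_normed_rec], which replaces b by b Q. *)
Lemma asc_convolution n z a b : a != 0 -> b != 0 -> z != 0 ->
  asc_normed n (mu z) a b =
  \sum_(i < n.+1) (qbin (a / z) i * z ^+ i) * (qbin (b * z) (n - i) * z ^- (n - i)).
Proof.
move=> a0 + z0; elim: n b => [|n IH] b b0.
  by rewrite big_ord_recl big_ord0 /asc_normed asc0 !qbin0 qpoch0 !expr0 invr1 !(mulr1, addr0).
have bQ0 : b * Q != 0 by rewrite mulf_neq0.
have c0 : b * (1 - Q ^+ n.+1) != 0 by rewrite mulf_neq0 ?nzS.
apply: (mulfI c0); have := asc_normed_rec n (mu z) b a0.
have -> : Posz n + 1 = n.+1 by rewrite -PoszD addn1.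
rewrite -!exprnP => ->; rewrite !IH //.
have -> : 1 - 2%:R * b * mu z + b ^+ 2 = (1 - b * z) * (1 - b / z) by rewrite /mu; field.
set u := fun i => qbin (a / z) i * z ^+ i.
set v := fun i => qbin (b * z) i * z ^- i.
have uS i : (1 - Q ^+ i.+1) * u i.+1 = (z - a * Q ^+ i) * u i.
  by rewrite /u [LHS]mulrA qbinS exprS; field.
have vS i : (1 - Q ^+ i.+1) * v i.+1 = (1 / z - b * Q ^+ i) * v i.
  rewrite /v [LHS]mulrA qbinS exprS.
  by have := expf_neq0 i z0; move: (z ^+ i) => W W0; field; rewrite W0 z0.
have vQ i : (1 - b * z) * qbin (b * Q * z) i = (1 - b * z * Q ^+ i) * qbin (b * z) i.
  rewrite /qbin mulrA.
  have -> : (1 - b * z) * qpoch (b * Q * z) Q i = qpoch (b * z) Q i * (1 - b * z * Q ^+ i).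
    by rewrite -qpochSr qpochSl [b * Q * z]mulrAC.
  by ring.
transitivity (\sum_(i < n.+1) (b * Q ^+ (n - i) * ((1 - Q ^+ i.+1) * u i.+1) * v (n - i)%N
   + b * u i * ((1 - Q ^+ (n - i).+1) * v (n - i).+1))).
  rewrite !mulr_sumr -sumrB; apply: eq_bigr => -[i /=]; rewrite ltnS => iN _.
  rewrite uS vS /u /v.
  transitivity ((1 - a * b * Q ^+ n) * (u i * v (n - i)%N) - u i * z ^- (n - i) * (1 - b / z) *
    ((1 - b * z) * qbin (b * Q * z) (n - i))); first by rewrite /u /v; ring.
  rewrite vQ -{1}(subnKC iN) exprD /u /v; ring: (divff z0).
rewrite big_split /= mulr_sumr.
transitivity (\sum_(i < n.+2) (b * Q ^+ (n.+1 - i) * (1 - Q ^+ i) * u i * v (n.+1 - i)%N) +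
  \sum_(i < n.+2) (b * (1 - Q ^+ (n.+1 - i)) * u i * v (n.+1 - i)%N)).
  congr (_ + _).
    rewrite [RHS]big_ord_recl /= expr0 subrr !(mulr0, mul0r) add0r.
    by apply: eq_bigr => i _; rewrite /bump /= add1n subSS; ring.
  rewrite [RHS]big_ord_recr /= subnn expr0 subrr !(mulr0, mul0r) addr0.
  by apply: eq_bigr => -[i /=]; rewrite ltnS => iN _; rewrite subSn //; ring.
rewrite -big_split /=; apply: eq_bigr => -[i /=]; rewrite ltnS => iN _.
have -> : Q ^+ n.+1 = Q ^+ i * Q ^+ (n.+1 - i) by rewrite -exprD subnKC.
by rewrite /u /v; ring.
Qed.

(** The q-Chu-Vandermonde sum cleared of denominators, so that D and D X are
    arbitrary.  The induction replaces X by X Q and splits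
    1 - X = (1 - D X Q^j) - X (1 - D Q^j); the two halves recombine by Pascal's rule. *)
Lemma qVandermonde l X D : qpoch X Q l =
  \sum_(j < l.+1) qpoch Q Q l / (qpoch Q Q j * qpoch Q Q (l - j)) * (- X) ^+ j * Q ^+ 'C(j, 2)
     * qpoch D Q j * qpoch (D * X * Q ^+ j) Q (l - j).
Proof.
elim: l X => [|l IH] X.
  by rewrite big_ord_recl big_ord0 /= bin0n !qpoch0 !expr0 !(mulr1, invr1, addr0).
rewrite qpochSl IH mulr_sumr.
transitivity (\sum_(j < l.+1) (qpoch Q Q l / (qpoch Q Q j * qpoch Q Q (l - j)) * Q ^+ j * (- X) ^+ j
      * Q ^+ 'C(j, 2) * (qpoch D Q j * qpoch (D * X * Q ^+ j) Q (l - j).+1)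
  + qpoch Q Q l / (qpoch Q Q j * qpoch Q Q (l - j)) * (- X) ^+ j.+1
      * Q ^+ 'C(j.+1, 2) * (qpoch D Q j.+1 * qpoch (D * X * Q ^+ j.+1) Q (l - j)))).
  apply: eq_bigr => -[j /= _] _.
  rewrite binS bin1 (qpochSr D) (qpochSl _ _ (l - j)).
  have -> : D * X * Q ^+ j * Q = D * X * Q ^+ j.+1 by rewrite exprS; ring.
  have -> : D * (X * Q) * Q ^+ j = D * X * Q ^+ j.+1 by rewrite exprS; ring.
  rewrite exprD (exprS (- X)) -(mulNr X) exprMn; ring.
rewrite big_split /=.
transitivity (\sum_(j < l.+2) qpoch Q Q l / (qpoch Q Q j * qpoch Q Q (l.+1 - j)) * (Q ^+ j * (1 - Q ^+ (l.+1 - j)))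
    * ((- X) ^+ j * Q ^+ 'C(j, 2) * (qpoch D Q j * qpoch (D * X * Q ^+ j) Q (l.+1 - j)))
  + \sum_(j < l.+2) qpoch Q Q l / (qpoch Q Q j * qpoch Q Q (l.+1 - j)) * (1 - Q ^+ j)
    * ((- X) ^+ j * Q ^+ 'C(j, 2) * (qpoch D Q j * qpoch (D * X * Q ^+ j) Q (l.+1 - j)))).
  congr (_ + _).
    rewrite [RHS]big_ord_recr /= subnn expr0 subrr !(mulr0, mul0r) addr0.
    apply: eq_bigr => -[j /=]; rewrite ltnS => jl _; rewrite subSn // (qpochSr Q Q) -exprS.
    have n1 := nz (l - j); have n2 := nzS (l - j); have n3 := nz j.
    by field; rewrite n1 n2 n3.
  rewrite [RHS]big_ord_recl /= expr0 subrr !(mulr0, mul0r) add0r.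
  apply: eq_bigr => -[j /=]; rewrite ltnS => jl _; rewrite /bump /= add1n subSS (qpochSr Q Q) -exprS.
  have n1 := nz (l - j); have n2 := nzS j; have n3 := nz j.
  by field; rewrite n1 n2 n3.
rewrite -big_split /=; apply: eq_bigr => -[j /=]; rewrite ltnS => jl _.
rewrite (qpochSr Q Q l) -exprS.
have -> : Q ^+ l.+1 = Q ^+ j * Q ^+ (l.+1 - j) by rewrite -exprD subnKC.
have n1 := nz (l.+1 - j); have n3 := nz j.
by field; rewrite n1 n3.
Qed.

End QHahn.

(** * The dual polynomials *)

Section Dual.
Variable K : numFieldType.
Variables Q s2 : K.
Hypothesis Q0 : Q != 0.
Hypothesis s20 : s2 != 0.
Hypothesis nz : forall k, qpoch Q Q k != 0.
Implicit Types (x y z k t : K) (n p j : nat).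

(** With k = q^(4 k_2) and s2 = Q / s^2, [dual_poly p n k] is the polynomial s_n in
    base 1/Q of the theorem up to elementary factors, see [asc_base_inv].  Here the
    degree p and the variable Q^n have exchanged roles, and k may vary. *)
Definition dual_coef p j k : K :=
  qpoch (Q ^- p) Q j * qpoch (k * s2 * Q ^ (p%:Z - 1)) Q j * qpoch (k * Q ^+ j) Q (p - j)
  / qpoch Q Q j * (Q / s2) ^+ j.

Definition dual_poly p n k : K :=
  \sum_(j < p.+1) dual_coef p j k * qpoch (Q ^+ n) Q^-1 j.

Lemma dual_coef_gt p j k : (p < j)%N -> dual_coef p j k = 0.
Proof. by move=> h; rewrite /dual_coef qpoch_terminates // !mul0r. Qed.

Lemma dual_poly_ext N p n k : (p < N)%N ->
  dual_poly p n k = \sum_(j < N) dual_coef p j k * qpoch (Q ^+ n) Q^-1 j.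
Proof.
move=> pN; rewrite /dual_poly -(subnKC pN) big_split_ord /= [X in _ = _ + X]big1 ?addr0 // => i _.
by rewrite dual_coef_gt ?mul0r // ltnS leq_addr.
Qed.

Lemma dual_poly0 n k : dual_poly 0 n k = 1.
Proof.
rewrite /dual_poly big_ord_recl big_ord0 /dual_coef /= !qpoch0 !expr0 invr1.
by rewrite !(mulr1, addr0).
Qed.

Lemma dual_coef_rec0 p k : k * s2 * Q ^+ (2 * p) * dual_coef p.+1 0 k =
  (1 - k * Q ^+ p) * (k * s2 * Q ^+ (2 * p)) * dual_coef p 0 k.
Proof.
by rewrite /dual_coef !subn0 qpochSr !qpoch0 !expr0 invr1 !mulr1; ring.
Qed.

(** Coefficients of [dual_poly_lower]: since
    (Q^(n+1); 1/Q)_(j+1) = (1 - Q^(n+1)) (Q^n; 1/Q)_j, lowering n shifts j. *)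
Lemma dual_coef_recS p j k : (j <= p)%N ->
  k * s2 * Q ^+ (2 * p) * dual_coef p.+1 j.+1 k =
  (1 - k * Q ^+ p) * (k * s2 * Q ^+ (2 * p)) * dual_coef p j.+1 k
  - (1 - k * s2 * Q ^+ (2 * p)) * (k * Q ^+ p * dual_coef p j (k * Q)).
Proof.
have G0 := nz j; have G1 := nzS nz j.
have E2 : Q ^+ (2 * p) = Q ^+ p * Q ^+ p by rewrite mulnC exprM expr2.
have EF n : qpoch (Q ^- n.+1) Q j.+1 = (1 - Q ^- n.+1) * qpoch (Q ^- n) Q j.
  by rewrite qpochSl exprS invfM mulrAC mulVf // mul1r.
have -> : (k * Q ^+ p * dual_coef p j (k * Q)) = k * Q ^+ p * (
   qpoch (Q ^- p) Q j * qpoch (k * s2 * Q ^+ p) Q j * qpoch (k * Q ^+ j.+1) Q (p - j)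
  / qpoch Q Q j * (Q / s2) ^+ j).
  rewrite /dual_coef; have -> : k * Q * s2 * Q ^ (p%:Z - 1) = k * s2 * Q ^+ p.
    by rewrite expfzDr // exprN1 -exprnP; field.
  by rewrite -(mulrA k Q) -exprS.
rewrite leq_eqVlt => /orP[/eqP Ejp|].
  rewrite Ejp in G0 G1 EF *.
  rewrite (@dual_coef_gt p) // mulr0 sub0r /dual_coef !subnn !qpoch0 !mulr1.
  have -> : (p.+1%:Z - 1) = p%:Z by rewrite -addn1 PoszD addrK.
  rewrite -exprnP (EF p) (qpochSr Q Q) -exprS (qpochSr _ _ p) E2.
  move: G0 G1; rewrite !exprS; move: (qpoch (Q ^- p) Q p) (qpoch _ Q p) (qpoch Q Q p) => F Ee G.
  have := expf_neq0 p Q0; move: (Q ^+ p) ((Q / s2) ^+ p) => V T V0 G0 G1.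
  by field; rewrite s20 G0 G1 V0 Q0.
move=> jp; have [i Ei] : {i | p = (j + i).+1}%N by exists (p - j.+1)%N; lia.
subst p; clear jp; rewrite /dual_coef.
have -> : ((j + i).+2 - j.+1 = i.+1)%N by lia.
have -> : ((j + i).+1 - j.+1 = i)%N by lia.
have -> : ((j + i).+1 - j = i.+1)%N by lia.
rewrite EF.
have -> : ((j + i).+2%:Z - 1) = (j + i).+1%:Z by rewrite -addn1 PoszD addrK.
have -> : ((j + i).+1%:Z - 1) = (j + i)%:Z by rewrite -addn1 PoszD addrK.
rewrite -!exprnP E2.
have -> : qpoch (k * s2 * Q ^+ (j + i)) Q j.+1 =
  (1 - k * s2 * Q ^+ (j + i)) * qpoch (k * s2 * Q ^+ (j + i).+1) Q j.
  by rewrite qpochSl exprSr !mulrA.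
rewrite (qpochSr _ _ i) !(qpochSr _ _ j) -exprS.
move: (qpoch (Q ^- (j + i).+1) Q j) (qpoch (k * s2 * _) Q j) (qpoch (k * _) Q i) (qpoch Q Q j) G0 G1 => F Ee D G G0.
have X1 u : u ^+ (j + i).+1 = u * u ^+ j * u ^+ i by rewrite exprS exprD mulrA.
have X2 u : u ^+ (j + i).+2 = u * (u * u ^+ j * u ^+ i) by rewrite exprS X1.
rewrite !X2 !X1 !exprD !exprS.
have := expf_neq0 j Q0; have := expf_neq0 i Q0.
move: (Q ^+ j) (Q ^+ i) ((Q / s2) ^+ j) => V Z T Z0 V0 G1.
by field; rewrite s20 G0 G1 V0 Q0 Z0.
Qed.

Lemma dual_coef_rec0' p k : k * s2 * Q ^+ (2 * p) * dual_coef p.+1 0 k =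
  (1 - k * Q ^+ p) * dual_coef p 0 k
  - (1 - k * s2 * Q ^+ (2 * p)) * ((1 - k) * dual_coef p 0 (k * Q)).
Proof.
rewrite /dual_coef !subn0 !qpoch0 !expr0 invr1 !(mulr1, mul1r).
have -> : (1 - k) * qpoch (k * Q) Q p = qpoch k Q p * (1 - k * Q ^+ p).
  by rewrite -qpochSr qpochSl.
by rewrite qpochSr; ring.
Qed.

(** Coefficients of [dual_poly_raise]: multiplication of (Q^n; 1/Q)_j by 1 - k Q^n
    gives a combination of (Q^n; 1/Q)_j and (Q^n; 1/Q)_(j+1). *)
Lemma dual_coef_recS' p j k : (j <= p)%N ->
  k * s2 * Q ^+ (2 * p) * dual_coef p.+1 j.+1 k =
  (1 - k * Q ^+ p) * dual_coef p j.+1 k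
  - (1 - k * s2 * Q ^+ (2 * p)) * ((1 - k * Q ^+ j.+1) * dual_coef p j.+1 (k * Q)
      + k * Q ^+ j * dual_coef p j (k * Q)).
Proof.
have G0 := nz j; have G1 := nzS nz j.
have E2 : Q ^+ (2 * p) = Q ^+ p * Q ^+ p by rewrite mulnC exprM expr2.
have EF n : qpoch (Q ^- n.+1) Q j.+1 = (1 - Q ^- n.+1) * qpoch (Q ^- n) Q j.
  by rewrite qpochSl exprS invfM mulrAC mulVf // mul1r.
have EC i : dual_coef p i (k * Q) =
   qpoch (Q ^- p) Q i * qpoch (k * s2 * Q ^+ p) Q i * qpoch (k * Q ^+ i.+1) Q (p - i)
  / qpoch Q Q i * (Q / s2) ^+ i.
  rewrite /dual_coef; have -> : k * Q * s2 * Q ^ (p%:Z - 1) = k * s2 * Q ^+ p.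
    by rewrite expfzDr // exprN1 -exprnP; field.
  by rewrite -(mulrA k Q) -exprS.
rewrite leq_eqVlt => /orP[/eqP Ejp|].
  rewrite Ejp in G0 G1 EF *.
  rewrite !(@dual_coef_gt p p.+1) // !mulr0 !add0r EC /dual_coef !subnn !qpoch0 !mulr1.
  have -> : (p.+1%:Z - 1) = p%:Z by rewrite -addn1 PoszD addrK.
  rewrite -exprnP (EF p) (qpochSr Q Q) -exprS (qpochSr _ _ p) E2.
  move: G0 G1; rewrite !exprS; move: (qpoch (Q ^- p) Q p) (qpoch _ Q p) (qpoch Q Q p) => F Ee G.
  have := expf_neq0 p Q0; move: (Q ^+ p) ((Q / s2) ^+ p) => V T V0 G0 G1.
  by field; rewrite s20 G0 G1 V0 Q0.
move=> jp; have [i Ei] : {i | p = (j + i).+1}%N by exists (p - j.+1)%N; lia.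
subst p; clear jp; rewrite !EC /dual_coef.
have -> : ((j + i).+2 - j.+1 = i.+1)%N by lia.
have -> : ((j + i).+1 - j.+1 = i)%N by lia.
have -> : ((j + i).+1 - j = i.+1)%N by lia.
rewrite EF.
have -> : ((j + i).+2%:Z - 1) = (j + i).+1%:Z by rewrite -addn1 PoszD addrK.
have -> : ((j + i).+1%:Z - 1) = (j + i)%:Z by rewrite -addn1 PoszD addrK.
rewrite -!exprnP E2.
have -> : qpoch (k * s2 * Q ^+ (j + i)) Q j.+1 =
  (1 - k * s2 * Q ^+ (j + i)) * qpoch (k * s2 * Q ^+ (j + i).+1) Q j.
  by rewrite qpochSl exprSr !mulrA.
have ED : (1 - k * Q ^+ j.+1) * qpoch (k * Q ^+ j.+2) Q i =
   qpoch (k * Q ^+ j.+1) Q i * (1 - k * Q ^+ j.+1 * Q ^+ i).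
  by rewrite -qpochSr qpochSl (exprSr Q j.+1) mulrA.
rewrite (qpochSr _ _ i) !(qpochSr _ _ j) -!(exprS Q j).
move: (qpoch (Q ^- (j + i).+1) Q j) (qpoch (k * s2 * _) Q j) ED (qpoch Q Q j) G0 G1 => F Ee ED G G0.
move: (qpoch _ Q i) (qpoch _ Q i) ED => D D' ED.
have X1 u : u ^+ (j + i).+1 = u * u ^+ j * u ^+ i by rewrite exprS exprD mulrA.
have X2 u : u ^+ (j + i).+2 = u * (u * u ^+ j * u ^+ i) by rewrite exprS X1.
move: ED; rewrite !X2 !X1 !exprD !exprS.
have := expf_neq0 j Q0; have := expf_neq0 i Q0.
move: (Q ^+ j) (Q ^+ i) ((Q / s2) ^+ j) => V Z T Z0 V0 ED G1.
rewrite [X in _ - _ * (X + _)](_ : _ = F * (1 - (Q * V * Z)^-1 * V)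
   * (Ee * (1 - k * s2 * (Q * V * Z) * V)) * ((1 - k * (Q * V)) * D')
   / (G * (1 - Q * V)) * (Q / s2 * T)); last by ring.
by rewrite ED; field; rewrite s20 G0 G1 V0 Q0 Z0.
Qed.

(** This relation and [dual_poly_raise] both express [dual_poly p.+1] by [dual_poly p],
    the first with n lowered where k is shifted, the second at the same n;
    [tri_step] applies one to each of the two terms into which s_(n+m) is split. *)
Lemma dual_poly_lower p n k : k * s2 * Q ^+ (2 * p) * dual_poly p.+1 n.+1 k =
  (1 - k * Q ^+ p) * (k * s2 * Q ^+ (2 * p)) * dual_poly p n.+1 k
  - (1 - k * s2 * Q ^+ (2 * p)) * (k * Q ^+ p * ((1 - Q ^+ n.+1) * dual_poly p n (k * Q))).
Proof.
rewrite !(@dual_poly_ext p.+2 _ n.+1) // {1}/dual_poly !mulr_sumr !(big_ord_recl p.+1) /=.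
rewrite mulrA dual_coef_rec0; set S1 := \sum_(i < p.+1) _.
set S2 := \sum_(i < p.+1) _; set S3 := \sum_(i < p.+1) _.
suff -> : S1 = S2 - S3 by ring.
rewrite -sumrB; apply: eq_bigr => -[j /= jp] _; rewrite /bump /= add1n.
rewrite mulrA dual_coef_recS // qpochSl exprS (mulrC Q) mulfK //.
by ring.
Qed.

Lemma dual_poly_lower0 p k : k * s2 * Q ^+ (2 * p) * dual_poly p.+1 0 k =
  (1 - k * Q ^+ p) * (k * s2 * Q ^+ (2 * p)) * dual_poly p 0 k.
Proof.
have E p' : dual_poly p' 0 k = dual_coef p' 0 k.
  rewrite /dual_poly big_ord_recl big1 ?addr0 ?qpoch0 ?mulr1 // => i _.
  by rewrite qpochSl expr0 subrr mul0r mulr0.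
by rewrite !E dual_coef_rec0.
Qed.

Lemma dual_poly_raise p n k : k * s2 * Q ^+ (2 * p) * dual_poly p.+1 n k =
  (1 - k * Q ^+ p) * dual_poly p n k
  - (1 - k * s2 * Q ^+ (2 * p)) * ((1 - k * Q ^+ n) * dual_poly p n (k * Q)).
Proof.
have step j : (1 - k * Q ^+ n) * qpoch (Q ^+ n) Q^-1 j =
   (1 - k * Q ^+ j) * qpoch (Q ^+ n) Q^-1 j + k * Q ^+ j * qpoch (Q ^+ n) Q^-1 j.+1.
  by rewrite qpochSr exprVn; have := expf_neq0 j Q0; move: (Q ^+ j) => V V0; field.
have -> : (1 - k * Q ^+ n) * dual_poly p n (k * Q) =
   \sum_(j < p.+2) (1 - k * Q ^+ j) * dual_coef p j (k * Q) * qpoch (Q ^+ n) Q^-1 j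
   + \sum_(j < p.+1) k * Q ^+ j * dual_coef p j (k * Q) * qpoch (Q ^+ n) Q^-1 j.+1.
  rewrite big_ord_recr /= (@dual_coef_gt p p.+1) // mulr0 mul0r addr0 -big_split /=.
  rewrite /dual_poly mulr_sumr; apply: eq_bigr => j _.
  rewrite mulrCA step; ring.
rewrite !(@dual_poly_ext p.+2) // !mulrDr !mulr_sumr !(big_ord_recl p.+1) /=.
set S1 := \sum_(i < p.+1) _; set S2 := \sum_(i < p.+1) _; set S3 := \sum_(i < p.+1) _.
set S4 := \sum_(i < p.+1) _.
rewrite mulrA dual_coef_rec0' !expr0 !mulr1.
suff -> : S1 = S2 - S3 - S4 by ring.
rewrite -!sumrB; apply: eq_bigr => -[j /= jp] _; rewrite /bump /= add1n.
by rewrite mulrA dual_coef_recS' //; ring.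
Qed.

End Dual.

Section DualASC.
Variable K : numFieldType.
Variable Q : K.
Hypothesis Q0 : Q != 0.
Hypothesis nz : forall k, qpoch Q Q k != 0.
Implicit Types (x y z t h s : K) (n p j k : nat).

Lemma qpoch_base_inv x k : x != 0 ->
  qpoch x Q^-1 k = qpoch x^-1 Q k * (- x) ^+ k * Q^-1 ^+ 'C(k, 2).
Proof.
move=> x0; elim: k => [|k IH]; first by rewrite !qpoch0 bin0n !expr0 !mulr1.
rewrite !qpochSr IH binS bin1 exprD exprS !exprVn.
have := expf_neq0 k Q0; have := expf_neq0 'C(k, 2) Q0.
by move: (Q ^+ k) (Q ^+ 'C(k, 2)) ((- x) ^+ k) => V W T W0 V0; field; rewrite V0 W0 x0.
Qed.

Lemma bin2D k n : ('C(k + n, 2) = 'C(k, 2) + k * n + 'C(n, 2))%N.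
Proof.
elim: n => [|n IH]; first by rewrite addn0 muln0 bin0n !addn0.
by rewrite addnS !binS !bin1 IH; lia.
Qed.

(** Both sides are sums over k of multiples of (Q^n; 1/Q)_k, which vanish for k > n
    and for k > p; the variable h Q^p / s makes one factor of [qpoch_pair] equal to
    (Q^p; 1/Q)_k.  It remains to rewrite base 1/Q as base Q termwise. *)
Lemma asc_base_inv n p h s : h != 0 -> s != 0 -> (forall k, qpoch (h ^+ 2) Q k != 0) ->
  al_salam_chihara n (mu (h * Q ^+ p / s)) (s / h) (h^-1 / s) Q^-1 =
  (- (h * s)) ^- n * Q ^- 'C(n, 2) * qpoch (h ^+ 2) Q n / qpoch (h ^+ 2) Q p
  * dual_poly Q (Q / s ^+ 2) p n (h ^+ 2).
Proof.
move=> h0 s0 hn.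
have Qp0 := expf_neq0 p Q0.
have z0 : h * Q ^+ p / s != 0 by rewrite !mulf_neq0 ?invr_eq0.
rewrite /al_salam_chihara (@aw_sum_ext _ (n + p).+1) ?invr_eq0 //; last by rewrite ltnS leq_addr.
rewrite (@dual_poly_ext _ Q _ _ (n + p).+1) //; last by rewrite ltnS leq_addl.
rewrite mulr_sumr; apply: eq_bigr => -[k /= _] _.
rewrite qpoch_pairE // /qpochs !big_cons big_nil mulr1.
have -> : s / h * (h * Q ^+ p / s) = Q ^+ p by field; rewrite h0 s0.
have [nk|kn] := ltnP n k.
  rewrite aw_coef_gt ?invr_eq0 // mul0r.
  have := @qpoch_terminates _ Q^-1 n k; rewrite invr_eq0 => /(_ Q0 nk).
  by rewrite -exprVn invrK => ->; rewrite !mulr0.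
have [pk|kp] := ltnP p k.
  rewrite dual_coef_gt // mul0r mulr0.
  have := @qpoch_terminates _ Q^-1 p k; rewrite invr_eq0 => /(_ Q0 pk).
  by rewrite -exprVn invrK => ->; rewrite !(mul0r, mulr0).
rewrite /aw_coef !(mulr0, mul0r) !qpoch_const0 !mulr1.
have -> : Q^-1 ^- n = Q ^+ n by rewrite -exprVn invrK.
rewrite (qpoch_base_inv _ Qp0) (qpoch_base_inv k (x := Q^-1)) ?invr_eq0 // invrK.
have -> : s / h / (h * Q ^+ p / s) = s ^+ 2 / (h ^+ 2 * Q ^+ p).
  by field; rewrite h0 s0 Qp0.
have -> : s / h * (h^-1 / s) * Q^-1 ^+ k = (h ^+ 2 * Q ^+ k)^-1.
  by rewrite exprVn; have := expf_neq0 k Q0; move: (Q ^+ k) => V V0; field; rewrite h0 s0 V0.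
have hQ0 j : h ^+ 2 * Q ^+ j != 0 by rewrite mulf_neq0 ?expf_neq0.
rewrite (qpoch_base_inv _ (x := s ^+ 2 / _)); last by rewrite mulf_neq0 ?expf_neq0 ?invr_eq0.
rewrite (qpoch_base_inv (n - k)) ?invr_eq0 // invrK invf_div.
rewrite /dual_coef.
have -> : h ^+ 2 * (Q / s ^+ 2) * Q ^ (p%:Z - 1) = h ^+ 2 * Q ^+ p / s ^+ 2.
  by rewrite expfzDr // exprN1 -exprnP; field; rewrite Q0 s0.
have En : qpoch (h ^+ 2) Q n = qpoch (h ^+ 2) Q k * qpoch (h ^+ 2 * Q ^+ k) Q (n - k).
  by rewrite -qpochD subnKC.
have Ep : qpoch (h ^+ 2) Q p = qpoch (h ^+ 2) Q k * qpoch (h ^+ 2 * Q ^+ k) Q (p - k).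
  by rewrite -qpochD subnKC.
have := hn p; rewrite En Ep mulf_eq0 negb_or => /andP[n1 n2].
have n3 := nz k.
have EC : Q ^+ 'C(n, 2) = Q ^+ 'C(k, 2) * (Q ^+ k) ^+ (n - k) * Q ^+ 'C(n - k, 2).
  by rewrite -exprM -!exprD -bin2D subnKC.
rewrite EC.
move: (qpoch (Q ^+ n) _ _) (qpoch (Q ^- p) _ _) (qpoch (h ^+ 2 * Q ^+ p / _) _ _) (qpoch (h ^+ 2 * Q ^+ k) Q (n - k)) => G1 G2 G3 G4.
move: (qpoch _ Q (p - k)) (qpoch (h ^+ 2) Q k) (qpoch Q Q k) n1 n2 n3 => G5 G6 G7 n1 n2 n3.
have ES u : u ^+ n = u ^+ k * u ^+ (n - k) :> K by rewrite -exprD subnKC.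
(* signs are powers of an abstract e, which cancels from both sides *)
have [e Ee] : {e : K | e = -1} by exists (-1).
have Ne u : - u = e * u by rewrite Ee mulN1r.
have e0 : e != 0 by rewrite Ee oppr_eq0 oner_eq0.
have -> : (- (h * s)) ^- n = (-1) ^+ n * (h * s) ^- n by rewrite (exprNn (h * s)) invfM invr_sign.
have -> : Q / (Q / s ^+ 2) = s * s by field; rewrite Q0 s0.
rewrite -Ee !ES !Ne !exprMn !exprVn !exprMn.
have Qk0 := expf_neq0 k Q0.
have Qkk0 := expf_neq0 (n - k) Qk0.
have := expf_neq0 'C(k, 2) Q0; have := expf_neq0 'C(n - k, 2) Q0.
have := expf_neq0 k h0; have := expf_neq0 k s0; have := expf_neq0 k e0; have := expf_neq0 (n - k) h0.
have := expf_neq0 (n - k) s0; have := expf_neq0 k Qp0.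
move: (Q ^+ k ^+ (n - k)) (Q ^+ p ^+ k) (Q ^+ 'C(n - k, 2)) (Q ^+ 'C(k, 2)) Qkk0 => V1 V2 V3 V4.
move: (h ^+ k) (h ^+ (n - k)) (s ^+ k) (s ^+ (n - k)) (e ^+ k) (Q ^+ k) Qk0 => W1 W2 W3 W4 W5 W6.
move=> *; field; do ?[apply/andP; split]; by [].
Qed.
End DualASC.

(** * Complete fields with a real absolute value *)

(** The properties of the complex numbers on which the convergence arguments rest.
    Absolute values are taken in R, so that real estimates apply to them, and the
    carrier is abstract, so that computations never unfold a complex number into
    its two coordinates. *)
Record completeField (R : realType) := CompleteField {
  cfield :> numFieldType;
  cfR : {rmorphism R -> cfield};
  cabs : cfield -> R;
  ler_cfR : forall a b, (cfR a <= cfR b) = (a <= b);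
  cabs_normE : forall z, `|z| = cfR (cabs z);
  cabs_complete : forall (u : nat -> cfield) (M : nat -> R),
    (forall n, cabs (u n) <= M n) -> cvgn (series M) ->
    exists l : cfield, forall e : R, 0 < e ->
      \forall n \near \oo, cabs (series u n - l) <= e }.

Arguments cfR {R} c.
Arguments cabs {R c}.

Section Modulus.
Variables (R : realType) (C : completeField R).
Local Notation ofR := (cfR C).
Implicit Types (x y z : C) (a b e : R).

Lemma ler_ofR a b : (ofR a <= ofR b) = (a <= b).
Proof. exact: ler_cfR. Qed.
Lemma ltr_ofR a b : (ofR a < ofR b) = (a < b).
Proof. by rewrite !lt_neqAle ler_ofR (inj_eq (fmorph_inj ofR)). Qed.
Lemma ofR_eq0 a : (ofR a == 0) = (a == 0).
Proof. exact: fmorph_eq0. Qed.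
Lemma cabsE z : `|z| = ofR (cabs z).
Proof. exact: cabs_normE. Qed.
Lemma ofR_inj : injective ofR. Proof. exact: fmorph_inj. Qed.

Lemma cabs_ge0 z : 0 <= cabs z.
Proof. by rewrite -ler_ofR rmorph0 -cabsE normr_ge0. Qed.
Lemma cabsM x y : cabs (x * y) = cabs x * cabs y.
Proof. by apply: ofR_inj; rewrite rmorphM -!cabsE normrM. Qed.
Lemma cabsD x y : cabs (x + y) <= cabs x + cabs y.
Proof. by rewrite -ler_ofR rmorphD -!cabsE ler_normD. Qed.
Lemma cabsN x : cabs (- x) = cabs x.
Proof. by apply: ofR_inj; rewrite -!cabsE normrN. Qed.
Lemma cabsB x y : cabs (x - y) <= cabs x + cabs y.
Proof. by rewrite (le_trans (cabsD _ _)) // cabsN. Qed.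
Lemma cabs_distC x y : cabs (x - y) = cabs (y - x).
Proof. by rewrite -cabsN opprB. Qed.
Lemma cabs0 : cabs (0 : C) = 0. Proof. by apply: ofR_inj; rewrite -cabsE normr0 rmorph0. Qed.
Lemma cabs1 : cabs (1 : C) = 1. Proof. by apply: ofR_inj; rewrite -cabsE normr1 rmorph1. Qed.
Lemma cabs_eq0 x : (cabs x == 0) = (x == 0).
Proof. by rewrite -ofR_eq0 -cabsE normr_eq0. Qed.
Lemma cabsV x : cabs x^-1 = (cabs x)^-1.
Proof. by apply: ofR_inj; rewrite fmorphV -!cabsE normfV. Qed.
Lemma cabsX x n : cabs (x ^+ n) = cabs x ^+ n.
Proof. by apply: ofR_inj; rewrite rmorphXn -!cabsE normrX. Qed.
Lemma cabs_ofR a : cabs (ofR a) = `|a|.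
Proof.
apply: ofR_inj; rewrite -cabsE; have [a0|a0] := leP 0 a.
  by rewrite (ger0_norm a0) ger0_norm // -(rmorph0 ofR) ler_ofR.
by rewrite (ltr0_norm a0) ltr0_norm ?rmorphN // -(rmorph0 ofR) ltr_ofR.
Qed.
Lemma cabs_sum (I : Type) (r : seq I) (P : pred I) (F : I -> C) :
  cabs (\sum_(i <- r | P i) F i) <= \sum_(i <- r | P i) cabs (F i).
Proof.
elim/big_ind2: _ => [|x a y b h1 h2|//]; first by rewrite cabs0.
by rewrite (le_trans (cabsD _ _)) // lerD.
Qed.
Lemma cvg_cabsP (u : nat -> C) (l : C) :
  (forall e, 0 < e -> \forall n \near \oo, cabs (u n - l) <= e) <-> u @ \oo --> l.
Proof.
split=> [h|/cvgrPdist_le h e e0].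
  apply/cvgrPdist_le => e e0.
  have [e' Ee] : exists e', e = ofR e'.
    by exists (cabs e); rewrite -cabsE gtr0_norm.
  rewrite Ee -(rmorph0 ofR) ltr_ofR in e0 *.
  by near=> n; rewrite cabsE ler_ofR cabs_distC; near: n; exact: h.
have e0' : 0 < ofR e by rewrite -(rmorph0 ofR) ltr_ofR.
have := h _ e0'; apply: filterS => n.
by rewrite cabsE ler_ofR cabs_distC.
Unshelve. all: by end_near. Qed.

End Modulus.

(** * Limits and dominated series *)

Section Limits.
Variable K : numFieldType.
Implicit Types (u v : nat -> K) (a b x l : K).

(** Boxed, so that unification does not unfold the inclusion of filters. *)
Variant tends u a : Prop := Tends of u @ \oo --> a.

Lemma tendsP u a : tends u a <-> u @ \oo --> a.
Proof. by split=> [[]|]. Qed.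

Lemma tends_mul u v a b : tends u a -> tends v b -> tends (fun n => u n * v n) (a * b).
Proof. by move=> [h] [h']; split; exact: cvgM. Qed.
Lemma tends_add u v a b : tends u a -> tends v b -> tends (fun n => u n + v n) (a + b).
Proof. by move=> [h] [h']; split; exact: cvgD. Qed.
Lemma tends_sub u v a b : tends u a -> tends v b -> tends (fun n => u n - v n) (a - b).
Proof. by move=> [h] [h']; split; exact: cvgB. Qed.
Lemma tends_cst a : tends (fun=> a) a.
Proof. by split; exact: cvg_cst. Qed.
Lemma eq_tends u v a : tends u a -> u =1 v -> tends v a.
Proof. by move=> h /funext <-. Qed.
Lemma tends_unique u a b : tends u a -> tends u b -> a = b.
Proof. by move=> [h] [h']; exact: (cvg_unique _ h h'). Qed.
Lemma tends_shift n u a : tends (fun k => u (k + n)%N) a <-> tends u a.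
Proof. by rewrite !tendsP cvg_shiftn. Qed.
Lemma tends_lim u a : tends u a -> lim (u @ \oo) = a.
Proof. by move=> [h]; exact: (cvg_lim _ h). Qed.

Lemma tends_finsum (I : finType) (F : nat -> I -> K) (G : I -> K) :
  (forall i, tends (fun n => F n i) (G i)) -> tends (fun n => \sum_i F n i) (\sum_i G i).
Proof.
move=> h; have E (f : I -> K) : \sum_i f i = \sum_(i <- enum I) f i by rewrite big_enum.
rewrite E; suff: tends (fun n => \sum_(i <- enum I) F n i) (\sum_(i <- enum I) G i).
  by move=> t; apply: (eq_tends t) => n; rewrite E.
elim: (enum I) => [|i s IH].
  by rewrite big_nil; apply: (eq_tends (tends_cst _)) => n; rewrite big_nil.
by rewrite big_cons; apply: (eq_tends (tends_add (h i) IH)) => n; rewrite big_cons.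
Qed.

Definition sums u a := tends (series u) a.

Lemma sums_unique u a b : sums u a -> sums u b -> a = b.
Proof. exact: tends_unique. Qed.

Lemma eq_sums u v a : sums u a -> u =1 v -> sums v a.
Proof. by move=> h /funext <-. Qed.

Lemma sumsZ x u l : sums u l -> sums (fun n => x * u n) (x * l).
Proof.
move=> h; apply: (eq_tends (tends_mul (tends_cst x) h)) => n.
by rewrite /series /= mulr_sumr.
Qed.

Lemma sumsD u v l l' : sums u l -> sums v l' -> sums (fun n => u n + v n) (l + l').
Proof.
move=> h h'; apply: (eq_tends (tends_add h h')) => n.
by rewrite /series /= big_split.
Qed.

Lemma sums0 : sums (fun=> 0) 0.
Proof. by apply: (eq_tends (tends_cst (0 : K))) => n; rewrite /series /= big1. Qed.

Lemma sums_telescope u : tends u 0 -> sums (fun n => u n.+1 - u n) (- u 0%N).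
Proof.
move=> h; rewrite -[- _]add0r; apply: (eq_tends (tends_sub h (tends_cst _))) => n.
by rewrite /series /= telescope_sumr.
Qed.

Lemma sums_shift n u l : sums (fun k => u (n + k)%N) l -> sums u (series u n + l).
Proof.
move=> h; apply/(tends_shift n); apply: (eq_tends (tends_add (tends_cst _) h)) => k.
rewrite series_addn; congr (_ + _); rewrite -{2}[n]add0n big_addn addnK /series /=.
by apply: eq_bigr => i _; rewrite addnC.
Qed.

End Limits.

Section Sums.
Variables (R : realType) (C : completeField R).
Implicit Types (x y z l : C) (a b c e r : R) (u v : nat -> C).

Lemma tends_cabsP u l :
  (forall e, 0 < e -> \forall n \near \oo, cabs (u n - l) <= e) <-> tends u l.
Proof. by rewrite tendsP; exact: cvg_cabsP. Qed.

Lemma tends_cabs_le u l b : tends u l -> (\forall n \near \oo, cabs (u n) <= b) -> cabs l <= b.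
Proof.
move=> /tends_cabsP ul ub; apply/ler_addgt0Pr => e e0.
near \oo => m; have -> : l = u m - (u m - l) by ring.
rewrite (le_trans (cabsB _ _)) // lerD //; first by near: m.
by near: m; exact: ul.
Unshelve. all: by end_near. Qed.

Section Geometric.
Variables (c r : R).
Hypotheses (c0 : 0 <= c) (r0 : 0 <= r) (r1 : r < 1).

Lemma geometric_tail_cvg0 e : 0 < e -> \forall n \near \oo, c * r ^+ n / (1 - r) <= e.
Proof.
move=> e0; have h : `|r| < 1 by rewrite ger0_norm.
have /cvgrPdist_le/(_ _ (mulr_gt0 e0 (_ : 0 < 1 - r))) := cvg_geometric c h.
rewrite subr_gt0 => /(_ r1); apply: filterS => n /=.
rewrite sub0r normrN ger0_norm ?mulr_ge0 ?exprn_ge0 // => h'.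
by rewrite ler_pdivrMr // subr_gt0.
Qed.

Lemma geometric_partial m n : \sum_(m <= k < n) c * r ^+ k <= c * r ^+ m / (1 - r).
Proof.
rewrite ler_pdivlMr ?subr_gt0 //.
have [mn|nm] := leqP m n; last by rewrite big_geq ?mul0r ?mulr_ge0 ?exprn_ge0 // ltnW.
suff -> : (\sum_(m <= k < n) c * r ^+ k) * (1 - r) = c * r ^+ m - c * r ^+ n.
  by rewrite lerBlDr lerDl mulr_ge0 // exprn_ge0.
rewrite -[RHS]opprB -(telescope_sumr (fun k => c * r ^+ k) mn) mulr_suml -sumrN.
by apply: eq_bigr => k _; rewrite exprS; ring.
Qed.

Lemma geometric_dominated u : (forall n, cabs (u n) <= c * r ^+ n) -> exists l, sums u l.
Proof.
move=> h; have [|l hl] := cabs_complete h; last by exists l; apply/tends_cabsP.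
  apply: is_cvg_geometric_series.
by rewrite ger0_norm.
Qed.

Lemma sums_tail u l n : (forall n, cabs (u n) <= c * r ^+ n) -> sums u l ->
  cabs (l - series u n) <= c * r ^+ n / (1 - r).
Proof.
move=> h ul.
have ul' := tends_sub ul (tends_cst (series u n)).
apply: (tends_cabs_le ul'); near=> k.
have nk : (n <= k)%N by near: k; exact: nbhs_infty_ge.
rewrite sub_series_geq // (le_trans (cabs_sum _ _ _)) //.
by rewrite (le_trans _ (geometric_partial n k)) // ler_sum.
Unshelve. all: by end_near. Qed.

Lemma sums_le u l : (forall n, cabs (u n) <= c * r ^+ n) -> sums u l -> cabs l <= c / (1 - r).
Proof.
move=> h /(sums_tail 0 h); rewrite /series /= big_geq // subr0 expr0 mulr1 //.
Qed.

(** Cut all series at an index K after which the geometric majorant contributes at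
    most e / 3; only finitely many terms remain, and those converge. *)
Lemma tannery (F : nat -> nat -> C) (G : nat -> C) (s : nat -> C) :
  (forall n k, cabs (F n k) <= c * r ^+ k) -> (forall n, sums (F n) (s n)) ->
  (forall k, tends (F^~ k) (G k)) ->
  exists2 l, sums G l & tends s l.
Proof.
move=> FM Fs FG.
have GM k : cabs (G k) <= c * r ^+ k.
  by apply: (tends_cabs_le (FG k)); near=> n; exact: FM.
have [l Gl] := geometric_dominated GM; exists l => //.
apply/tends_cabsP => e e0; have e3 : 0 < e / 3 by rewrite divr_gt0.
have [K _ /(_ K (leqnn K)) hK] := geometric_tail_cvg0 e3.
have cK : tends (fun n => series (F n) K) (series G K).
  rewrite /series /= big_mkord; apply: (eq_tends (tends_finsum (fun i : 'I_K => FG i))) => n.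
  by rewrite big_mkord.
move/tends_cabsP: cK => /(_ _ e3) cK; near=> n.
have -> : s n - l = (s n - series (F n) K) + (series (F n) K - series G K) - (l - series G K) by ring.
rewrite (le_trans (cabsB _ _)) // (_ : e = e / 3 + e / 3 + e / 3); last by field.
rewrite lerD //; last by rewrite (le_trans (sums_tail _ GM Gl)).
rewrite (le_trans (cabsD _ _)) // lerD //; last by near: n.
by rewrite (le_trans (sums_tail _ (FM n) (Fs n))).
Unshelve. all: by end_near. Qed.

End Geometric.

(** The sum over the first n antidiagonals is a sum over rows i < n, truncated to
    length n - i; each truncated row tends to its sum, under a geometric majorant
    in i, so [tannery] applies. *)
Lemma antidiagonal_sums c r (F : nat -> nat -> C) (s : nat -> C) :
  0 <= c -> 0 <= r -> r < 1 ->
  (forall i j, cabs (F i j) <= c * r ^+ i * r ^+ j) -> (forall i, sums (F i) (s i)) ->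
  exists2 l, sums s l & sums (fun n => \sum_(i < n.+1) F i (n - i)%N) l.
Proof.
move=> c0 r0 r1 FM Fs.
pose T n i : C := if (i < n)%N then series (F i) (n - i)%N else 0.
have Tsum n : sums (T n) (\sum_(k < n) series (F k) (n - k)%N).
  have -> : \sum_(k < n) series (F k) (n - k)%N = series (T n) n + 0.
    rewrite addr0 /series /= [RHS]big_mkord; apply: eq_bigr => i _.
    by rewrite /T ltn_ord.
  by apply: sums_shift; apply: (eq_sums (sums0 _)) => i; rewrite /T ltnNge leq_addr.
have cr : 0 <= c / (1 - r) by rewrite divr_ge0 // subr_ge0 ltW.
have TM n i : cabs (T n i) <= c / (1 - r) * r ^+ i.
  rewrite /T; case: ifP => _; last by rewrite cabs0 mulr_ge0 ?exprn_ge0.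
  rewrite (le_trans (cabs_sum _ _ _)) //.
  rewrite (@le_trans _ _ (\sum_(0 <= k < n - i) c * r ^+ k * r ^+ i)) //.
    by apply: ler_sum => k _; rewrite mulrAC FM.
  rewrite -mulr_suml ler_wpM2r ?exprn_ge0 //.
  by rewrite (le_trans (geometric_partial c0 r0 r1 _ _)) // expr0 mulr1.
have TG i : tends (T^~ i) (s i).
  apply/tends_cabsP => e e0; have /tends_cabsP/(_ _ e0) [K _ hK] := Fs i.
  near=> n; have h : (i + K < n)%N by near: n; exact: nbhs_infty_gt.
  have -> : T n i = series (F i) (n - i)%N by rewrite /T ifT //; lia.
  by apply: hK => /=; lia.
have [l sl Tl] := tannery cr r0 r1 TM Tsum TG; exists l => //.
apply: (eq_tends Tl) => n; rewrite /series /= big_mkord.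
elim: n => [|n IH]; first by rewrite !big_ord0.
rewrite [RHS]big_ord_recr /= -IH [LHS]big_ord_recr /= [X in _ = _ + X]big_ord_recr /=.
rewrite subnn subSnn addrA -big_split /= big_mkord big_ord_recl big_ord0 addr0.
congr (_ + _); apply: eq_bigr => -[i /= ni] _.
by rewrite subSn 1?ltnW // !big_mkord big_ord_recr.
Unshelve. all: by end_near. Qed.

End Sums.

(** * Infinite q-shifted factorials *)

Section QInf.
Variables (R : realType) (C : completeField R).
Local Notation ofR := (cfR C).
Variable qr : R.
Hypotheses (qr0 : 0 < qr) (qr1 : qr < 1).
Local Notation Q := (ofR qr).
Implicit Types (x y z l : C) (a b c e r : R) (u v : nat -> C).

Lemma cabsQ : cabs Q = qr. Proof. by rewrite cabs_ofR gtr0_norm. Qed.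
Lemma Qneq0 : Q != 0. Proof. by rewrite ofR_eq0 gt_eqF. Qed.
Lemma omq_gt0 : 0 < 1 - qr. Proof. by rewrite subr_gt0. Qed.
Lemma qrn_le1 n : qr ^+ n <= 1. Proof. by rewrite exprn_ile1 // ltW. Qed.
Lemma qrn_ge0 n : 0 <= qr ^+ n. Proof. by rewrite exprn_ge0 // ltW. Qed.

Lemma tends_expr z : cabs z < 1 -> tends (fun n => z ^+ n) 0.
Proof.
move=> z1; apply/tends_cabsP => e e0; have z0 := cabs_ge0 z.
have := @cvg_geometric R 1 (cabs z); rewrite ger0_norm // => /(_ z1).
move/cvgrPdist_le => /(_ _ e0); apply: filterS => n /=.
by rewrite mul1r sub0r normrN ger0_norm ?exprn_ge0 // subr0 cabsX.
Qed.

Lemma tends_Qn : tends (fun n => Q ^+ n) 0.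
Proof. by apply: tends_expr; rewrite cabsQ. Qed.

(** exp (a / (1 - Q)), a bound for the product of the 1 + a Q^j. *)
Definition Ebound a : R := expR (a / (1 - qr)).

Lemma Ebound_ge0 a : 0 <= Ebound a. Proof. exact: expR_ge0. Qed.

Lemma Ebound_le a b : a <= b -> Ebound a <= Ebound b.
Proof. by move=> h; rewrite ler_expR ler_pM2r // invr_gt0 omq_gt0. Qed.

Lemma sum_geometric_le a n : 0 <= a -> \sum_(j < n) a * qr ^+ j <= a / (1 - qr).
Proof.
move=> a0; have := geometric_partial a0 (ltW qr0) qr1 0 n.
by rewrite expr0 mulr1 big_mkord.
Qed.

Lemma cabs_1B x k : cabs (1 - x * Q ^+ k) <= 1 + cabs x * qr ^+ k.
Proof. by rewrite (le_trans (cabsB _ _)) // cabs1 cabsM cabsX cabsQ. Qed.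

Lemma cabs_qpoch_le x n : cabs (qpoch x Q n) <= Ebound (cabs x).
Proof.
suff h : cabs (qpoch x Q n) <= expR (\sum_(j < n) cabs x * qr ^+ j).
  by rewrite (le_trans h) // ler_expR sum_geometric_le // cabs_ge0.
elim: n => [|n IH]; first by rewrite qpoch0 big_ord0 expR0 cabs1.
rewrite qpochSr cabsM big_ord_recr /= expRD ler_pM ?cabs_ge0 //.
by rewrite (le_trans (cabs_1B _ _)) // expR_ge1Dx.
Qed.

(** From 1 / (1 - t) = 1 + t / (1 - t) <= exp (t / (1 - t)) with t = |x| Q^j, and
    1 - t >= 1 - |x|. *)
Lemma cabs_qpoch_inv_le x n : cabs x < 1 ->
  qpoch x Q n != 0 /\ (cabs (qpoch x Q n))^-1 <= Ebound (cabs x / (1 - cabs x)).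
Proof.
move=> x1; have x0 := cabs_ge0 x.
have ox : 0 < 1 - cabs x by rewrite subr_gt0.
suff [h1 h2] : qpoch x Q n != 0 /\
   (cabs (qpoch x Q n))^-1 <= expR (\sum_(j < n) cabs x / (1 - cabs x) * qr ^+ j).
  split=> //; rewrite (le_trans h2) // ler_expR sum_geometric_le //.
  by rewrite divr_ge0 // ltW.
elim: n => [|n [IH1 IH2]]; first by rewrite qpoch0 big_ord0 expR0 cabs1 invr1 oner_neq0.
have xq : cabs x * qr ^+ n <= cabs x by rewrite ler_piMr // qrn_le1.
have h : 1 - cabs x * qr ^+ n <= cabs (1 - x * Q ^+ n).
  have := cabsD (1 - x * Q ^+ n) (x * Q ^+ n).
  by rewrite subrK cabs1 cabsM cabsX cabsQ lerBlDr.
have p1 : 0 < 1 - cabs x * qr ^+ n by rewrite subr_gt0 (le_lt_trans xq).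
have p2 := lt_le_trans p1 h.
split; first by rewrite qpochSr mulf_neq0 // -cabs_eq0 gt_eqF.
rewrite qpochSr cabsM invfM big_ord_recr /= expRD ler_pM ?invr_ge0 ?cabs_ge0 //.
rewrite (@le_trans _ _ (1 - cabs x * qr ^+ n)^-1) ?lef_pV2 //.
have -> : (1 - cabs x * qr ^+ n)^-1 = 1 + cabs x * qr ^+ n / (1 - cabs x * qr ^+ n).
  by field; rewrite gt_eqF.
rewrite (le_trans (expR_ge1Dx _)) // ler_expR [leRHS]mulrAC ler_wpM2l ?mulr_ge0 ?qrn_ge0 //.
by rewrite lef_pV2 // lerD2l lerN2.
Qed.

Lemma qpoch_neq0_small x n : cabs x < 1 -> qpoch x Q n != 0.
Proof. by move=> /cabs_qpoch_inv_le h; case: (h n). Qed.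

Lemma nzQ k : qpoch Q Q k != 0.
Proof. by apply: qpoch_neq0_small; rewrite cabsQ. Qed.

(** A bound for (x; Q)_n / (Q; Q)_n, uniform in n and in |x| <= a. *)
Definition qbound a := Ebound a * Ebound (qr / (1 - qr)).

Lemma qbound_ge0 a : 0 <= qbound a.
Proof. by rewrite mulr_ge0 ?Ebound_ge0. Qed.

Lemma qbound_le a b : a <= b -> qbound a <= qbound b.
Proof. by move=> h; rewrite ler_wpM2r ?Ebound_ge0 // Ebound_le. Qed.

Lemma cabs_qbin_le x n : cabs (qbin Q x n) <= qbound (cabs x).
Proof.
rewrite /qbin cabsM cabsV ler_pM ?invr_ge0 ?cabs_ge0 ?cabs_qpoch_le //.
have := @cabs_qpoch_inv_le Q n; rewrite cabsQ => /(_ qr1) [_].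
by [].
Qed.

Lemma cabs_qpochQV_le n : cabs (qpoch Q Q n)^-1 <= qbound 0.
Proof.
have := cabs_qbin_le 0 n; rewrite /qbin qpoch_const0 mul1r cabs0 //.
Qed.

(** The product as the sum of the increments of its partial products; this gives
    its existence and, by [sums_le], its distance to 1. *)
Lemma qpoch_inf_sums x :
  sums (fun k => - (x * Q ^+ k * qpoch x Q k)) (qpoch_inf x Q - 1).
Proof.
have c0 : 0 <= cabs x * Ebound (cabs x) by rewrite mulr_ge0 ?cabs_ge0 ?Ebound_ge0.
have [|l hl] := @geometric_dominated _ C (cabs x * Ebound (cabs x)) qr (ltW qr0) qr1 (fun k => - (x * Q ^+ k * qpoch x Q k)).
  move=> n; rewrite cabsN !cabsM cabsX cabsQ mulrAC.
  by rewrite ler_wpM2r ?qrn_ge0 // ler_wpM2l ?cabs_ge0 // cabs_qpoch_le.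
suff h : tends (qpoch x Q) (1 + l) by rewrite /qpoch_inf (tends_lim h) addrC addKr.
apply: (eq_tends (tends_add (tends_cst 1) hl)) => n.
elim: n => [|n IH]; first by rewrite qpoch0 /series /= big_geq // addr0.
by rewrite seriesSr addrA IH qpochSr; ring.
Qed.

Lemma tends_qpoch x : tends (qpoch x Q) (qpoch_inf x Q).
Proof.
have := tends_add (tends_cst (1 : C)) (qpoch_inf_sums x).
rewrite addrC subrK => h; apply: (eq_tends h) => n.
elim: n => [|n IH]; first by rewrite qpoch0 /series /= big_geq // addr0.
by rewrite seriesSr addrA IH qpochSr; ring.
Qed.

Lemma qpoch_inf_split n x : qpoch_inf x Q = qpoch x Q n * qpoch_inf (x * Q ^+ n) Q.
Proof.
have h : tends (fun k => qpoch x Q (k + n)) (qpoch_inf x Q).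
  by apply/tends_shift; exact: tends_qpoch.
apply: (tends_unique h); apply: (eq_tends (tends_mul (tends_cst _) (tends_qpoch _))) => k.
by rewrite addnC qpochD.
Qed.

Lemma qpoch_infS x : qpoch_inf x Q = (1 - x) * qpoch_inf (x * Q) Q.
Proof. by rewrite (qpoch_inf_split 1) expr1 qpochSr qpoch0 expr0 mulr1 mul1r. Qed.

Lemma cabs_qpoch_inf_le x : cabs (qpoch_inf x Q) <= Ebound (cabs x).
Proof.
apply: (tends_cabs_le (tends_qpoch x)); near=> n; exact: cabs_qpoch_le.
Unshelve. all: by end_near. Qed.

Lemma cabs_qpoch_infB1 x :
  cabs (qpoch_inf x Q - 1) <= cabs x * Ebound (cabs x) / (1 - qr).
Proof.
have c0 : 0 <= cabs x * Ebound (cabs x) by rewrite mulr_ge0 ?cabs_ge0 ?Ebound_ge0.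
apply: (sums_le c0 (ltW qr0) qr1 _ (qpoch_inf_sums x)) => n.
rewrite cabsN !cabsM cabsX cabsQ mulrAC.
by rewrite ler_wpM2r ?qrn_ge0 // ler_wpM2l ?cabs_ge0 // cabs_qpoch_le.
Qed.

Lemma tends_qpoch_inf_1 x : tends (fun n => qpoch_inf (x * Q ^+ n) Q) 1.
Proof.
apply/tends_cabsP => e e0; set B := cabs x * Ebound (cabs x) / (1 - qr).
have B0 : 0 <= B.
  by apply: divr_ge0; [rewrite mulr_ge0 ?cabs_ge0 ?Ebound_ge0 | exact: ltW omq_gt0].
have e1 : 0 < e / (B + 1) by rewrite divr_gt0 // ltr_wpDl.
have /tends_cabsP/(_ _ e1) := tends_Qn; apply: filterS => n.
rewrite subr0 cabsX cabsQ ler_pdivlMr ?ltr_wpDl // => h.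
rewrite (le_trans (cabs_qpoch_infB1 _)) // (le_trans _ h) //.
rewrite (@le_trans _ _ (qr ^+ n * B)) ?ler_wpM2l ?qrn_ge0 ?lerDl //.
rewrite cabsM cabsX cabsQ /B !mulrA ler_wpM2r ?invr_ge0 ?(ltW omq_gt0) //.
rewrite [qr ^+ n * _]mulrC ler_wpM2l ?mulr_ge0 ?cabs_ge0 ?qrn_ge0 // Ebound_le //.
by rewrite ler_piMr ?cabs_ge0 ?qrn_le1.
Qed.

Lemma qpoch_inf_neq0_small x : cabs x < 1 -> qpoch_inf x Q != 0.
Proof.
move=> x1; apply/eqP => E.
set D := Ebound (cabs x / (1 - cabs x)).
have D0 : 0 < D by exact: expR_gt0.
have := tends_qpoch x; rewrite E => /tends_cabsP/(_ (D^-1 / 2)).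
rewrite divr_gt0 ?invr_gt0 // => /(_ isT) [n _ /(_ n (leqnn n))] /=.
have [h1 h2] := cabs_qpoch_inv_le n x1; rewrite subr0 => h3.
have c0 : 0 < cabs (qpoch x Q n) by rewrite lt_neqAle cabs_ge0 andbT eq_sym cabs_eq0.
have : D^-1 <= cabs (qpoch x Q n) by rewrite -[X in _ <= X]invrK lef_pV2 // posrE invr_gt0.
have Dp : 0 < D^-1 by rewrite invr_gt0.
by move=> h4; move: (D^-1) (le_trans h4 h3) Dp => d; lra.
Qed.

Lemma qpoch_neq0_inf x n : qpoch_inf x Q != 0 -> qpoch x Q n != 0.
Proof. by rewrite (qpoch_inf_split n) mulf_eq0 negb_or => /andP[]. Qed.

Lemma tends_qpoch_arg (xs : nat -> C) x n : tends xs x ->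
  tends (fun k => qpoch (xs k) Q n) (qpoch x Q n).
Proof.
move=> h; elim: n => [|n IH].
  by rewrite qpoch0; apply: (eq_tends (tends_cst _)) => k; rewrite qpoch0.
rewrite qpochSr.
have := tends_mul IH (tends_sub (tends_cst 1) (tends_mul h (tends_cst (Q ^+ n)))).
by move=> h'; apply: (eq_tends h') => k; rewrite qpochSr.
Qed.

End QInf.

(** * The q-binomial and q-Gauss sums *)

Section Summation.
Variables (R : realType) (C : completeField R).
Local Notation ofR := (cfR C).
Variable qr : R.
Hypotheses (qr0 : 0 < qr) (qr1 : qr < 1).
Local Notation Q := (ofR qr).
Implicit Types (x y z a b c e l X D : C) (r : R) (u v : nat -> C).

Let nz := nzQ C qr0 qr1.

Lemma tends0_geometric M r u : 0 <= r -> r < 1 -> (forall n, cabs (u n) <= M * r ^+ n) -> tends u 0.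
Proof.
move=> r0 r1 h; have M0 : 0 <= M by have := le_trans (cabs_ge0 _) (h 0%N); rewrite expr0 mulr1.
apply/tends_cabsP => e e0; have e1 : 0 < e / (M + 1) by rewrite divr_gt0 // ltr_wpDl.
have rr : cabs (ofR r) < 1 by rewrite cabs_ofR ger0_norm.
have /tends_cabsP/(_ _ e1) := tends_expr rr; apply: filterS => n.
rewrite subr0 cabsX cabs_ofR (ger0_norm r0) ler_pdivlMr ?ltr_wpDl // => h1.
rewrite subr0 (le_trans (h n)) // (le_trans _ h1) // mulrC ler_wpM2l ?exprn_ge0 //.
by rewrite lerDl.
Qed.

Lemma sums_delta : sums (fun i : nat => (i == 0%N)%:R : C) 1.
Proof.
pose d i : C := (i == 0%N)%:R.
have : sums d (series d 1 + 0) by apply: sums_shift; exact: (eq_sums (sums0 _)).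
by rewrite /series /= big_nat1 addr0.
Qed.

Lemma tends_pow_delta z i : tends (fun n => (z * Q ^+ n) ^+ i) ((i == 0%N)%:R).
Proof.
case: i => [|i]; first by apply: (eq_tends (tends_cst _)) => n; rewrite expr0.
have h := tends_mul (tends_cst z) (tends_Qn C qr0 qr1); rewrite mulr0 in h.
elim: i => [|i IH]; first by apply: (eq_tends h) => n; rewrite expr1.
by have := tends_mul h IH; rewrite mul0r => h'; apply: (eq_tends h') => n; rewrite [RHS]exprS.
Qed.

(** The sum F(w) satisfies (1 - w) F(w) = (1 - a w) F(w Q): the difference of the
    two sides telescopes.  Iterate from w = z and use F(z Q^n) --> 1, where only
    the term i = 0 survives. *)
Theorem qbinomial a z : cabs z < 1 ->
  sums (fun i => qbin Q a i * z ^+ i) (qpoch_inf (a * z) Q / qpoch_inf z Q).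
Proof.
move=> z1; pose t w := fun i => qbin Q a i * w ^+ i.
have z0 := cabs_ge0 z; have M0 := qbound_ge0 qr (cabs a).
have zQ n : cabs (z * Q ^+ n) <= cabs z.
  by rewrite cabsM cabsX (cabsQ C qr0) ler_piMr // (qrn_le1 qr0 qr1).
have tM w i : cabs w <= cabs z -> cabs (t w i) <= qbound qr (cabs a) * cabs z ^+ i.
  move=> h; rewrite cabsM cabsX ler_pM ?exprn_ge0 ?cabs_ge0 ?cabs_qbin_le //.
  by rewrite lerXn2r ?nnegrE ?cabs_ge0.
have ex w : cabs w <= cabs z -> exists l, sums (t w) l.
  by move=> h; apply: (geometric_dominated z0 z1) => i; exact: tM.
have step w l l' : cabs w <= cabs z -> sums (t w) l -> sums (t (w * Q)) l' ->
    (1 - w) * l = (1 - a * w) * l'.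
  move=> h hl hl'; apply/eqP; rewrite -subr_eq0; apply/eqP.
  pose D i := - ((1 - Q ^+ i) * t w i).
  have D0 : tends D 0.
    have h0 : tends (t w) 0 by apply: (tends0_geometric z0 z1) => i; exact: tM.
    have := tends_sub (tends_mul (tends_Qn C qr0 qr1) h0) h0; rewrite mul0r subr0 => h1.
    by apply: (eq_tends h1) => i; rewrite /D; ring.
  have D00 : D 0%N = 0 by rewrite /D expr0 subrr mul0r oppr0.
  have := sums_telescope D0; rewrite D00 oppr0 => h1.
  apply: (sums_unique _ h1).
  have := sumsD (sumsZ (1 - w) hl) (sumsZ (- (1 - a * w)) hl'); rewrite mulNr => h2.
  apply: (eq_sums h2) => i.
  have E : (1 - Q ^+ i.+1) * t w i.+1 = (1 - a * Q ^+ i) * qbin Q a i * w ^+ i.+1.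
    by rewrite /t [LHS]mulrA (qbinS nz).
  by rewrite /D E /t exprMn (exprS w); ring.
have ex' n := ex _ (zQ n).
have [s hs] : exists s : nat -> C, forall n, sums (t (z * Q ^+ n)) (s n).
  by exists (fun n => sval (cid (ex' n))) => n; case: (cid _).
have iter n : qpoch z Q n * s 0%N = qpoch (a * z) Q n * s n.
  elim: n => [|n IH]; first by rewrite !qpoch0.
  rewrite !qpochSr mulrAC IH mulrAC -!mulrA; congr (_ * _).
  rewrite (step (z * Q ^+ n) (s n) (s n.+1)) ?mulrA //.
  by have := hs n.+1; rewrite exprSr mulrA.
have [l hl sl] : exists2 l, sums (fun i : nat => (i == 0%N)%:R : C) l & tends s l.
  apply: (tannery M0 z0 z1 (F := fun n => t (z * Q ^+ n))) => //.
    by move=> n k; apply: tM.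
  move=> i; have := tends_mul (tends_cst (qbin Q a i)) (tends_pow_delta z i).
  suff -> : qbin Q a i * (i == 0%N)%:R = (i == 0%N)%:R by [].
  by case: i => [|i]; rewrite ?qbin0 ?mul1r ?mulr0.
have {hl} E := sums_unique hl sums_delta; rewrite {l}E in sl.
have h1 := tends_mul (tends_qpoch qr0 qr1 z) (tends_cst (s 0%N)).
have h2 := tends_mul (tends_qpoch qr0 qr1 (a * z)) sl.
have E : qpoch_inf z Q * s 0%N = qpoch_inf (a * z) Q * 1.
  by apply: (tends_unique h1); apply: (eq_tends h2) => n; rewrite iter.
have nzz := qpoch_inf_neq0_small qr0 qr1 z1.
suff -> : qpoch_inf (a * z) Q / qpoch_inf z Q = s 0%N.
  have := hs 0%N; set e0 := _ * Q ^+ 0; suff -> : e0 = z by [].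
  by rewrite /e0 expr0 mulr1.
by apply: (mulfI nzz); rewrite E mulr1 mulrC (divfK nzz).
Qed.

(** As for [qbinomial], with the recurrence
    (1 - c/(ab)) F(c) = (1 - c/a) (1 - c/b) F(c Q) and F(c Q^n) --> 1.  Compared
    with the usual form both sides are multiplied by (c; Q)_oo, which makes each
    term an entire function of c. *)
Theorem qGauss a b c : a != 0 -> b != 0 -> cabs (c / (a * b)) < 1 ->
  sums (fun i => qbin Q a i * qpoch b Q i * qpoch_inf (c * Q ^+ i) Q * (c / (a * b)) ^+ i)
    (qpoch_inf (c / a) Q * qpoch_inf (c / b) Q / qpoch_inf (c / (a * b)) Q).
Proof.
move=> a0 b0; set z := c / (a * b) => z1.
pose t d := fun i => qbin Q a i * qpoch b Q i * qpoch_inf (d * Q ^+ i) Q * (d / (a * b)) ^+ i.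
have z0 := cabs_ge0 z.
pose M := qbound qr (cabs a) * Ebound qr (cabs b) * Ebound qr (cabs c).
have M0 : 0 <= M by rewrite !mulr_ge0 ?qbound_ge0 ?Ebound_ge0.
have tM n i : cabs (t (c * Q ^+ n) i) <= M * cabs z ^+ i.
  have q1 := qrn_le1 qr0 qr1.
  rewrite /t; move: (cabs_qbin_le qr0 qr1 a i) (cabs_qpoch_le qr0 qr1 b i) => B1 B2.
  have B3 : cabs (qpoch_inf (c * Q ^+ n * Q ^+ i) Q) <= Ebound qr (cabs c).
    rewrite (le_trans (cabs_qpoch_inf_le qr0 qr1 _)) // Ebound_le //.
    by rewrite -mulrA -exprD cabsM cabsX (cabsQ C qr0) ler_piMr ?cabs_ge0.
  have B4 : cabs ((c * Q ^+ n / (a * b)) ^+ i) <= cabs z ^+ i.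
    rewrite cabsX lerXn2r ?nnegrE ?cabs_ge0 // mulrAC cabsM cabsX (cabsQ C qr0).
    by rewrite ler_piMr ?cabs_ge0.
  rewrite /M (cabsM _ (_ ^+ i)) ler_pM ?cabs_ge0 // cabsM ler_pM ?cabs_ge0 //.
  by rewrite cabsM ler_pM ?cabs_ge0.
have ex n : exists l, sums (t (c * Q ^+ n)) l.
  by apply: (geometric_dominated z0 z1) => i; exact: tM.
have step n l l' : sums (t (c * Q ^+ n)) l -> sums (t (c * Q ^+ n.+1)) l' ->
    (1 - z * Q ^+ n) * l = (1 - c / a * Q ^+ n) * (1 - c / b * Q ^+ n) * l'.
  move=> hl hl'; apply/eqP; rewrite -subr_eq0; apply/eqP.
  pose D i := - ((1 - Q ^+ i) * t (c * Q ^+ n) i).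
  have D0 : tends D 0.
    have h0 : tends (t (c * Q ^+ n)) 0 by apply: (tends0_geometric z0 z1) => i; exact: tM.
    have := tends_sub (tends_mul (tends_Qn C qr0 qr1) h0) h0; rewrite mul0r subr0 => h1.
    by apply: (eq_tends h1) => i; rewrite /D; ring.
  have D00 : D 0%N = 0 by rewrite /D expr0 subrr mul0r oppr0.
  have := sums_telescope D0; rewrite D00 oppr0 => h1.
  apply: (sums_unique _ h1).
  have := sumsD (sumsZ (1 - z * Q ^+ n) hl) (sumsZ (- ((1 - c / a * Q ^+ n) * (1 - c / b * Q ^+ n))) hl').
  rewrite mulNr => h2; apply: (eq_sums h2) => i.
  have E1 : (1 - Q ^+ i.+1) * t (c * Q ^+ n) i.+1 = qbin Q a i * qpoch b Q i *
     qpoch_inf (c * Q ^+ n * Q ^+ i.+1) Q * ((1 - a * Q ^+ i) * (1 - b * Q ^+ i) *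
     (c * Q ^+ n / (a * b)) ^+ i.+1).
    transitivity ((1 - Q ^+ i.+1) * qbin Q a i.+1 * (qpoch b Q i.+1 * qpoch_inf (c * Q ^+ n * Q ^+ i.+1) Q
      * (c * Q ^+ n / (a * b)) ^+ i.+1)); first by rewrite /t; ring.
    by rewrite (qbinS nz) qpochSr; ring.
  have E2 : t (c * Q ^+ n) i = qbin Q a i * qpoch b Q i *
     ((1 - c * Q ^+ n * Q ^+ i) * qpoch_inf (c * Q ^+ n * Q ^+ i.+1) Q) * (c * Q ^+ n / (a * b)) ^+ i.
    by rewrite /t (qpoch_infS qr0 qr1 (c * Q ^+ n * Q ^+ i)) exprSr !mulrA.
  rewrite /D; transitivity ((1 - z * Q ^+ n) * t (c * Q ^+ n) i
    - (1 - c / a * Q ^+ n) * (1 - c / b * Q ^+ n) * t (c * Q ^+ n.+1) i); first by ring.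
  rewrite [RHS](_ : _ = (1 - Q ^+ i) * t (c * Q ^+ n) i - (1 - Q ^+ i.+1) * t (c * Q ^+ n) i.+1); last by ring.
  rewrite E1 E2 /t /z.
  have -> : c * Q ^+ n.+1 * Q ^+ i = c * Q ^+ n * Q ^+ i.+1 by rewrite exprSr !exprS; ring.
  have -> : c * Q ^+ n.+1 / (a * b) = c * Q ^+ n / (a * b) * Q by rewrite exprSr; ring.
  rewrite [(c * Q ^+ n / (a * b) * Q) ^+ i]exprMn (exprS (c * Q ^+ n / (a * b))).
  move: (qpoch_inf _ _) (qbin _ _ _) (qpoch _ _ _) => G1 G2 G3.
  move: ((c * Q ^+ n / (a * b)) ^+ i) (Q ^+ n) (Q ^+ i) => Z V W.
  by field; rewrite a0 b0.
have [s hs] : exists s : nat -> C, forall n, sums (t (c * Q ^+ n)) (s n).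
  by exists (fun n => sval (cid (ex n))) => n; case: (cid _).
have iter n : qpoch z Q n * s 0%N = qpoch (c / a) Q n * qpoch (c / b) Q n * s n.
  elim: n => [|n IH]; first by rewrite !qpoch0 !mul1r.
  rewrite !qpochSr mulrAC IH.
  transitivity (qpoch (c / a) Q n * qpoch (c / b) Q n * ((1 - z * Q ^+ n) * s n)); first by ring.
  by rewrite (step n _ _ (hs n) (hs n.+1)); ring.
have [l hl sl] : exists2 l, sums (fun i : nat => (i == 0%N)%:R : C) l & tends s l.
  apply: (tannery M0 z0 z1 (F := fun n => t (c * Q ^+ n))) => // i.
  have h1 := tends_mul (tends_cst (qbin Q a i * qpoch b Q i)) (tends_qpoch_inf_1 qr0 qr1 (c * Q ^+ i)).
  have := tends_mul h1 (tends_pow_delta z i).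
  have -> : qbin Q a i * qpoch b Q i * 1 * (i == 0%N)%:R = (i == 0%N)%:R.
    by case: i {h1} => [|i]; rewrite ?qbin0 ?qpoch0 ?mul1r ?mulr0.
  move=> h2; apply: (eq_tends h2) => n; rewrite /t.
  by rewrite (mulrAC c) [c * Q ^+ n / _]mulrAC.
have {hl} E := sums_unique hl sums_delta; rewrite {l}E in sl.
have h1 := tends_mul (tends_qpoch qr0 qr1 z) (tends_cst (s 0%N)).
have h2 := tends_mul (tends_mul (tends_qpoch qr0 qr1 (c / a)) (tends_qpoch qr0 qr1 (c / b))) sl.
have E : qpoch_inf z Q * s 0%N = qpoch_inf (c / a) Q * qpoch_inf (c / b) Q * 1.
  by apply: (tends_unique h1); apply: (eq_tends h2) => n; rewrite iter.
have nzz := qpoch_inf_neq0_small qr0 qr1 z1.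
suff -> : qpoch_inf (c / a) Q * qpoch_inf (c / b) Q / qpoch_inf z Q = s 0%N.
  have := hs 0%N; set e0 := _ * Q ^+ 0; suff -> : e0 = c by [].
  by rewrite /e0 expr0 mulr1.
by apply: (mulfI nzz); rewrite E mulr1 mulrC (divfK nzz).
Qed.

End Summation.

Section GaussInt.
Variables (R : realType) (C : completeField R).
Local Notation ofR := (cfR C).
Variable qr : R.
Hypotheses (qr0 : 0 < qr) (qr1 : qr < 1).
Local Notation Q := (ofR qr).
Implicit Types (x y z a b c e l X D : C) (r : R) (u v : nat -> C).

Let Qn0 := Qneq0 C qr0.
Let nz := nzQ C qr0 qr1.

Lemma qpoch_reverse X n : X != 0 ->
  qpoch (X * Q ^- n) Q n = (- X) ^+ n / Q ^+ 'C(n.+1, 2) * qpoch (Q / X) Q n.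
Proof.
move=> X0; elim: n => [|n IH]; first by rewrite !qpoch0 !expr0 invr1 !mulr1.
have -> : qpoch (X * Q ^- n.+1) Q n.+1 = (1 - X * Q ^- n.+1) * qpoch (X * Q ^- n) Q n.
  rewrite qpochSl exprS; congr (_ * qpoch _ _ _).
  by have := expf_neq0 n Qn0; move: (Q ^+ n) => V V0; field; rewrite V0 Qn0.
rewrite IH qpochSr (binS n.+1) bin1 exprD !exprS.
have := expf_neq0 n Qn0; have := expf_neq0 'C(n.+1, 2) Qn0.
by move: (Q ^+ n) (Q ^+ 'C(n.+1, 2)) => V W W0 V0; field; rewrite V0 W0 Qn0 X0.
Qed.

Definition qbinz X (h : int) : C := if h is Posz n then qbin Q X n else 0.

(** [qGauss] with b = X Q^n and c = Q^(n+1), as (X)_(i+n) = (X)_n (X Q^n)_i. *)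
Lemma gauss_nat a X n : a != 0 -> X != 0 -> cabs (Q / (a * X)) < 1 ->
  sums (fun i => qbin Q a i * qbin Q X (i + n)%N * (Q / (a * X)) ^+ i)
    (qpoch X Q n * qpoch_inf (Q ^+ n.+1 / a) Q * qpoch_inf (Q / X) Q
      / (qpoch_inf Q Q * qpoch_inf (Q / (a * X)) Q)).
Proof.
move=> a0 X0 z1; have Qi0 : qpoch_inf Q Q != 0.
  by apply: qpoch_inf_neq0_small; rewrite ?(cabsQ C qr0).
have Z0 := qpoch_inf_neq0_small qr0 qr1 z1.
have Qn := expf_neq0 n Qn0; have b0 : X * Q ^+ n != 0 by rewrite mulf_neq0.
have Ez : Q ^+ n.+1 / (a * (X * Q ^+ n)) = Q / (a * X).
  by rewrite exprS; move: (Q ^+ n) Qn => V V0; field; rewrite V0 a0 X0.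
have EX : Q ^+ n.+1 / (X * Q ^+ n) = Q / X.
  by rewrite exprS; move: (Q ^+ n) Qn => V V0; field; rewrite V0 X0.
have := @qGauss _ C _ qr0 qr1 a (X * Q ^+ n) (Q ^+ n.+1) a0 b0.
rewrite Ez EX => /(_ z1) h.
have := sumsZ (qpoch X Q n / qpoch_inf Q Q) h.
rewrite [X in sums _ X -> _](_ : _ = qpoch X Q n * qpoch_inf (Q ^+ n.+1 / a) Q * qpoch_inf (Q / X) Q
      / (qpoch_inf Q Q * qpoch_inf (Q / (a * X)) Q)); last by move: Qi0 Z0; move: (qpoch_inf Q Q) (qpoch_inf (Q / (a * X)) Q) => G1 G2 n1 n2; field; rewrite n1 n2.
move=> h'; apply: (eq_sums h') => i.
have -> : qbin Q X (i + n) = qpoch X Q n / qpoch_inf Q Q *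
    (qpoch (X * Q ^+ n) Q i * qpoch_inf (Q ^+ n.+1 * Q ^+ i) Q).
  rewrite /qbin addnC qpochD (qpoch_inf_split qr0 qr1 (n + i) Q).
  have -> : Q ^+ n.+1 * Q ^+ i = Q * Q ^+ (n + i) by rewrite -exprD -exprS.
  have n1 := nz (n + i).
  have : qpoch_inf (Q * Q ^+ (n + i)) Q != 0.
    by move: Qi0; rewrite (qpoch_inf_split qr0 qr1 (n + i) Q) mulf_eq0 negb_or => /andP[].
  move: (qpoch_inf _ _) => G G0; by field; rewrite n1 G0.
by ring.
Qed.

Variables (g : C).
Hypothesis g2 : g ^+ 2 = Q.

Lemma g_neq0 : g != 0.
Proof. by apply: contraNneq Qn0 => E; rewrite -g2 E expr0n. Qed.

Lemma g_bin n : Q ^+ 'C(n.+1, 2) = g ^+ (n * n.+1).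
Proof.
rewrite -g2 -exprM; congr (_ ^+ _).
by elim: n => // n IH; rewrite (binS n.+1) bin1 mulnDr IH; lia.
Qed.

(** The value of the shifted sum of [gauss_int] in a form that is uniform in m, where
    g is a square root of Q, so that g^(m(m+1)) = Q^(m(m+1)/2) is an integral
    power. *)
Definition gaussK (m : int) (l : nat) a X : C :=
  (- X) ^ (- m) * g ^ (m * (m + 1)) * qpoch (X * Q ^ (- m)) Q l
  * qpoch_inf (Q ^ (l%:Z + 1 - m) / a) Q * qpoch_inf (Q ^ (1 + m) / X) Q
  / (qpoch_inf Q Q * qpoch_inf (Q / (a * X)) Q).

Lemma qpoch_reverse_g X n : X != 0 ->
  qpoch (X * Q ^- n) Q n = (- X) ^+ n / g ^+ (n * n.+1) * qpoch (Q / X) Q n.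
Proof. by move=> X0; rewrite qpoch_reverse // g_bin. Qed.

Lemma gaussK_ge (m' n : nat) a X : a != 0 -> X != 0 ->
  gaussK m' (m' + n) a X = qpoch X Q n * qpoch_inf (Q ^+ n.+1 / a) Q * qpoch_inf (Q / X) Q
      / (qpoch_inf Q Q * qpoch_inf (Q / (a * X)) Q).
Proof.
move=> a0 X0; rewrite /gaussK qpochD.
have -> : Q ^ ((m' + n)%N%:Z + 1 - m'%:Z) = Q ^+ n.+1.
  by rewrite [RHS]exprnP; congr (_ ^ _); lia.
have -> : Q ^ (1 + m'%:Z) = Q * Q ^+ m' by rewrite expfzDr // expr1z.
have -> : g ^ (m'%:Z * (m'%:Z + 1)) = g ^+ (m' * m'.+1).
  by rewrite [RHS]exprnP; congr (_ ^ _); lia.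
rewrite -!exprnN qpoch_reverse_g //.
have -> : X * Q ^- m' * Q ^+ m' = X by rewrite mulfVK ?expf_neq0.
rewrite (qpoch_inf_split qr0 qr1 m' (Q / X)).
have -> : Q / X * Q ^+ m' = Q * Q ^+ m' / X by ring.
have := expf_neq0 (m' * m'.+1) g_neq0; have : (- X) ^+ m' != 0 by rewrite expf_neq0 ?oppr_eq0.
move: (qpoch_inf (Q * Q ^+ m' / X) Q) (qpoch_inf (Q ^+ n.+1 / a) Q) => B A.
move: (qpoch_inf Q Q * _)^-1 ((- X) ^+ m') (g ^+ _) (qpoch _ _ _) (qpoch _ _ _) => D V W G1 G2 V0 W0.
by field; rewrite V0 W0.
Qed.

Lemma gaussK_lt (l d : nat) a X : a != 0 -> X != 0 ->
  gaussK (l + d)%N l a X = (Q / (a * X)) ^+ d *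
    (qpoch a Q d * qpoch_inf (Q ^+ d.+1 / X) Q * qpoch_inf (Q / a) Q
      / (qpoch_inf Q Q * qpoch_inf (Q / (a * X)) Q)).
Proof.
move=> a0 X0; rewrite /gaussK.
have -> : Q ^ (l%:Z + 1 - (l + d)%N%:Z) / a = Q / a * Q ^- d.
  by rewrite (_ : _ - _ = 1 - d%:Z) ?expfzDr // ?expr1z ?exprnN; [ring | lia].
have -> : Q ^ (1 + (l + d)%N%:Z) = Q ^+ d.+1 * Q ^+ l.
  by rewrite -exprD [RHS]exprnP; congr (_ ^ _); lia.
have -> : g ^ ((l + d)%N%:Z * ((l + d)%N%:Z + 1)) = g ^+ (l * l.+1) * Q ^+ (l * d) * g ^+ (d * d.+1).
  by rewrite -g2 -exprM -!exprD [RHS]exprnP; congr (_ ^ _); lia.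
have Qd := expf_neq0 d Qn0; have Ql := expf_neq0 l Qn0.
have -> : X * Q ^ (- (l + d)%N%:Z) = X * Q ^- d * Q ^- l.
  by rewrite -exprnN exprD invfM; ring.
have qa : Q / a != 0 by rewrite mulf_neq0 ?invr_eq0.
have xq : X * Q ^- d != 0 by rewrite mulf_neq0 ?invr_eq0.
rewrite qpoch_reverse_g // (qpoch_inf_split qr0 qr1 d (Q / a * _)) qpoch_reverse_g // divfK //.
have -> : Q / (X * Q ^- d) = Q ^+ d.+1 / X.
  by rewrite exprS; move: (Q ^+ d) Qd => V V0; field; rewrite X0 V0.
have -> : Q / (Q / a) = a by field; rewrite a0 Qn0.
rewrite (qpoch_inf_split qr0 qr1 l (Q ^+ d.+1 / X)).
have -> : Q ^+ d.+1 / X * Q ^+ l = Q ^+ d.+1 * Q ^+ l / X by ring.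
rewrite -exprnN exprD.
have -> : (- (X * Q ^- d)) ^+ l = (- X) ^+ l / Q ^+ (l * d).
  by rewrite -mulNr exprMn exprVn -exprM mulnC.
have -> : (- (Q / a)) ^+ d = (- X) ^+ d * (Q / (a * X)) ^+ d.
  by rewrite -exprMn; congr (_ ^+ _); field; rewrite a0 X0.
have Qld := expf_neq0 (l * d) Qn0.
have h1 := expf_neq0 (l * l.+1) g_neq0; have h2 := expf_neq0 (d * d.+1) g_neq0.
have h3 : (- X) ^+ l != 0 by rewrite expf_neq0 ?oppr_eq0.
have h4 : (- X) ^+ d != 0 by rewrite expf_neq0 ?oppr_eq0.
move: (qpoch_inf (Q ^+ d.+1 * Q ^+ l / X) Q) (qpoch_inf (Q / a) Q) => B A.
move: (qpoch_inf Q Q * _)^-1 (qpoch _ _ l) (qpoch _ _ d) => D G1 G2.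
move: (g ^+ _) (g ^+ _) (Q ^+ (l * d)) ((- X) ^+ l) ((- X) ^+ d) ((Q / (a * X)) ^+ d) h1 h2 h3 h4 Qld.
move=> V1 V2 V3 V4 V5 V6 n1 n2 n3 n4 n5.
by field; rewrite n1 n2 n3 n4 n5.
Qed.

Lemma gaussK_neg (m' l : nat) a X : a != 0 -> X != 0 ->
  gaussK (- m'%:Z) l a X = qpoch X Q (m' + l) * qpoch_inf (Q ^+ (m' + l).+1 / a) Q
      * qpoch_inf (Q / X) Q / (qpoch_inf Q Q * qpoch_inf (Q / (a * X)) Q).
Proof.
move=> a0 X0; rewrite /gaussK qpochD opprK -(exprnP (- X)) -(exprnP Q m').
have -> : Q ^ (l%:Z + 1 + m'%:Z) = Q ^+ (m' + l).+1.
  by rewrite [RHS]exprnP; congr (_ ^ _); lia.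
have Qm := expf_neq0 m' Qn0.
have -> : Q ^ (1 + - m'%:Z) / X = Q / X * Q ^- m'.
  by rewrite expfzDr // expr1z -exprnN; ring.
have EG : g ^ (- m'%:Z * (- m'%:Z + 1)) * Q ^+ m' = g ^+ (m' * m'.+1).
  rewrite -g2 -exprM !exprnP -expfzDr ?g_neq0 //; congr (_ ^ _); lia.
have qx : Q / X != 0 by rewrite mulf_neq0 ?invr_eq0.
rewrite (qpoch_inf_split qr0 qr1 m' (Q / X * _)) qpoch_reverse_g // divfK //.
have -> : Q / (Q / X) = X by field; rewrite X0 Qn0.
have -> : (- (Q / X)) ^+ m' = Q ^+ m' / (- X) ^+ m'.
  by rewrite -exprVn -exprMn; congr (_ ^+ _); field; rewrite ?oppr_eq0 X0.
have h1 := expf_neq0 (m' * m'.+1) g_neq0.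
have h3 : (- X) ^+ m' != 0 by rewrite expf_neq0 ?oppr_eq0.
have -> : g ^ (- m'%:Z * (- m'%:Z + 1)) = g ^+ (m' * m'.+1) / Q ^+ m' by rewrite -EG mulfK.
move: (qpoch_inf (Q / X) Q) (qpoch_inf (_ / a) Q) => B A.
move: (qpoch_inf Q Q * _)^-1 (qpoch _ _ l) (qpoch _ _ m') => D G1 G2.
move: (g ^+ _) (Q ^+ m') ((- X) ^+ m') h1 Qm h3 => V1 V2 V3 n1 n2 n3.
by field; rewrite n1 n2 n3.
Qed.

(** According to the position of m relative to 0 and l.  For m <= l the shift l - m
    is a natural number and this is [gauss_nat].  For m > l the first m - l terms
    vanish, and after they are dropped a and X have exchanged roles. *)
Lemma gauss_int a X (m : int) (l : nat) : a != 0 -> X != 0 -> cabs (Q / (a * X)) < 1 ->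
  sums (fun i => qbin Q a i * qbinz X (i%:Z + l%:Z - m) * (Q / (a * X)) ^+ i) (gaussK m l a X).
Proof.
move=> a0 X0 z1; have [[m' Em lm]|[l' El]|[m' Em]] :
   [\/ exists2 m' : nat, m = m' & (m' <= l)%N, exists d, m = (l + d.+1)%N |
      exists m' : nat, m = - m'%:Z].
- case: m => m'; last by apply: Or33; exists m'.+1; rewrite NegzE.
  have [h|h] := leqP m' l; first by apply: Or31; exists m'.
  by apply: Or32; exists (m' - l).-1; congr Posz; lia.
- rewrite Em -(subnKC lm) gaussK_ge //; apply: (eq_sums (gauss_nat (l - m') a0 X0 z1)) => i.
  by congr (_ * _ * _); rewrite -[LHS]/(qbinz X (i + (l - m'))%N); congr qbinz; lia.
- rewrite El gaussK_lt // -[X in sums _ X]add0r.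
  have -> : 0 = series (fun i => qbin Q a i * qbinz X (i%:Z + l%:Z - (l + l'.+1)%N%:Z) * (Q / (a * X)) ^+ i) l'.+1.
    rewrite /series /= big_nat big1 // => i /= il.
    have -> : (i%:Z + l%:Z - (l + l'.+1)%N%:Z) = Negz (l' - i) by rewrite NegzE; lia.
    by rewrite mulr0 mul0r.
  apply: sums_shift; have E : a * X = X * a by rewrite mulrC.
  rewrite E in z1 *; apply: (eq_sums (sumsZ _ (gauss_nat l'.+1 X0 a0 z1))) => i.
  have -> : ((l'.+1 + i)%N%:Z + l%:Z - (l + l'.+1)%N%:Z) = i by lia.
  by rewrite /qbinz exprD [(i + _)%N]addnC; ring.
rewrite Em gaussK_neg // addnC; apply: (eq_sums (gauss_nat (l + m') a0 X0 z1)) => i.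
by congr (_ * _ * _); rewrite -[LHS]/(qbinz X (i + (l + m'))%N); congr qbinz; lia.
Qed.

End GaussInt.

(** * A 2phi1 to 2phi2 transformation *)

Section Heine.
Variables (R : realType) (C : completeField R).
Local Notation ofR := (cfR C).
Variable qr : R.
Hypotheses (qr0 : 0 < qr) (qr1 : qr < 1).
Local Notation Q := (ofR qr).
Implicit Types (x y z e X D : C) (r M : R).

Let nz := nzQ C qr0 qr1.

(** The ratio of consecutive terms, M q^j / r, is eventually at most 1, where q
    is the real base. *)
Lemma gaussian_le_geometric M r : 0 <= M -> 0 < r ->
  exists2 c, 0 <= c & forall j, M ^+ j * qr ^+ 'C(j, 2) <= c * r ^+ j.
Proof.
move=> M0 r0; pose a j := (M / r) ^+ j * qr ^+ 'C(j, 2).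
have Mr0 : 0 <= M / r by rewrite divr_ge0 // ltW.
have a0 j : 0 <= a j by rewrite mulr_ge0 ?exprn_ge0 // ltW.
have aS j : a j.+1 = M / r * qr ^+ j * a j.
  by rewrite /a binS bin1 exprD exprS; ring.
have [J hJ] : exists J, forall j, (J <= j)%N -> M / r * qr ^+ j <= 1.
  have e0 : 0 < 1 / (M / r + 1) by rewrite divr_gt0 // ltr_wpDl.
  have := tends_Qn C qr0 qr1; move=> /tends_cabsP/(_ _ e0) [J _ hJ].
  exists J => j /hJ /=; rewrite subr0 cabsX (cabsQ C qr0) ler_pdivlMr ?ltr_wpDl // => h.
  rewrite (le_trans _ h) // mulrC ler_wpM2l ?exprn_ge0 ?(ltW qr0) // lerDl //.
have bd j : a j <= \sum_(i < J.+1) a i.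
  have h1 i : (i <= J)%N -> a i <= \sum_(i < J.+1) a i.
    move=> iJ; rewrite -ltnS in iJ; rewrite (bigD1 (Ordinal iJ)) //= lerDl.
    by apply: sumr_ge0.
  have [jJ|Jj] := leqP j J; first exact: h1.
  rewrite -(subnKC (ltnW Jj)); elim: (j - J)%N => [|k IH]; first by rewrite addn0 h1.
  rewrite addnS aS (le_trans _ IH) // ler_piMl // hJ //; exact: leq_addr.
exists (\sum_(i < J.+1) a i); first exact: sumr_ge0.
move=> j; rewrite -ler_pdivrMr ?exprn_gt0 //.
by rewrite (le_trans _ (bd j)) // /a expr_div_n mulrAC.
Qed.

(** Expand (X)_l by [qVandermonde], exchange the sums, and sum over l - j by
    [qbinomial].  The factor (-X z)^j Q^(j(j-1)/2) decays faster than any geometric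
    series, which makes the double series absolutely convergent for all X.  The
    denominators (DX)_l and (DX, ez)_j of the two series are cleared by infinite
    products, so that DX and ez may be powers Q^(-n). *)
Theorem heine22 e X D z : cabs z < 1 ->
  exists2 S, sums (fun l => qbin Q e l * qpoch X Q l * qpoch_inf (D * X * Q ^+ l) Q * z ^+ l)
                  (S / qpoch_inf z Q) &
    sums (fun j => qbin Q e j * qpoch D Q j * qpoch_inf (D * X * Q ^+ j) Q
        * qpoch_inf (e * z * Q ^+ j) Q * (- (X * z)) ^+ j * Q ^+ 'C(j, 2)) S.
Proof.
move=> z1; have zz := qpoch_inf_neq0_small qr0 qr1 z1; have z0 := cabs_ge0 z.
pose r := (cabs z + 1) / 2.
have r0 : 0 < r by rewrite divr_gt0 // ltr_wpDl.
have zr : cabs z <= r by rewrite /r; lra.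
have r1 : r < 1 by rewrite /r; lra.
have [c c0 hc] := gaussian_le_geometric (cabs_ge0 (- (X * z))) r0.
pose cf j := qbin Q e j * qpoch D Q j * qpoch_inf (D * X * Q ^+ j) Q
    * ((- (X * z)) ^+ j * Q ^+ 'C(j, 2)).
pose F j k := cf j * (qbin Q (e * Q ^+ j) k * z ^+ k).
pose M := qbound qr (cabs e) * Ebound qr (cabs D) * Ebound qr (cabs (D * X)) * c
   * qbound qr (cabs e).
have q1 n : cabs (Q ^+ n) <= 1 by rewrite cabsX (cabsQ C qr0) (qrn_le1 qr0 qr1).
have xQ x n : cabs (x * Q ^+ n) <= cabs x by rewrite cabsM ler_piMr ?cabs_ge0.
have FM j k : cabs (F j k) <= M * r ^+ j * r ^+ k.
  have B1 : cabs (cf j) <= qbound qr (cabs e) * Ebound qr (cabs D) * Ebound qr (cabs (D * X)) * (c * r ^+ j).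
    rewrite /cf cabsM ler_pM ?cabs_ge0 //; last by rewrite cabsM !cabsX (cabsQ C qr0) hc.
    rewrite cabsM ler_pM ?cabs_ge0 //; last first.
      by rewrite (le_trans (cabs_qpoch_inf_le qr0 qr1 _)) // Ebound_le.
    by rewrite cabsM ler_pM ?cabs_ge0 ?cabs_qbin_le ?cabs_qpoch_le.
  have B2 : cabs (qbin Q (e * Q ^+ j) k * z ^+ k) <= qbound qr (cabs e) * r ^+ k.
    rewrite cabsM ler_pM ?cabs_ge0 //.
      by rewrite (le_trans (cabs_qbin_le qr0 qr1 _ _)) // qbound_le.
    by rewrite cabsX lerXn2r ?nnegrE // ltW.
  rewrite /F cabsM (le_trans (ler_pM (cabs_ge0 _) (cabs_ge0 _) B1 B2)) //.
  by rewrite /M le_eqVlt; apply/orP; left; apply/eqP; ring.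
have Fs j : sums (F j) (cf j * (qpoch_inf (e * Q ^+ j * z) Q / qpoch_inf z Q)).
  by apply: sumsZ; exact: qbinomial.
have M0 : 0 <= M by rewrite !mulr_ge0 ?qbound_ge0 ?Ebound_ge0.
have [S hS1 hS2] := antidiagonal_sums M0 (ltW r0) r1 FM Fs.
exists (S * qpoch_inf z Q).
  rewrite mulfK //; apply: (eq_sums hS2) => n.
  rewrite (qVandermonde nz n X D) mulr_sumr !mulr_suml.
  apply: eq_bigr => -[j /=]; rewrite ltnS => jn _.
  rewrite /F /cf /qbin.
  have -> : qpoch_inf (D * X * Q ^+ j) Q = qpoch (D * X * Q ^+ j) Q (n - j) * qpoch_inf (D * X * Q ^+ n) Q.
    have <- : D * X * Q ^+ j * Q ^+ (n - j) = D * X * Q ^+ n by rewrite -mulrA -exprD subnKC.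
    exact: qpoch_inf_split.
  have -> : qpoch e Q n = qpoch e Q j * qpoch (e * Q ^+ j) Q (n - j) by rewrite -qpochD subnKC.
  have -> : (- (X * z)) ^+ j = (- X) ^+ j * z ^+ j by rewrite -mulNr exprMn.
  have -> : z ^+ n = z ^+ j * z ^+ (n - j) by rewrite -exprD subnKC.
  have n1 := nz n; have n2 := nz j; have n3 := nz (n - j).
  move: (qpoch_inf _ _) => G; field; by rewrite n1 n2 n3.
have := sumsZ (qpoch_inf z Q) hS1; rewrite mulrC => h; apply: (eq_sums h) => j.
rewrite /cf (mulrAC e); move: (qpoch_inf (e * z * _) _) (qpoch_inf (D * _ * _) _) (qpoch_inf z Q) zz => G1 G2 G3 zz.
by field.
Qed.

End Heine.

(** * Growth of the polynomials in n *)

Section Bounds.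
Variables (R : realType) (C : completeField R).
Local Notation ofR := (cfR C).
Variable qr : R.
Hypotheses (qr0 : 0 < qr) (qr1 : qr < 1).
Local Notation Q := (ofR qr).
Implicit Types (x y z a b c : C) (r rho : R) (n k : nat).

Let Qn0 := Qneq0 C qr0.
Let nz := nzQ C qr0 qr1.

Lemma linear_le_geometric rho n : 1 < rho -> n.+1%:R <= (1 + (rho - 1)^-1) * rho ^+ n.
Proof.
move=> h; have h0 : 0 < rho - 1 by rewrite subr_gt0.
have hi : 0 < (rho - 1)^-1 by rewrite invr_gt0.
elim: n => [|n IH]; first by rewrite expr0 mulr1 lerDl ltW.
have h1 : 1 <= rho ^+ n by rewrite exprn_ege1 // ltW.
have E : (1 + (rho - 1)^-1) * rho ^+ n.+1 =
   (1 + (rho - 1)^-1) * rho ^+ n + rho * rho ^+ n.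
  by rewrite exprS; field; rewrite gt_eqF.
rewrite E -addn1 natrD lerD //.
by rewrite -[X in X <= _]mulr1 ler_pM // ltW.
Qed.

(** The n + 1 terms of [asc_convolution] are bounded by a constant because |z| = 1,
    and n + 1 is dominated by rho^n. *)
Lemma asc_bound rho a bmax z : 1 < rho -> a != 0 -> cabs z = 1 -> 0 <= bmax ->
  exists2 M, 0 <= M & forall b n, b != 0 -> cabs b <= bmax ->
    cabs (asc_normed Q n (mu z) a b) <= M * rho ^+ n.
Proof.
move=> h a0 z1 bm; have z0 : z != 0 by rewrite -cabs_eq0 z1 oner_neq0.
have h0 : 0 < rho - 1 by rewrite subr_gt0.
have K0 : 0 <= 1 + (rho - 1)^-1 by rewrite addr_ge0 // invr_ge0 ltW.
exists (qbound qr (cabs a) * qbound qr bmax * (1 + (rho - 1)^-1)).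
  by apply: mulr_ge0 => //; apply: mulr_ge0; exact: qbound_ge0.
move=> b n b0 bb; rewrite (asc_convolution Qn0 nz) // (le_trans (cabs_sum _ _ _)) //.
rewrite (@le_trans _ _ (\sum_(i < n.+1) qbound qr (cabs a) * qbound qr bmax)) //.
  apply: ler_sum => i _; rewrite cabsM; apply: ler_pM; rewrite ?cabs_ge0 //.
    rewrite cabsM cabsX z1 expr1n mulr1.
    by rewrite (le_trans (cabs_qbin_le qr0 qr1 _ _)) // qbound_le // cabsM cabsV z1 invr1 mulr1.
  rewrite cabsM cabsV cabsX z1 expr1n invr1 mulr1.
  by rewrite (le_trans (cabs_qbin_le qr0 qr1 _ _)) // qbound_le // cabsM z1 mulr1.
rewrite sumr_const card_ord -mulr_natr -[leRHS]mulrA ler_wpM2l ?linear_le_geometric //.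
by rewrite mulr_ge0 ?qbound_ge0.
Qed.

Lemma cdqH_cont n x a c (bs : nat -> C) b : tends bs b ->
  tends (fun k => cdual_qHahn n x a (bs k) c Q) (cdual_qHahn n x a b c Q).
Proof.
move=> h; rewrite /cdual_qHahn aw_sum.
have := @tends_finsum C 'I_n.+1 (fun k i => aw_coef n i a (bs k) c 0 Q * qpoch_pair a x Q i)
  (fun i => aw_coef n i a b c 0 Q * qpoch_pair a x Q i).
move=> h'; apply: (eq_tends (h' _)) => [i|k]; last by rewrite aw_sum.
apply: tends_mul (tends_cst _).
rewrite /aw_coef !(mulr0, mul0r) !qpoch_const0 !mulr1.
have h1 : tends (fun k => a * bs k * Q ^+ i) (a * b * Q ^+ i).
  exact: tends_mul (tends_mul (tends_cst _) h) (tends_cst _).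
have h2 := @tends_qpoch_arg _ _ qr _ _ (n - i) h1.
have := tends_mul (tends_mul (tends_cst (a ^- n * qpoch (Q ^- n) Q i)) h2)
  (tends_cst (qpoch (a * c * Q ^+ i) Q (n - i) / qpoch Q Q i * Q ^+ i)).
rewrite [X in tends _ X -> _](_ : _ = a ^- n * (qpoch (Q ^- n) Q i *
  (qpoch (a * b * Q ^+ i) Q (n - i) * qpoch (a * c * Q ^+ i) Q (n - i)) /
  qpoch Q Q i * Q ^+ i)); last by ring.
by move=> h3; apply: (eq_tends h3) => k; rewrite /aw_coef !(mulr0, mul0r) !qpoch_const0 !mulr1; ring.
Qed.

Lemma asc_cont n x a (bs : nat -> C) b : tends bs b ->
  tends (fun k => asc_normed Q n x a (bs k)) (asc_normed Q n x a b).
Proof.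
by move=> h; exact: (tends_mul (cdqH_cont n x a 0 h) (tends_cst (qpoch Q Q n)^-1)).
Qed.

(** Each application of [cdqH_shift] replaces b by b Q at the cost of a factor
    1 + O(|b| Q^j), and the product of these factors converges. *)
Lemma cdqH_iter_bound x a c J n b (D : R) : a != 0 ->
  (forall i, (i <= n)%N -> cabs (cdual_qHahn i x a (b * Q ^+ J) c Q) <= D) ->
  forall i, (i <= n)%N -> cabs (cdual_qHahn i x a b c Q) <=
    expR (\sum_(j < J) 2 * (1 + cabs (a * c)) * cabs b * qr ^+ j) * D.
Proof.
move=> a0; elim: J b => [|J IH] b h.
  by move=> i il; rewrite big_ord0 expR0 mul1r; have := h i il; rewrite expr0 mulr1.
have D0 : 0 <= D by rewrite (le_trans _ (h 0%N isT)) ?cabs_ge0.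
have {}IH := IH (b * Q) _.
have {IH} h1 : forall i, (i <= n)%N -> cabs (cdual_qHahn i x a (b * Q) c Q) <=
    expR (\sum_(j < J) 2 * (1 + cabs (a * c)) * cabs (b * Q) * qr ^+ j) * D.
  by apply: IH => i il; have := h i il; rewrite exprS mulrA.
set k0 := 2 * (1 + cabs (a * c)) in h1 *.
have k00 : 0 <= k0 by rewrite mulr_ge0 // addr_ge0 ?cabs_ge0.
set D' := expR _ * D in h1.
have D'0 : 0 <= D' by rewrite mulr_ge0 ?expR_ge0.
have -> : expR (\sum_(j < J.+1) k0 * cabs b * qr ^+ j) * D = expR (k0 * cabs b) * D'.
  rewrite /D' big_ord_recl expr0 mulr1 expRD -mulrA; congr (_ * (expR _ * _)).
  by apply: eq_bigr => j _; rewrite cabsM (cabsQ C qr0) lift0 exprS; ring.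
case=> [|i] il.
  rewrite (le_trans (y := 1 * D')) //; first by rewrite mul1r (_ : cdual_qHahn 0 x a b c Q = cdual_qHahn 0 x a (b * Q) c Q) ?h1 // !cdqH0.
  by rewrite ler_wpM2r // -expR0 ler_expR mulr_ge0 ?cabs_ge0.
rewrite cdqH_shift // (le_trans (cabsB _ _)) //.
rewrite (@le_trans _ _ (D' + k0 * cabs b * D')) //; last first.
  by rewrite -{1}[D']mul1r -mulrDl ler_wpM2r // expR_ge1Dx.
apply: lerD; first exact: h1.
rewrite cabsM; apply: ler_pM; rewrite ?cabs_ge0 //; last by apply: h1; exact: ltnW.
rewrite -mulrA cabsM mulrC ler_wpM2r ?cabs_ge0 // cabsM; apply: ler_pM; rewrite ?cabs_ge0 //.
  rewrite (le_trans (cabsB _ _)) // cabs1 cabsX (cabsQ C qr0).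
  by rewrite -[X in _ <= X]/(1 + 1) lerD // (qrn_le1 qr0 qr1).
by rewrite (le_trans (cabs_1B qr0 _ _)) // lerD2l ler_piMr ?cabs_ge0 // (qrn_le1 qr0 qr1).
Qed.

(** Let J tend to infinity in [cdqH_iter_bound]: for b = 0 the polynomial is, up to
    (Q; Q)_n, an Al-Salam-Chihara polynomial, which [asc_bound] controls, and for
    each n there is a J for which the values at b Q^J are within 1 of those at 0. *)
Lemma cdqH_bound rho a c bmax z : 1 < rho -> a != 0 -> c != 0 -> cabs z = 1 -> 0 <= bmax ->
  exists2 M, 0 <= M & forall b n, cabs b <= bmax ->
    cabs (cdual_qHahn n (mu z) a b c Q) <= M * rho ^+ n.
Proof.
move=> h a0 c0 z1 bm.
have [M M0 hM] := asc_bound h a0 z1 (cabs_ge0 c).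
have rho1 n : 1 <= rho ^+ n by rewrite exprn_ege1 // ltW.
have B0 n : cabs (cdual_qHahn n (mu z) a 0 c Q) <= M * Ebound qr qr * rho ^+ n.
  have -> : cdual_qHahn n (mu z) a 0 c Q = asc_normed Q n (mu z) a c * qpoch Q Q n.
    by rewrite /asc_normed absz_nat divfK // /cdual_qHahn aw_perm_bc.
  rewrite cabsM mulrAC ler_pM ?cabs_ge0 // ?hM //.
  by rewrite (le_trans (cabs_qpoch_le qr0 qr1 _ _)) // (cabsQ C qr0).
set M' := M * Ebound qr qr in B0.
have M'0 : 0 <= M' by rewrite mulr_ge0 ?Ebound_ge0.
pose k0 := 2 * (1 + cabs (a * c)).
have k00 : 0 <= k0 by rewrite mulr_ge0 // addr_ge0 ?cabs_ge0.
exists (Ebound qr (k0 * bmax) * (M' + 1)).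
  by rewrite mulr_ge0 ?Ebound_ge0 // addr_ge0.
move=> b n bb.
have [J hJ] : exists J, forall i, (i <= n)%N ->
    cabs (cdual_qHahn i (mu z) a (b * Q ^+ J) c Q) <= (M' + 1) * rho ^+ n.
  suff [J _ hJ] : \forall J \near \oo, forall i, (i <= n)%N ->
    cabs (cdual_qHahn i (mu z) a (b * Q ^+ J) c Q) <= (M' + 1) * rho ^+ n.
    by exists J; apply: hJ => /=.
  suff hh k : (k <= n)%N -> \forall J \near \oo, forall i, (i <= k)%N ->
    cabs (cdual_qHahn i (mu z) a (b * Q ^+ J) c Q) <= (M' + 1) * rho ^+ n by exact: hh.
  have one i : (i <= n)%N -> \forall J \near \oo,
    cabs (cdual_qHahn i (mu z) a (b * Q ^+ J) c Q) <= (M' + 1) * rho ^+ n.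
    move=> il; have hb : tends (fun J => b * Q ^+ J) 0.
      by have := tends_mul (tends_cst b) (tends_Qn C qr0 qr1); rewrite mulr0.
    have /tends_cabsP/(_ _ ltr01) := cdqH_cont i (mu z) a c hb; apply: filterS => J hJ.
    rewrite -[cdual_qHahn _ _ _ _ _ _](subrK (cdual_qHahn i (mu z) a 0 c Q)).
    rewrite (le_trans (cabsD _ _)) // addrC mulrDl lerD //.
      by rewrite (le_trans (B0 i)) // ler_wpM2l // ler_weXn2l // ltW.
    by rewrite (le_trans hJ) // mul1r.
  elim: k => [|k IH] kn.
    by apply: filterS (one 0%N isT) => J hJ [].
  apply: filterS2 (IH (ltnW kn)) (one _ kn) => J h1 h2 i; rewrite leq_eqVlt => /orP[/eqP ->//|].
  by rewrite ltnS; exact: h1.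
rewrite (le_trans (cdqH_iter_bound a0 hJ (leqnn n))) // -[leRHS]mulrA.
rewrite ler_wpM2r //; first by rewrite mulr_ge0 ?addr_ge0 // exprn_ge0 // ltW // (lt_trans ltr01).
rewrite (le_trans (y := Ebound qr (k0 * cabs b))) //.
  by rewrite ler_expR (sum_geometric_le qr0 qr1) // mulr_ge0 ?cabs_ge0.
by rewrite Ebound_le // ler_wpM2l.
Qed.

End Bounds.

(** * The bilinear sum as a function of b *)

Section Shift.
Variable (K : numFieldType).
Implicit Types (u : nat -> K) (l : K).

Lemma sums_unshift n u l : sums u l -> sums (fun k => u (n + k)%N) (l - series u n).
Proof.
move=> /(proj2 (tends_shift n _ _)) h; apply: (eq_tends (tends_sub h (tends_cst (series u n)))) => k.
rewrite series_addn addrC addKr -{1}[n]add0n big_addn addnK /series /=.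
by apply: eq_bigr => i _; rewrite addnC.
Qed.

Lemma series_eq0 n u : (forall i, (i < n)%N -> u i = 0) -> series u n = 0.
Proof. by move=> h; rewrite /series /= big_nat big1 // => i /andP[_ /h]. Qed.

(** Two ways of summing H over all integers k with k >= 0 and k + m >= 0. *)
Lemma sums_int_shift (H : int -> K) (m : int) l :
  (forall k, k < 0 -> H k = 0) -> (forall k, k + m < 0 -> H k = 0) ->
  sums (fun n : nat => H (n%:Z - m)) l -> sums (fun n : nat => H n) l.
Proof.
move=> H0 Hm; case: m Hm => [m Hm|m Hm].
  move=> /(sums_unshift m); rewrite series_eq0 ?subr0 => [h|i im]; last by apply: H0; lia.
  by apply: (eq_sums h) => k; congr H; lia.
move=> h; rewrite -[l]add0r.
have <- : series (fun n : nat => H n) m.+1 = 0 by apply: series_eq0 => i im; apply: Hm; lia.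
by apply: sums_shift; apply: (eq_sums h) => k; congr H; lia.
Qed.

End Shift.

Section Growth.
Variables (R : realType) (C : completeField R).
Implicit Type sg : C.

(** A rate rho > 1 with |sg| rho^2 < 1: each of the two polynomials in [bil_term] is
    O(rho^n). *)
Definition growth sg : R := 2 / (1 + cabs sg).

Lemma growth_gt1 sg : cabs sg < 1 -> 1 < growth sg.
Proof.
move=> sg1; have h : 0 < 1 + cabs sg by rewrite ltr_pwDl ?cabs_ge0.
by rewrite /growth ltr_pdivlMr // mul1r -[X in _ < X]/(1 + 1) ltrD2l.
Qed.

Lemma growth_ratio_ge0 sg : 0 <= cabs sg * growth sg * growth sg.
Proof.
have h : 0 <= growth sg by rewrite divr_ge0 // addr_ge0 ?cabs_ge0.
by apply: mulr_ge0 => //; apply: mulr_ge0 => //; exact: cabs_ge0.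
Qed.

Lemma growth_ratio_lt1 sg : cabs sg < 1 -> cabs sg * growth sg * growth sg < 1.
Proof.
rewrite /growth => sg1; have h : 0 < 1 + cabs sg by rewrite ltr_pwDl ?cabs_ge0.
have -> : cabs sg * (2 / (1 + cabs sg)) * (2 / (1 + cabs sg)) = 4 * cabs sg / (1 + cabs sg) ^+ 2.
  by field; rewrite gt_eqF.
rewrite ltr_pdivrMr ?exprn_gt0 // mul1r.
have : 0 < (1 - cabs sg) ^+ 2 by rewrite exprn_gt0 // subr_gt0.
by rewrite !expr2; nra.
Qed.

End Growth.

Section Bilinear.
Variables (R : realType) (C : completeField R).
Local Notation ofR := (cfR C).
Variable qr : R.
Hypotheses (qr0 : 0 < qr) (qr1 : qr < 1).
Local Notation Q := (ofR qr).
Implicit Types (a b c z : C) (r rho : R) (n k : nat).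

Let Qn0 := Qneq0 C qr0.
Let nz := nzQ C qr0 qr1.

Variables (x y sg A : C) (m : int).
Hypotheses (x1 : cabs x = 1) (y1 : cabs y = 1) (sg0 : sg != 0) (sg1 : cabs sg < 1) (A0 : A != 0).

Variables (al ga : C).
Hypotheses (alE : al = A * Q ^ m * sg) (gaE : ga = Q / (A * sg)).

Let x0 : x != 0. Proof. by rewrite -cabs_eq0 x1 oner_neq0. Qed.
Let Qz (h : int) : Q ^ h != 0. Proof. by rewrite expfz_neq0. Qed.
Let al0 : al != 0. Proof. by rewrite alE !mulf_neq0. Qed.
Let ga0 : ga != 0. Proof. by rewrite gaE mulf_neq0 ?invr_eq0 ?mulf_neq0. Qed.
Let alga : al * ga = Q ^ (m + 1).
Proof. by rewrite alE gaE expfzDr // expr1z; field; rewrite A0 sg0. Qed.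

(** The infinite product absorbs the factor 1 - al b Q^n of [cdqH_rec], so that al
    drops out of that relation, see [cdq_weighted_rec]. *)
Definition cdq_weighted n b : C :=
  cdual_qHahn n (mu y) al b ga Q * qpoch_inf (al * b * Q ^+ n) Q / qpoch Q Q n.

Definition bil_term n b : C :=
  sg ^+ n * asc_normed Q (n%:Z + m) (mu x) A (b * sg) * cdq_weighted n b.

Lemma cdq_weighted_shift n b : cdq_weighted n.+1 b =
  (1 - al * b * Q ^+ n.+1) * cdq_weighted n.+1 (b * Q)
  - b * (1 - Q ^ (n.+1%:Z + m)) * cdq_weighted n (b * Q).
Proof.
rewrite /cdq_weighted cdqH_shift //.
have -> : al * ga * Q ^+ n = Q ^ (n.+1%:Z + m).
  by rewrite alga exprnP -expfzDr //; congr (_ ^ _); clear; lia.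
rewrite (qpoch_infS qr0 qr1 (al * b * Q ^+ n.+1)).
have -> : al * b * Q ^+ n.+1 * Q = al * (b * Q) * Q ^+ n.+1 by ring.
have E : al * (b * Q) * Q ^+ n = al * b * Q ^+ n.+1 by rewrite exprS; ring.
rewrite E (qpoch_infS qr0 qr1 (al * b * Q ^+ n.+1)).
have -> : al * b * Q ^+ n.+1 * Q = al * (b * Q) * Q ^+ n.+1 by ring.
rewrite qpochSr -exprS; have n1 := nz n; have n2 := nzS nz n.
move: (Q ^ _) (qpoch_inf _ _) (cdual_qHahn _ _ _ _ _ _) (cdual_qHahn _ _ _ _ _ _) => V G1 P1 P2.
move: n1 n2; move: (qpoch Q Q n) (Q ^+ n.+1) => G2 W n1 n2.
by field; rewrite n1 n2.
Qed.

Lemma cdq_weighted_shift0 b : cdq_weighted 0 b =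
  (1 - al * b * Q ^+ 0) * cdq_weighted 0 (b * Q).
Proof.
rewrite /cdq_weighted !cdqH0 !qpoch0 !expr0 !mulr1 (qpoch_infS qr0 qr1 (al * b)).
by rewrite mulrA; ring.
Qed.

Local Notation rho := (growth sg).
Local Notation ratio := (cabs sg * growth sg * growth sg).
Let rho1 : 1 < rho. Proof. exact: growth_gt1. Qed.
Let ratio0 : 0 <= ratio. Proof. exact: growth_ratio_ge0. Qed.
Let ratio1 : ratio < 1. Proof. exact: growth_ratio_lt1. Qed.

Lemma asc_int_bound a bmax (h : int) : a != 0 -> 0 <= bmax ->
  exists2 M, 0 <= M & forall b n, b != 0 -> cabs b <= bmax ->
    cabs (asc_normed Q (n%:Z + h) (mu x) a b) <= M * rho ^+ n.
Proof.
move=> a0 bm; have [M M0 hM] := asc_bound qr0 qr1 rho1 a0 x1 bm.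
have r0 : 0 <= rho by rewrite ltW // (lt_trans ltr01 rho1).
exists (M * rho ^+ `|h|%N); first by rewrite mulr_ge0 // exprn_ge0.
move=> b n b0 bb; case E : (n%:Z + h) => [k|k]; last first.
  by rewrite /asc_normed /= mul0r cabs0 !mulr_ge0 // exprn_ge0.
rewrite (le_trans (hM _ _ b0 bb)) // -mulrA ler_wpM2l // -exprD ler_weXn2l ?ltW //.
by move: E; clear; lia.
Qed.

Lemma cdq_weighted_bound bmax : 0 <= bmax ->
  exists2 M, 0 <= M & forall b n, cabs b <= bmax -> cabs (cdq_weighted n b) <= M * rho ^+ n.
Proof.
move=> bm; have [M M0 hM] := cdqH_bound qr0 qr1 rho1 al0 ga0 y1 bm.
exists (M * Ebound qr (cabs al * bmax) * qbound qr 0).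
  by apply: mulr_ge0; rewrite ?qbound_ge0 //; apply: mulr_ge0; rewrite ?Ebound_ge0.
move=> b n bb; rewrite /cdq_weighted.
have B2 : cabs (qpoch_inf (al * b * Q ^+ n) Q) <= Ebound qr (cabs al * bmax).
  rewrite (le_trans (cabs_qpoch_inf_le qr0 qr1 _)) // Ebound_le //.
  rewrite [cabs (_ * _)]cabsM cabsX (cabsQ C qr0) (@le_trans _ _ (cabs (al * b))) //.
    by rewrite ler_piMr ?cabs_ge0 ?(qrn_le1 qr0 qr1).
  by rewrite [cabs (al * b)]cabsM ler_wpM2l ?cabs_ge0.
have B3 := cabs_qpochQV_le C qr0 qr1 n; have B1 := hM b n bb.
rewrite cabsM (_ : M * _ * _ * _ = M * rho ^+ n * Ebound qr (cabs al * bmax) * qbound qr 0); last by ring.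
apply: ler_pM; rewrite ?cabs_ge0 //; rewrite cabsM; apply: ler_pM; rewrite ?cabs_ge0 //.
Qed.

Lemma bil_bound bmax : 0 <= bmax ->
  exists2 M, 0 <= M & forall b n, b != 0 -> cabs b <= bmax -> cabs (bil_term n b) <= M * ratio ^+ n.
Proof.
move=> bm.
have [M1 M10 h1] := asc_int_bound m A0 bm.
have [M2 M20 h2] := cdq_weighted_bound bm.
exists (M1 * M2); first by rewrite mulr_ge0.
move=> b n b0 bb; rewrite /bil_term.
have bs0 : b * sg != 0 by rewrite mulf_neq0.
have bs : cabs (b * sg) <= bmax by rewrite cabsM (le_trans _ bb) // ler_piMr ?cabs_ge0 // ltW.
have B1 := h1 _ n bs0 bs; have B2 := h2 _ n bb.
rewrite (_ : M1 * M2 * ratio ^+ n = cabs sg ^+ n * (M1 * rho ^+ n) * (M2 * rho ^+ n)); last first.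
  by rewrite !exprMn; ring.
rewrite cabsM; apply: ler_pM; rewrite ?cabs_ge0 //.
by rewrite cabsM cabsX ler_wpM2l // exprn_ge0 // cabs_ge0.
Qed.

(** Shift b in P_n by [cdq_weighted_shift], move the term with n - 1 to index n by
    summation by parts, and collect g_(n+m) and g_(n+m+1) by [asc_normed_rec]; this
    uses A b sg Q^(n+m) = al b Q^n. *)
Lemma bil_step b l l' : b != 0 -> sums (bil_term^~ b) l -> sums (bil_term^~ (b * Q)) l' ->
  l = (1 - b * sg * x) * (1 - b * sg / x) * l'.
Proof.
move=> b0 hl hl'.
(* the boundary term of the summation by parts *)
pose W n := if n is k.+1 then sg ^+ k.+1 * asc_normed Q (k.+1%:Z + m) (mu x) A (b * sg)
   * (b * (1 - Q ^ (k.+1%:Z + m)) * cdq_weighted k (b * Q)) else 0.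
have [M1 M10 h1] := asc_int_bound (1 + m) A0 (cabs_ge0 (b * sg)).
have [M2 M20 h2] := cdq_weighted_bound (cabs_ge0 (b * Q)).
have bs0 : b * sg != 0 by rewrite mulf_neq0.
have W0 : tends W 0.
  apply/(tends_shift 1).
  (* 1 - Q^(k+1+m) tends to 1, and the other factors of W (k+1) are
     geometrically small *)
  have Wb k : cabs (W (k + 1)%N / (1 - Q ^ (k.+1%:Z + m))) <= cabs (sg * b) * M1 * M2 * ratio ^+ k.
    rewrite addn1 /W.
    have [E|nE] := eqVneq (1 - Q ^ (k.+1%:Z + m)) 0.
      by rewrite E invr0 mulr0 cabs0 !mulr_ge0 ?cabs_ge0 // exprn_ge0.
    rewrite (_ : _ / _ = sg * b * (sg ^+ k * asc_normed Q (k%:Z + (1 + m)) (mu x) A (b * sg) * cdq_weighted k (b * Q))); last first.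
      rewrite (_ : k%:Z + (1 + m) = k.+1%:Z + m); last by clear; lia.
      by rewrite exprS; move: (asc_normed _ _ _ _ _) (cdq_weighted _ _) => G1 G2; field.
    rewrite cabsM (_ : _ * _ * _ * _ = cabs (sg * b) * (cabs sg ^+ k * (M1 * rho ^+ k) * (M2 * rho ^+ k))); last first.
      by rewrite !exprMn; ring.
    rewrite ler_wpM2l ?cabs_ge0 // cabsM; apply: ler_pM; rewrite ?cabs_ge0 ?h2 //.
    by rewrite cabsM cabsX ler_wpM2l ?h1 // exprn_ge0 // cabs_ge0.
  have t1 : tends (fun k => Q ^ (k.+1%:Z + m)) 0.
    have := tends_mul (tends_Qn C qr0 qr1) (tends_cst (Q ^ (1 + m))); rewrite mul0r => h.
    by apply: (eq_tends h) => k; rewrite exprnP -expfzDr //; congr (_ ^ _); clear; lia.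
  have t2 := tends0_geometric ratio0 ratio1 Wb.
  have := tends_mul t2 (tends_sub (tends_cst 1) t1); rewrite mul0r => h; apply: (eq_tends h) => k.
  rewrite addn1 /W; have [E|nE] := eqVneq (1 - Q ^ (k.+1%:Z + m)) 0.
    by rewrite E !(mulr0, mul0r).
  by rewrite divfK.
have key n : bil_term n b = (1 - b * sg * x) * (1 - b * sg / x) * bil_term n (b * Q) + (W n.+1 - W n).
  have -> : (1 - b * sg * x) * (1 - b * sg / x) = 1 - 2%:R * (b * sg) * mu x + (b * sg) ^+ 2.
    by rewrite /mu; field.
  have := asc_normed_rec Qn0 nz (n%:Z + m) (mu x) (b * sg) A0.
  have -> : n%:Z + m + 1 = n.+1%:Z + m by clear; lia.
  have -> : A * (b * sg) * Q ^ (n%:Z + m) = al * b * Q ^+ n.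
    by rewrite alE expfzDr // -exprnP; ring.
  move=> E; have EW : W n.+1 = sg ^+ n * cdq_weighted n (b * Q) *
     (b * sg * (1 - Q ^ (n.+1%:Z + m)) * asc_normed Q (n.+1%:Z + m) (mu x) A (b * sg)).
    by rewrite /W exprS; ring.
  rewrite EW E /bil_term.
  have -> : b * Q * sg = b * sg * Q by ring.
  case: n E EW => [|n] E EW.
    by rewrite /W cdq_weighted_shift0; ring.
  by rewrite /W cdq_weighted_shift; ring.
have := sumsD (sumsZ ((1 - b * sg * x) * (1 - b * sg / x)) hl') (sums_telescope W0).
rewrite oppr0 addr0 => h; apply: (sums_unique hl); apply: (eq_sums h) => n.
by rewrite key.
Qed.

(** Iterate [bil_step]; the terms are continuous at b = 0 and bounded uniformly in
    n for b Q^n, so [tannery] gives the limit of the sums.  The sum f0 at b = 0 is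
    defined without reference to the starting point. *)
Lemma bil_sum : exists f0, forall b, b != 0 ->
  sums (bil_term^~ b) (qpoch_inf (b * sg * x) Q * qpoch_inf (b * sg / x) Q * f0).
Proof.
have lim0 b : b != 0 -> exists2 f0, sums (bil_term^~ 0) f0 &
    sums (bil_term^~ b) (qpoch_inf (b * sg * x) Q * qpoch_inf (b * sg / x) Q * f0).
  move=> b0; have [M M0 hM] := bil_bound (cabs_ge0 b).
  have bn0 n : b * Q ^+ n != 0 by rewrite mulf_neq0 ?expf_neq0.
  have bnb n : cabs (b * Q ^+ n) <= cabs b.
    by rewrite cabsM cabsX (cabsQ C qr0) ler_piMr ?cabs_ge0 ?(qrn_le1 qr0 qr1).
  have ex n : exists l, sums (bil_term^~ (b * Q ^+ n)) l.
    by apply: (geometric_dominated ratio0 ratio1) => k; exact: hM.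
  have [s hs] : exists s : nat -> C, forall n, sums (bil_term^~ (b * Q ^+ n)) (s n).
    by exists (fun n => sval (cid (ex n))) => n; case: (cid _).
  have iter n : s 0%N = qpoch (b * sg * x) Q n * qpoch (b * sg / x) Q n * s n.
    elim: n => [|n IH]; first by rewrite !qpoch0 !mul1r.
    rewrite IH !qpochSr (bil_step (bn0 n) (hs n) (l' := s n.+1)).
      by rewrite (_ : b * Q ^+ n * sg * x = b * sg * x * Q ^+ n); [ring | ring].
    by have := hs n.+1; rewrite exprSr mulrA.
  have [f0 hf sf] : exists2 f0, sums (bil_term^~ 0) f0 & tends s f0.
    apply: (tannery M0 ratio0 ratio1 (F := fun n => bil_term^~ (b * Q ^+ n))) => //.
      by move=> n k; exact: hM.
    move=> k; have hb : tends (fun n => b * Q ^+ n) 0.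
      by have := tends_mul (tends_cst b) (tends_Qn C qr0 qr1); rewrite mulr0.
    rewrite /bil_term; apply: tends_mul.
      apply: tends_mul (tends_cst _) _.
      have hb' := tends_mul hb (tends_cst sg).
      case: (k%:Z + m) => [j|j]; first exact: asc_cont.
      by rewrite /asc_normed /= mul0r; exact: tends_cst.
    apply: tends_mul (tends_cst _); apply: tends_mul; first exact: cdqH_cont.
    rewrite mulr0 mul0r.
    have -> : qpoch_inf 0 Q = 1.
      apply: (tends_unique (tends_qpoch qr0 qr1 0)); apply: (eq_tends (tends_cst _)) => n.
      by rewrite qpoch_const0.
    apply: (eq_tends (tends_qpoch_inf_1 qr0 qr1 (al * b * Q ^+ k))) => n.
    by congr qpoch_inf; ring.
  exists f0 => //; have h0 := hs 0%N; rewrite expr0 mulr1 in h0.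
  suff -> : qpoch_inf (b * sg * x) Q * qpoch_inf (b * sg / x) Q * f0 = s 0%N by [].
  have h := tends_mul (tends_mul (tends_qpoch qr0 qr1 (b * sg * x)) (tends_qpoch qr0 qr1 (b * sg / x))) sf.
  by apply: (tends_unique h); apply: (eq_tends (tends_cst _)) => n; rewrite -iter.
have [f0 hf0 _] := lim0 1 (oner_neq0 _); exists f0 => b /lim0[f1 hf1].
by rewrite (sums_unique hf0 hf1).
Qed.

End Bilinear.

(** * The value of the bilinear sum *)

Section Value.
Variables (R : realType) (C : completeField R).
Local Notation ofR := (cfR C).
Variable qr : R.
Hypotheses (qr0 : 0 < qr) (qr1 : qr < 1).
Local Notation Q := (ofR qr).
Implicit Types (a b c z : C) (r rho : R) (n k : nat).

Let Qn0 := Qneq0 C qr0.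
Let nz := nzQ C qr0 qr1.

Variables (x y sg A : C) (m : int).
Hypotheses (x1 : cabs x = 1) (y1 : cabs y = 1) (sg0 : sg != 0) (sg1 : cabs sg < 1) (A0 : A != 0).

Variables (al ga g : C).
Hypotheses (alE : al = A * Q ^ m * sg) (gaE : ga = Q / (A * sg)) (g2 : g ^+ 2 = Q).

Let x0 : x != 0. Proof. by rewrite -cabs_eq0 x1 oner_neq0. Qed.
Let y0 : y != 0. Proof. by rewrite -cabs_eq0 y1 oner_neq0. Qed.
Let Qz (h : int) : Q ^ h != 0. Proof. by rewrite expfz_neq0. Qed.
Let al0 : al != 0. Proof. by rewrite alE !mulf_neq0. Qed.
Let ga0 : ga != 0. Proof. by rewrite gaE mulf_neq0 ?invr_eq0 ?mulf_neq0. Qed.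

Let unit_prod a b : cabs a = 1 -> cabs b = 1 -> cabs (sg * a * b) = cabs sg.
Proof. by move=> ha hb; rewrite cabsM hb mulr1 cabsM ha mulr1. Qed.
Let xV1 : cabs x^-1 = 1. Proof. by rewrite cabsV x1 invr1. Qed.
Let yV1 : cabs y^-1 = 1. Proof. by rewrite cabsV y1 invr1. Qed.

(** The terms of the 2phi2 of the theorem with the denominators (Y, sg^2; Q)_j
    cleared by the infinite products, where Y = Q^(1-m) x / A. *)
Definition phi_term j : C :=
  qbin Q (sg * x * y) j * qpoch (sg * x / y) Q j * qpoch_inf (Q ^ (1 - m) * x / A * Q ^+ j) Q
  * qpoch_inf (sg ^+ 2 * Q ^+ j) Q * (- (Q ^ (1 - m) / (A * x))) ^+ j * Q ^+ 'C(j, 2).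

Definition bil_const : C :=
  (- (Q / A)) ^ (- m) * g ^ (m * (m + 1)) * qpoch_inf (al * y) Q * qpoch_inf (al / y) Q
  / (qpoch_inf Q Q * (qpoch_inf (sg * x * y) Q * qpoch_inf (sg / x * y) Q
      * qpoch_inf (sg * x / y) Q * qpoch_inf (sg / x / y) Q)).

(** The value of the sum at b = y, where P_n = y^(-n) (al y, ga y; Q)_n by
    [cdqH_special]. *)
Lemma bil_special : exists2 S, sums phi_term S &
  sums (fun n => bil_term qr x y sg A m al ga n y)
    (qpoch_inf (al * y) Q * ((- (Q / A)) ^ (- m) * g ^ (m * (m + 1)) * qpoch_inf (al / y) Q
      / (qpoch_inf Q Q * qpoch_inf (sg * x / y) Q)) * (S / qpoch_inf (sg / x / y) Q)).
Proof.
pose c := sg / y; pose X := ga * y; pose a := A / x; pose e := sg * x * y.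
have c0 : c != 0 by rewrite mulf_neq0 ?invr_eq0.
have X0 : X != 0 by rewrite mulf_neq0.
have a0 : a != 0 by rewrite mulf_neq0 ?invr_eq0.
have ysg0 : y * sg != 0 by rewrite mulf_neq0.
have cs : cabs c = cabs sg by rewrite cabsM yV1 mulr1.
have Ez : Q / (a * X) = sg * x / y by rewrite /a /X gaE; field; rewrite A0 sg0 x0 y0 Qn0.
have z1 : cabs (Q / (a * X)) < 1 by rewrite Ez unit_prod.
have w1 : cabs (sg / x / y) < 1 by rewrite unit_prod.
pose X' := X * Q ^ (- m).
have [S hS1 hS2] := @heine22 R C qr qr0 qr1 e X' (sg * x / y) _ w1.
have EDX : sg * x / y * X' = Q ^ (1 - m) * x / A.
  by rewrite /X' /X gaE expfzDr // expr1z; field; rewrite A0 sg0 y0.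
have Eez : e * (sg / x / y) = sg ^+ 2 by rewrite /e; field; rewrite x0 y0.
have EXz : X' * (sg / x / y) = Q ^ (1 - m) / (A * x).
  by rewrite /X' /X gaE expfzDr // expr1z; field; rewrite A0 sg0 y0 x0.
exists S.
  by apply: (eq_sums hS2) => j; rewrite /phi_term EDX Eez EXz.
(* g_(n+m) = sum of v l * u (n + m - l); with i = n + m - l the sum over i is
   evaluated by [gauss_int] and the sum over l by [heine22] *)
pose u i := qbin Q a i * x ^+ i.
pose v i := qbin Q e i * x ^- i.
pose F l i := v l * c ^+ l * (u i * c ^+ i) * (c ^ (- m) * qbinz qr X (i%:Z + l%:Z - m)).
pose H (h : int) := c ^ h * qbinz qr X h * asc_normed Q (h + m) (mu x) A (y * sg).
have HT n : bil_term qr x y sg A m al ga n y = qpoch_inf (al * y) Q * H n.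
  rewrite /bil_term /cdq_weighted cdqH_special // (qpoch_inf_split qr0 qr1 n (al * y)).
  rewrite /H /qbinz /qbin -exprnP /c expr_div_n /X.
  by have n1 := nz n; have n2 := expf_neq0 n y0; field; rewrite n1 n2.
have asc_conv (h : int) (n : nat) : h = n -> asc_normed Q h (mu x) A (y * sg) =
   \sum_(l < n.+1) v l * u (n - l)%N.
  move=> ->; rewrite (asc_convolution Qn0 nz) // /u /v /e.
  rewrite (_ : y * sg * x = sg * x * y); last by ring.
  rewrite (reindex_inj rev_ord_inj) /=; apply: eq_bigr => -[l /= ll] _.
  by rewrite subSS subKn ?(mulrC (_ * _ ^+ _)) // -ltnS.
have FH (n : nat) : \sum_(l < n.+1) F l (n - l)%N = H (n%:Z - m).
  rewrite /H (asc_conv _ n) ?subrK // expfzDr // -exprnP !mulr_sumr.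
  apply: eq_bigr => -[l /=]; rewrite ltnS => ln _; rewrite /F.
  have -> : c ^+ n = c ^+ l * c ^+ (n - l) by rewrite -exprD subnKC.
  have -> : (n - l)%N%:Z + l%:Z - m = n%:Z - m by move: ln; clear; lia.
  by ring.
have q0 (t : R) : 0 <= qbound qr t by exact: qbound_ge0.
pose M := qbound qr (cabs e) * qbound qr (cabs a) * (cabs (c ^ (- m)) * qbound qr (cabs X)).
have M0 : 0 <= M by rewrite /M; apply: mulr_ge0; apply: mulr_ge0; rewrite ?cabs_ge0.
have FM l i : cabs (F l i) <= M * cabs sg ^+ l * cabs sg ^+ i.
  have B1 : cabs (v l * c ^+ l) <= qbound qr (cabs e) * cabs sg ^+ l.
    rewrite cabsM cabsX cs ler_wpM2r ?exprn_ge0 ?cabs_ge0 //.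
    by rewrite /v cabsM cabsV cabsX x1 expr1n invr1 mulr1 cabs_qbin_le.
  have B2 : cabs (u i * c ^+ i) <= qbound qr (cabs a) * cabs sg ^+ i.
    rewrite cabsM cabsX cs ler_wpM2r ?exprn_ge0 ?cabs_ge0 //.
    by rewrite /u cabsM cabsX x1 expr1n mulr1 cabs_qbin_le.
  have B3 : cabs (c ^ (- m) * qbinz qr X (i%:Z + l%:Z - m)) <= cabs (c ^ (- m)) * qbound qr (cabs X).
    rewrite cabsM ler_wpM2l ?cabs_ge0 //; case: (_ - m) => k /=; first exact: cabs_qbin_le.
    by rewrite cabs0.
  rewrite /F cabsM (_ : M * _ * _ = qbound qr (cabs e) * cabs sg ^+ l * (qbound qr (cabs a) * cabs sg ^+ i)
     * (cabs (c ^ (- m)) * qbound qr (cabs X))); last by rewrite /M; ring.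
  apply: ler_pM; rewrite ?cabs_ge0 // cabsM; apply: ler_pM; rewrite ?cabs_ge0 //.
have Fs l : sums (F l) (v l * c ^+ l * c ^ (- m) * gaussK qr g m l a X).
  have := sumsZ (v l * c ^+ l * c ^ (- m)) (gauss_int qr0 qr1 g2 m l a0 X0 z1).
  move=> h; apply: (eq_sums h) => i; rewrite Ez /F /u.
  have -> : (sg * x / y) ^+ i = x ^+ i * c ^+ i by rewrite -exprMn /c; congr (_ ^+ _); ring.
  by ring.
have [l hl1 hl2] := antidiagonal_sums M0 (cabs_ge0 _) sg1 FM Fs.
have hH : sums (fun n : nat => H n) l.
  apply: (@sums_int_shift _ H m).
  - by case=> // k _; rewrite /H /= mulr0 mul0r.
  - by move=> k km; rewrite /H; case: (k + m) km => // j _; rewrite /asc_normed /= mul0r mulr0.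
  - by apply: (eq_sums hl2) => n; rewrite FH.
have := sumsZ (qpoch_inf (al * y) Q) hH; rewrite -mulrA.
suff -> : l = (- (Q / A)) ^ (- m) * g ^ (m * (m + 1)) * qpoch_inf (al / y) Q
   / (qpoch_inf Q Q * qpoch_inf (sg * x / y) Q) * (S / qpoch_inf (sg / x / y) Q).
  by move=> h; apply: (eq_sums h) => n; rewrite HT.
apply: (sums_unique hl1).
have := sumsZ ((- (Q / A)) ^ (- m) * g ^ (m * (m + 1)) * qpoch_inf (al / y) Q
   / (qpoch_inf Q Q * qpoch_inf (sg * x / y) Q)) hS1.
move=> h; apply: (eq_sums h) => k; rewrite /gaussK Ez EDX -/X'.
have -> : Q ^ (1 + m) / X = al / y.
  by rewrite alE /X gaE expfzDr // expr1z; field; rewrite A0 sg0 y0 Qn0.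
have -> : Q ^ (k%:Z + 1 - m) / a = Q ^ (1 - m) * x / A * Q ^+ k.
  rewrite /a -(addrA k%:Z) expfzDr // -exprnP.
  by move: (Q ^ _) => V; field; rewrite A0 x0.
have -> : (- (Q / A)) ^ (- m) = c ^ (- m) * (- X) ^ (- m).
  rewrite -expfzMl; congr (_ ^ _); rewrite /c /X gaE; field; by rewrite A0 sg0 y0.
have -> : (sg / x / y) ^+ k = c ^+ k * x ^- k.
  by rewrite -exprVn -exprMn /c; congr (_ ^+ _); ring.
rewrite /v; move: (qpoch_inf Q Q * _)^-1 => G.
by ring.
Qed.

(** [bil_sum] with its constant determined by comparison at b = y, which is possible
    since (y sg x, y sg / x; Q)_oo is not zero for |sg| < 1. *)
Lemma bil_value : exists2 S, sums phi_term S &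
  forall b, b != 0 -> sums (fun n => bil_term qr x y sg A m al ga n b)
    (qpoch_inf (b * sg * x) Q * qpoch_inf (b * sg / x) Q * (bil_const * S)).
Proof.
have [S hS hy] := bil_special; exists S => // b b0.
have [f0 hf] := bil_sum qr0 qr1 x1 y1 sg0 sg1 A0 alE gaE.
suff -> : bil_const * S = f0 by exact: hf.
have := sums_unique hy (hf y y0).
rewrite (_ : y * sg * x = sg * x * y); last by ring.
rewrite (_ : y * sg / x = sg / x * y); last by ring.
have n0 : qpoch_inf Q Q != 0 by apply: qpoch_inf_neq0_small; rewrite ?(cabsQ C qr0).
have n1 : qpoch_inf (sg * x * y) Q != 0 by apply: qpoch_inf_neq0_small; rewrite ?unit_prod.
have n2 : qpoch_inf (sg / x * y) Q != 0 by apply: qpoch_inf_neq0_small; rewrite ?unit_prod.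
have n3 : qpoch_inf (sg * x / y) Q != 0 by apply: qpoch_inf_neq0_small; rewrite ?unit_prod.
have n4 : qpoch_inf (sg / x / y) Q != 0 by apply: qpoch_inf_neq0_small; rewrite ?unit_prod.
rewrite /bil_const; move: n0 n1 n2 n3 n4.
move: (qpoch_inf (sg * x * y) Q) (qpoch_inf (sg / x * y) Q) (qpoch_inf (sg * x / y) Q) (qpoch_inf (sg / x / y) Q).
move: (qpoch_inf Q Q) (qpoch_inf (al * y) Q) (qpoch_inf (al / y) Q) (_ ^ (- m)) (_ ^ (m * _)).
move=> G1 G2 G3 G4 G5 G6 G7 G8 G9 n0 n1 n2 n3 n4 E.
apply: (mulfI n1); apply: (mulfI n2); rewrite [RHS]mulrCA [RHS]mulrA -E.
by field; rewrite n0 n1 n2 n3 n4.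
Qed.

End Value.

(** * Induction on p *)

Section PStep.
Variables (R : realType) (C : completeField R).
Local Notation ofR := (cfR C).
Variable qr : R.
Hypotheses (qr0 : 0 < qr) (qr1 : qr < 1).
Local Notation Q := (ofR qr).
Implicit Types (a b c z k : C) (r : R) (n p : nat).

Let Qn0 := Qneq0 C qr0.
Let nz := nzQ C qr0 qr1.

Variables (x y sg A : C) (m : int).
Hypotheses (x1 : cabs x = 1) (y1 : cabs y = 1) (sg0 : sg != 0) (sg1 : cabs sg < 1) (A0 : A != 0).

Variables (al ga g : C).
Hypotheses (alE : al = A * Q ^ m * sg) (gaE : ga = Q / (A * sg)) (g2 : g ^+ 2 = Q).

Let x0 : x != 0. Proof. by rewrite -cabs_eq0 x1 oner_neq0. Qed.
Let Qz (h : int) : Q ^ h != 0. Proof. by rewrite expfz_neq0. Qed.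
Let al0 : al != 0. Proof. by rewrite alE !mulf_neq0. Qed.
Let ga0 : ga != 0. Proof. by rewrite gaE mulf_neq0 ?invr_eq0 ?mulf_neq0. Qed.

Local Notation rho := (growth sg).
Local Notation ratio := (cabs sg * growth sg * growth sg).
Local Notation cdw := (cdq_weighted qr y al ga).

(** The parameters A and b sg of g and the polynomial w_p vary with p in such a way
    that A Q^(-p) * b sg Q^p is constant; k = b ga moves with b. *)
Definition tri_term p n b : C :=
  sg ^+ n * asc_normed Q (n%:Z + m) (mu x) (A / Q ^+ p) (b * sg * Q ^+ p)
  * cdw n b * dual_poly Q (sg ^+ 2) p n (b * ga).

(** A polynomial in Q^n with |Q^n| <= 1. *)
Lemma dual_poly_bound p k : exists2 M, 0 <= M & forall n, cabs (dual_poly Q (sg ^+ 2) p n k) <= M.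
Proof.
exists (\sum_(j < p.+1) cabs (dual_coef Q (sg ^+ 2) p j k) * \prod_(i < j) (1 + cabs (Q^-1 ^+ i))).
  apply: sumr_ge0 => j _; rewrite mulr_ge0 ?cabs_ge0 //.
  by apply: prodr_ge0 => i _; rewrite addr_ge0 ?cabs_ge0.
move=> n; rewrite /dual_poly (le_trans (cabs_sum _ _ _)) //; apply: ler_sum => j _.
rewrite cabsM ler_wpM2l ?cabs_ge0 //.
elim: (j : nat) => [|i IH]; first by rewrite qpoch0 big_ord0 cabs1.
rewrite qpochSr cabsM big_ord_recr /= ler_pM ?cabs_ge0 // (le_trans (cabsB _ _)) // cabs1 lerD2l.
by rewrite cabsM ler_piMl ?cabs_ge0 // cabsX (cabsQ C qr0) (qrn_le1 qr0 qr1).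
Qed.

Lemma cdq_weighted_rec n b :
  (1 - 2%:R * b * mu y + b ^+ 2) * cdw n (b * Q) =
  (1 - b * ga * Q ^+ n) * cdw n b - b * (1 - Q ^+ n.+1) * cdw n.+1 b.
Proof.
rewrite /cdq_weighted.
have -> : al * (b * Q) * Q ^+ n = al * b * Q ^+ n.+1 by rewrite exprS; ring.
rewrite (qpoch_infS qr0 qr1 (al * b * Q ^+ n)).
have -> : al * b * Q ^+ n * Q = al * b * Q ^+ n.+1 by rewrite exprSr !mulrA.
have E := cdqH_rec Qn0 nz n (mu y) b ga al0.
have n1 := nz n; have n2 := nzS nz n; rewrite qpochSr -exprS.
move: (qpoch_inf _ _) E n1 n2 => G E n1 n2.
transitivity ((1 - 2 * b * mu y + b ^+ 2) * cdual_qHahn n (mu y) al (b * Q) ga Q * G / qpoch Q Q n).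
  by ring.
have -> : (1 - 2 * b * mu y + b ^+ 2) * cdual_qHahn n (mu y) al (b * Q) ga Q =
  (1 - al * b * Q ^+ n) * (1 - b * ga * Q ^+ n) * cdual_qHahn n (mu y) al b ga Q
  - b * cdual_qHahn n.+1 (mu y) al b ga Q by rewrite E; ring.
by field; rewrite n1 n2.
Qed.

(** Write s_(n+m) with parameters (A Q^(-p), b sg Q^p) and with
    (A Q^(-p-1), b sg Q^(p+1)) by means of e = s with (A Q^(-p), b sg Q^(p+1)), which
    is the family that occurs at b Q.  The terms in e (n + m) match by
    [dual_poly_raise] and [cdq_weighted_rec], those in e (n + m - 1) by
    [dual_poly_lower]; what remains is the difference of consecutive values of W. *)
Lemma tri_step p b l l' : b != 0 -> sums (fun n => tri_term p n b) l ->
  sums (fun n => tri_term p n (b * Q)) l' ->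
  sums (fun n => tri_term p.+1 n b)
   (((1 - b * ga * Q ^+ p) * l - (1 - b * ga * sg ^+ 2 * Q ^+ (2 * p))
      * (1 - 2%:R * b * mu y + b ^+ 2) * l') / (b * ga * sg ^+ 2 * Q ^+ (2 * p))).
Proof.
move=> b0 hl hl'; set eps := b * ga * sg ^+ 2 * Q ^+ (2 * p).
have eps0 : eps != 0 by rewrite !mulf_neq0 ?expf_neq0.
have Qp := expf_neq0 p Qn0.
have Ap0 : A / Q ^+ p != 0 by rewrite mulf_neq0 ?invr_eq0.
have bs0 : b * sg * Q ^+ p.+1 != 0 by rewrite !mulf_neq0 ?expf_neq0.
pose e (h : int) := asc_normed Q h (mu x) (A / Q ^+ p) (b * sg * Q ^+ p.+1).
pose w n := dual_poly Q (sg ^+ 2) p n (b * ga).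
pose w' n := dual_poly Q (sg ^+ 2) p n (b * Q * ga).
pose W n := if n is k.+1 then (1 - eps) * b * sg ^+ k * e (k%:Z + m) * w' k * (1 - Q ^+ k.+1) * cdw k.+1 b
  else 0.
have W0 : tends W 0.
  apply/(tends_shift 1).
  have [M1 M10 h1] := asc_int_bound qr0 qr1 x1 sg1 m Ap0 (cabs_ge0 (b * sg * Q ^+ p.+1)).
  have [M2 M20 h2] := cdq_weighted_bound qr0 qr1 y1 sg0 sg1 A0 alE gaE (cabs_ge0 b).
  have [M3 M30 h3] := dual_poly_bound p (b * Q * ga).
  have rho0 : 0 <= rho by rewrite ltW // (lt_trans ltr01) // growth_gt1.
  apply: (@tends0_geometric R C (cabs ((1 - eps) * b) * M1 * M3 * 2 * (M2 * rho)) ratio).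
  - exact: growth_ratio_ge0.
  - exact: growth_ratio_lt1.
  move=> k; rewrite addn1 /W.
  have B1 := h1 _ k bs0 (lexx _); rewrite -/(e _) in B1.
  have B2 := h2 b k.+1 (lexx _).
  have B3 := h3 k; rewrite -/(w' _) in B3.
  have B4 : cabs (1 - Q ^+ k.+1) <= 2.
    rewrite (le_trans (cabsB _ _)) // cabs1 cabsX (cabsQ C qr0) -[X in _ <= X]/(1 + 1) lerD2l.
    exact: (qrn_le1 qr0 qr1).
  rewrite (_ : _ * ratio ^+ k = cabs ((1 - eps) * b) * cabs sg ^+ k * (M1 * rho ^+ k) * M3 * 2 * (M2 * rho ^+ k.+1)); last first.
    by rewrite exprS !exprMn; ring.
  rewrite cabsM; apply: ler_pM; rewrite ?cabs_ge0 //.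
  rewrite cabsM; apply: ler_pM; rewrite ?cabs_ge0 //.
  rewrite cabsM; apply: ler_pM; rewrite ?cabs_ge0 //.
  rewrite cabsM; apply: ler_pM; rewrite ?cabs_ge0 //.
  by rewrite cabsM cabsX.
have key n : tri_term p.+1 n b = ((1 - b * ga * Q ^+ p) * tri_term p n b
   + - ((1 - eps) * (1 - 2%:R * b * mu y + b ^+ 2)) * tri_term p n (b * Q)) / eps
   + - eps^-1 * (W n.+1 - W n).
  have E1 : asc_normed Q (n%:Z + m) (mu x) (A / Q ^+ p) (b * sg * Q ^+ p) =
     e (n%:Z + m) - b * sg * Q ^+ p * e (n%:Z + m - 1).
    rewrite (asc_normed_shift Qn0 nz) //.
    by rewrite (_ : b * sg * Q ^+ p * Q = b * sg * Q ^+ p.+1) // exprSr !mulrA.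
  have E2 : asc_normed Q (n%:Z + m) (mu x) (A / Q ^+ p.+1) (b * sg * Q ^+ p.+1) =
     e (n%:Z + m) - A / Q ^+ p.+1 * e (n%:Z + m - 1).
    rewrite (asc_normed_shiftl Qn0 nz) ?mulf_neq0 ?invr_eq0 ?expf_neq0 //.
    rewrite (_ : A / Q ^+ p.+1 * Q = A / Q ^+ p) // exprS.
    by field; rewrite Qp Qn0.
  have E3 : b * Q * sg * Q ^+ p = b * sg * Q ^+ p.+1 by rewrite exprS; ring.
  have E4 := cdq_weighted_rec n b.
  have kq : b * Q * ga = b * ga * Q by ring.
  have E5 := dual_poly_raise Qn0 (expf_neq0 2 sg0) nz p n (b * ga).
  rewrite /tri_term E1 E2 E3 -/(e _).
  rewrite -/eps -kq -/(w n) -/(w' n) in E5.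
  rewrite -/(w n) -/(w' n).
  have EW : W n.+1 = (1 - eps) * sg ^+ n * e (n%:Z + m) * w' n * (b * (1 - Q ^+ n.+1) * cdw n.+1 b).
    by rewrite /W; ring.
  have {}E4 : b * (1 - Q ^+ n.+1) * cdw n.+1 b = (1 - b * ga * Q ^+ n) * cdw n b
     - (1 - 2%:R * b * mu y + b ^+ 2) * cdw n (b * Q) by rewrite E4; ring.
  rewrite {}EW {}E4.
  have Ew1 : dual_poly Q (sg ^+ 2) p.+1 n (b * ga) = ((1 - b * ga * Q ^+ p) * w n
     - (1 - eps) * ((1 - b * ga * Q ^+ n) * w' n)) / eps.
    by rewrite -E5 [RHS]mulrC (mulKf eps0).
  set e1 := e (n%:Z + m - 1); set w1 := dual_poly _ _ p.+1 n _ in E5 Ew1 *.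
  (* the terms in e (n + m - 1) of the two sides differ by W n / eps, the term at
     n - 1 and k Q that [dual_poly_lower] produces *)
  have E6 : sg ^+ n * (A / Q ^+ p.+1 * e1) * cdw n b * w1 =
     ((1 - b * ga * Q ^+ p) * (sg ^+ n * (b * sg * Q ^+ p * e1) * cdw n b * w n) - W n) / eps.
    apply: (mulfI eps0); rewrite [RHS]mulrC (divfK eps0).
    transitivity (sg ^+ n * (A / Q ^+ p.+1 * e1) * cdw n b * (eps * w1)); first by ring.
    rewrite /W /e1 /w1; case: (n) => [|j].
      rewrite dual_poly_lower0 -/eps subr0 -/(w 0%N).
      rewrite /eps; move: (cdw _ _) (w _) (e _) => G1 G2 G3.
      rewrite gaE exprS [(2 * p)%N]mulnC (exprM Q p); move: (Q ^+ p) Qp => V V0.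
      by field; rewrite A0 sg0 V0 Qn0.
    have -> : j.+1%:Z + m - 1 = j%:Z + m by clear; lia.
    rewrite (dual_poly_lower Qn0 (expf_neq0 2 sg0) nz) -/eps -kq -/(w' j) -/(w j.+1).
    move: (cdw _ _) (w _) (w' _) (e _) (1 - Q ^+ j.+1) => G1 G2 G3 G4 G5.
    rewrite /eps gaE (exprS sg) (exprS Q p) [(2 * p)%N]mulnC (exprM Q p).
    move: (Q ^+ p) Qp => V V0; field.
    by rewrite A0 sg0 V0 Qn0.
  transitivity (sg ^+ n * e (n%:Z + m) * cdw n b * w1 - sg ^+ n * (A / Q ^+ p.+1 * e1) * cdw n b * w1).
    by ring.
  rewrite E6 Ew1 {E6}; move: (W n) (w n) (w' n) (cdw n b) (cdw n (b * Q)) (e _) e1 => G1 G2 G3 G4 G5 G6 G7.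
  by field.
have h1 := sumsD (sumsZ (1 - b * ga * Q ^+ p) hl) (sumsZ (- ((1 - eps) * (1 - 2%:R * b * mu y + b ^+ 2))) hl').
have := sumsD (sumsZ eps^-1 h1) (sumsZ (- eps^-1) (sums_telescope W0)).
rewrite oppr0 mulr0 addr0.
rewrite (_ : eps^-1 * _ = ((1 - b * ga * Q ^+ p) * l - (1 - eps) * (1 - 2%:R * b * mu y + b ^+ 2) * l') / eps).
  by move=> h; apply: (eq_sums h) => n; rewrite key [eps^-1 * _]mulrC.
by ring.
Qed.

Definition tri_const p : C := (sg ^+ 2 * ga) ^- p * Q ^- (p * p.-1).

(** Induction on p for all b at once, since [tri_step] uses the value at b Q;
    [bil_value] starts it. *)
Theorem tri_value : exists2 S, sums (phi_term qr x y sg A m) S &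
  forall p b, b != 0 -> sums (fun n => tri_term p n b)
    (tri_const p * (qpoch_inf (b * sg * Q ^+ p * x) Q * qpoch_inf (b * sg * Q ^+ p / x) Q)
      * askey_wilson p (mu y) (sg * x) (sg / x) ga b Q * (bil_const qr x y sg A m al g * S)).
Proof.
have [S hS hb] := bil_value qr0 qr1 x1 y1 sg0 sg1 A0 alE gaE g2; exists S => //.
move: hb; move: (bil_const _ _ _ _ _ _ _ _ * S) => Phi hb.
elim=> [|p IH] b b0.
  rewrite /tri_const !expr0 invr1 !mulr1 !mul1r aw0 mulr1; apply: (eq_sums (hb b b0)) => n.
  by rewrite /tri_term dual_poly0 !expr0 divr1 !mulr1.
have bQ0 : b * Q != 0 by rewrite mulf_neq0.
have := tri_step b0 (IH b b0) (IH _ bQ0).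
have sx0 : sg * x != 0 by rewrite mulf_neq0.
have E := aw_rec p (mu y) (sg / x) ga b sx0 Qn0 nz.
rewrite [X in sums _ X -> _](_ : _ = tri_const p.+1 *
   (qpoch_inf (b * sg * Q ^+ p.+1 * x) Q * qpoch_inf (b * sg * Q ^+ p.+1 / x) Q) *
   askey_wilson p.+1 (mu y) (sg * x) (sg / x) ga b Q * Phi) //.
have -> : b * Q * sg * Q ^+ p = b * sg * Q ^+ p.+1 by rewrite exprS; ring.
rewrite (qpoch_infS qr0 qr1 (b * sg * Q ^+ p * x)) (qpoch_infS qr0 qr1 (b * sg * Q ^+ p / x)).
have -> : b * sg * Q ^+ p * x * Q = b * sg * Q ^+ p.+1 * x by rewrite exprS; ring.
have -> : b * sg * Q ^+ p / x * Q = b * sg * Q ^+ p.+1 / x by rewrite exprS; ring.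
move: (qpoch_inf (b * sg * Q ^+ p.+1 * x) Q) (qpoch_inf (b * sg * Q ^+ p.+1 / x) Q) => G1 G2.
have EC : tri_const p = tri_const p.+1 * (sg ^+ 2 * ga * Q ^+ (2 * p)).
  rewrite /tri_const (exprS (sg ^+ 2 * ga)).
  have -> : (p.+1 * p.+1.-1 = p * p.-1 + 2 * p)%N by case: (p) => // j; rewrite /=; clear; lia.
  rewrite exprD; have h1 : sg ^+ 2 * ga != 0 by rewrite mulf_neq0 ?expf_neq0.
  have h2 := expf_neq0 (2 * p) Qn0; have h3 := expf_neq0 p h1; have h4 := expf_neq0 (p * p.-1) Qn0.
  move: (sg ^+ 2 * ga) ((_ * ga) ^+ p) (Q ^+ (2 * p)) (Q ^+ (p * p.-1)) h1 h2 h3 h4 => V1 V2 V3 V4 *.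
  by field; apply/and4P.
rewrite EC; have h1 : sg ^+ 2 * ga != 0 by rewrite mulf_neq0 ?expf_neq0.
have h2 := expf_neq0 (2 * p) Qn0.
move: (tri_const p.+1) => G3.
transitivity (G3 * (G1 * G2) * (b * askey_wilson p.+1 (mu y) (sg * x) (sg / x) ga b Q) * Phi / b); last first.
  by field.
rewrite E.
have -> : sg * x * (sg / x) * ga * b = sg ^+ 2 * ga * b by field.
have -> : b * ga * sg ^+ 2 = sg ^+ 2 * ga * b by ring.
move: (askey_wilson _ _ _ _ _ _ _) (askey_wilson _ _ _ _ _ _ _) => P1 P2.
move: h1 h2; move: (sg ^+ 2 * ga) (Q ^+ (2 * p)) (1 - 2 * b * mu y + b ^+ 2) (Q ^+ p) => V1 V2 V3 V4 h1 h2.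
by field; rewrite b0 h1 h2 x0.
Qed.

End PStep.

(** * The identity in the original normalisation *)

Section Translation.
Variables (R : realType) (C : completeField R) (q : R).
Hypotheses (q0 : 0 < q) (q1 : q < 1).
Local Notation g := (cfR C q).
Local Notation Q := (cfR C (q ^+ 2)).
Variables (x y S h1 h2 : C) (m : int) (p : nat).
Hypotheses (x1 : cabs x = 1) (y1 : cabs y = 1) (S0 : S != 0) (sg1 : cabs (g / S) < 1).
Hypotheses (h10 : h1 != 0) (h20 : h2 != 0) (h2n : forall k, qpoch (h2 ^+ 2) Q k != 0).

Let qr0 : 0 < q ^+ 2. Proof. exact: exprn_gt0. Qed.
Let qr1 : q ^+ 2 < 1. Proof. by rewrite expr_lt1 // ltW. Qed.
Let Qn0 := Qneq0 C qr0.
Let nz := nzQ C qr0 qr1.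
Let g0 : g != 0. Proof. by rewrite ofR_eq0 gt_eqF. Qed.
Let g2 : g ^+ 2 = Q. Proof. by rewrite rmorphXn. Qed.
Let x0 : x != 0. Proof. by rewrite -cabs_eq0 x1 oner_neq0. Qed.

Local Notation al := (h1 / h2 * Q ^ m * g).
Local Notation be := (h1 * h2 / g).
Local Notation ga := (h2 / h1 * g).
Local Notation A := (S * (h1 / h2)).
Local Notation sg := (g / S).
Local Notation Y := (h2 / h1 * Q ^ (1 - m) * x / S).

Let sg0 : sg != 0. Proof. by rewrite mulf_neq0 ?invr_eq0. Qed.
Let A0 : A != 0. Proof. by rewrite !mulf_neq0 ?invr_eq0. Qed.
Let be0 : be != 0. Proof. by rewrite !mulf_neq0 ?invr_eq0. Qed.
Let alE : al = A * Q ^ m * sg. Proof. by field; rewrite h20 S0. Qed.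
Let gaE : ga = Q / (A * sg). Proof. by rewrite -g2; field; rewrite h10 h20 S0 g0. Qed.
Let Qz (h : int) : Q ^ h != 0. Proof. by rewrite expfz_neq0. Qed.

Lemma phi22_value V : qpoch_inf (Q / S ^+ 2) Q != 0 -> qpoch_inf Y Q != 0 ->
  sums (phi_term (q ^+ 2) x y sg A m) V ->
  phi22 (g * (x / y) / S) (g * (x * y) / S) (Q / S ^+ 2) Y Q (h2 / h1 * Q ^ (1 - m) / x / S)
  = V / (qpoch_inf (Q / S ^+ 2) Q * qpoch_inf Y Q).
Proof.
move=> d1 d2 hV; rewrite [RHS]mulrC; apply: tends_lim; rewrite -[tends _ _]/(sums _ _).
apply: (eq_sums (sumsZ (qpoch_inf (Q / S ^+ 2) Q * qpoch_inf Y Q)^-1 hV)) => k.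
rewrite /phi_term /qpochs !big_cons !big_nil !mulr1 /qbin.
have -> : Q ^ (1 - m) * x / A = Y by field; rewrite h10 h20 S0.
have -> : sg ^+ 2 = Q / S ^+ 2 by rewrite -g2 expr_div_n.
have -> : sg * x * y = g * (x * y) / S by ring.
have -> : sg * x / y = g * (x / y) / S by ring.
have -> : - (Q ^ (1 - m) / (A * x)) = - 1 * (h2 / h1 * Q ^ (1 - m) / x / S).
  by field; rewrite h10 h20 S0 x0.
rewrite exprMn.
have n1 := nz k; have n2 := qpoch_neq0_inf qr0 qr1 k d1; have n3 := qpoch_neq0_inf qr0 qr1 k d2.
move: d1 d2 n2 n3; rewrite (qpoch_inf_split qr0 qr1 k (Q / S ^+ 2)) (qpoch_inf_split qr0 qr1 k Y).
rewrite !mulf_eq0 !negb_or => /andP[_ d1] /andP[_ d2].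
move: (qpoch_inf _ _) (qpoch_inf _ _) d1 d2 => G1 G2 d1 d2.
move: (qpoch (Q / _) _ _) (qpoch Y _ _) => G3 G4 n2 n3.
by field; rewrite n1 d1 d2 n2 n3.
Qed.

Lemma asc_normed_unfold (h : int) a b z : al_salam_chihara h z a b Q * qpoch_inf (Q ^ (1 + h)) Q
  = qpoch_inf Q Q * asc_normed Q h z a b.
Proof.
rewrite /asc_normed; case: h => n; last by rewrite /= !mul0r mulr0.
rewrite absz_nat (qpoch_inf_split qr0 qr1 n Q).
have -> : Q ^ (1 + n%:Z) = Q * Q ^+ n by rewrite expfzDr // expr1z.
have n1 := nz n; move: (qpoch_inf _ _) (al_salam_chihara _ _ _ _ _) => G1 G2.
by field.
Qed.

(** [tri_value] in the normalisation of the theorem, for parameters h1 and h2 in place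
    of q^(2 k_1) and q^(2 k_2) and with the squared modulus in c_n written as the
    product [normsq]. *)
Lemma trilinear_sum (normsq : C) :
  let B := h1 * h2 * Q ^+ p / S in
  qpoch_inf (Q / S ^+ 2) Q != 0 -> qpoch_inf Y Q != 0 ->
  qpoch_inf (B * x) Q != 0 -> qpoch_inf (B / x) Q != 0 ->
  qpoch_inf (al * y) Q != 0 -> qpoch_inf (al / y) Q != 0 ->
  normsq = qpoch_inf (sg * x * y) Q * qpoch_inf (sg / x * y) Q
        * qpoch_inf (sg * x / y) Q * qpoch_inf (sg / x / y) Q /
      (qpoch_inf (B * x) Q * qpoch_inf (B / x) Q
        * qpoch_inf (al * y) Q * qpoch_inf (al / y) Q) ->
  sums (fun n : nat =>
    (-1) ^ (n%:Z + m) * (h2 * g) ^+ n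
    * g ^ (n%:Z * (n%:Z - 1) - m * (m - 1) + 2 * (p%:Z * (p%:Z - 1)))
    / qpochs [:: Q; h2 ^+ 2] Q n * A ^ (- m) * (S ^+ 2 * (h1 / h2 / g ^+ 3)) ^- p
    * (qpochs_inf [:: Q ^ (1 + (n%:Z + m)); h1 ^+ 2 * Q ^ (n%:Z + m)] Q * qpochs [:: h2 ^+ 2] Q p
       / qpochs_inf [:: Q / S ^+ 2; Y] Q) * normsq
    * al_salam_chihara (n%:Z + m) (mu x) (S * (h1 / h2 / Q ^+ p)) (h1 * h2 * Q ^+ p / S) Q
    * al_salam_chihara n%:Z (mu (h2 * Q ^+ p / S)) (S / h2) (h2^-1 / S) Q^-1
    * cdual_qHahn n (mu y) al be ga Q)
   (askey_wilson p (mu y) (g * x / S) (g / x / S) ga be Q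
    * phi22 (g * (x / y) / S) (g * (x * y) / S) (Q / S ^+ 2) Y Q (h2 / h1 * Q ^ (1 - m) / x / S)).
Proof.
move=> B d1 d2 d3 d4 d5 d6 NE.
have [V hV hT] := tri_value qr0 qr1 x1 y1 sg0 sg1 A0 alE gaE g2.
rewrite (phi22_value d1 d2 hV).
pose K := (-1) ^ m * g ^ (- (m * (m - 1)) + 2 * (p%:Z * (p%:Z - 1))) * A ^ (- m)
  * (S ^+ 2 * (h1 / h2 / g ^+ 3)) ^- p * qpoch_inf Q Q
  / (qpoch_inf (Q / S ^+ 2) Q * qpoch_inf Y Q) * normsq.
have := sumsZ K (hT p be be0).
have EB : be * sg * Q ^+ p = B by rewrite /B; field; rewrite g0 S0.
have n0 : qpoch_inf Q Q != 0 by apply: qpoch_inf_neq0_small; rewrite ?(cabsQ C qr0).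
have e1 : (-1 : C) != 0 by rewrite oppr_eq0 oner_neq0.
rewrite [X in sums _ X -> _](_ : _ = askey_wilson p (mu y) (g * x / S) (g / x / S) ga be Q
   * (V / (qpoch_inf (Q / S ^+ 2) Q * qpoch_inf Y Q))).
  move=> h; apply: (eq_sums h) => n; rewrite /tri_term EB /cdq_weighted /qpochs /qpochs_inf.
  rewrite !big_cons !big_nil !mulr1 /K.
  rewrite (asc_base_inv Qn0 nz) //.
  have -> : Q / S ^+ 2 = sg ^+ 2 by rewrite -g2 expr_div_n.
  have -> : be * ga = h2 ^+ 2 by field; rewrite g0 h10.
  have -> : h1 ^+ 2 * Q ^ (n%:Z + m) = al * be * Q ^+ n.
    by rewrite expfzDr // -exprnP; field; rewrite h20 g0.
  have -> : S * (h1 / h2 / Q ^+ p) = A / Q ^+ p by ring.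
  rewrite -/B.
  have := asc_normed_unfold (n%:Z + m) (A / Q ^+ p) B (mu x).
  move: (asc_normed _ _ _ _ _) (al_salam_chihara _ _ _ _ _) => G1 G2.
  move: (qpoch_inf (Q ^ _) Q) (qpoch_inf Q Q) => G3 G4 EG.
  have -> : (-1) ^ (n%:Z + m) = (-1) ^+ n * (-1) ^ m :> C by rewrite expfzDr.
  have -> : g ^ (n%:Z * (n%:Z - 1) - m * (m - 1) + 2 * (p%:Z * (p%:Z - 1))) =
    Q ^+ 'C(n, 2) * g ^ (- (m * (m - 1)) + 2 * (p%:Z * (p%:Z - 1))).
    have -> : Q ^+ 'C(n, 2) = g ^ (n%:Z * (n%:Z - 1)).
      case: (n) => [|k]; first by rewrite bin0n mul0r.
      by rewrite (g_bin qr0 g2) [LHS]exprnP; congr (_ ^ _); clear; lia.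
    by rewrite -expfzDr // addrA.
  have -> : (- (h2 * S)) ^- n = (-1) ^+ n / (h2 ^+ n * S ^+ n).
    by rewrite (exprNn (h2 * S)) invfM invr_sign exprMn.
  have -> : (h2 * g) ^+ n = h2 ^+ n * g ^+ n by rewrite exprMn.
  have -> : sg ^+ n = g ^+ n / S ^+ n by rewrite expr_div_n.
  have sq : (-1) ^+ n * (-1) ^+ n = 1 :> C by rewrite -expr2 sqrr_sign.
  have n1 := nz n; have n2 := h2n n; have n3 := h2n p.
  have n4 := expf_neq0 n h20; have n5 := expf_neq0 n S0; have n6 := expf_neq0 'C(n, 2) Qn0.
  move: sq n4 n5 n6 n1 n2 n3.
  move: ((-1) ^+ n) (h2 ^+ n) (S ^+ n) (Q ^+ 'C(n, 2)) (qpoch Q Q n) (qpoch (h2 ^+ 2) Q n) (qpoch (h2 ^+ 2) Q p).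
  move: (g ^ _) (A ^ _) ((_ * (h1 / h2 / g ^+ 3)) ^- p) ((-1) ^ m).
  move: (dual_poly _ _ _ _ _) (cdual_qHahn _ _ _ _ _ _) (qpoch_inf _ _) (g ^+ n) ((_ * qpoch_inf _ _)^-1).
  move=> F1 F2 F3 F4 F5 F6 F7 F8 F9 u1 u2 u3 u4 u5 u6 u7 sq n4 n5 n6 n1 n2 n3.
  transitivity (F9 * F6 * F7 * F8 * F5 * normsq * F4 / u3 * (G4 * G1) * F2 * F3 / u5 * F1); first by ring.
  rewrite -EG; transitivity ((u1 * u1) * F9 * F6 * F7 * F8 * F5 * normsq * F4 / u3 * (G2 * G3) * F2 * F3 / u5 * F1).
    by rewrite sq mul1r.
  by field; rewrite n1 n2 n3 n4 n5 n6.
rewrite EB /bil_const.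
have -> : g * x / S = sg * x by ring.
have -> : g / x / S = sg / x by ring.
have sx a b : cabs a = 1 -> cabs b = 1 -> qpoch_inf (sg * a * b) Q != 0.
  move=> ha hb; apply: qpoch_inf_neq0_small => //.
  by rewrite cabsM hb mulr1 cabsM ha mulr1.
have xV1 : cabs x^-1 = 1 by rewrite cabsV x1 invr1.
have yV1 : cabs y^-1 = 1 by rewrite cabsV y1 invr1.
have s1 := sx _ _ x1 y1; have s2 := sx _ _ xV1 y1; have s3 := sx _ _ x1 yV1; have s4 := sx _ _ xV1 yV1.
(* all constants that are not infinite products cancel *)
pose W := (-1) ^ m * g ^ (- (m * (m - 1)) + 2 * (p%:Z * (p%:Z - 1))) * A ^ (- m)
  * (S ^+ 2 * (h1 / h2 / g ^+ 3)) ^- p * (tri_const (q ^+ 2) sg ga p * ((- (Q / A)) ^ (- m) * g ^ (m * (m + 1)))).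
have W1 : W = 1.
  rewrite /W /tri_const.
  have -> : g ^ (- (m * (m - 1)) + 2 * (p%:Z * (p%:Z - 1))) = Q ^+ (p * p.-1) * Q ^ m / g ^ (m * (m + 1)).
    have -> : Q ^+ (p * p.-1) = g ^ (2 * (p%:Z * (p%:Z - 1))).
      rewrite -g2 -exprM [LHS]exprnP; congr (_ ^ _).
      by case: (p) => // k; clear; lia.
    have -> : Q ^ m = g ^ (2 * m) by rewrite -g2 (exprnP g) exprz_exp.
    by rewrite -expfzDr // invr_expz -expfzDr //; congr (_ ^ _); ring.
  have -> : (- (Q / A)) ^ (- m) = (-1) ^ (- m) * Q ^ (- m) * A ^ m.
    move: A => a; rewrite -[- (Q / a)]mulN1r !expfzMl exprz_inv opprK mulrA //.
  have -> : (S ^+ 2 * (h1 / h2 / g ^+ 3)) = (sg ^+ 2 * ga)^-1.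
    by field; rewrite h10 h20 g0 S0.
  rewrite exprVn invrK -!invr_expz.
  have m1 : (-1) ^ m != 0 :> C by rewrite expfz_neq0.
  have m2 := Qz m; have m3 : A ^ m != 0 by rewrite expfz_neq0.
  have m4 : g ^ (m * (m + 1)) != 0 by rewrite expfz_neq0.
  have m5 := expf_neq0 (p * p.-1) Qn0.
  have m6 : (sg ^+ 2 * ga) ^+ p != 0 by rewrite expf_neq0 // !mulf_neq0 ?invr_eq0.
  move: m1 m2 m3 m4 m5 m6.
  move: ((-1) ^ m) (Q ^ m) (A ^ m) (g ^ _) (Q ^+ _) (_ ^+ p) => u1 u2 u3 u4 u5 u6 m1 m2 m3 m4 m5 m6.
  by field; rewrite m1 m2 m3 m4 m5 m6.
transitivity (W * (askey_wilson p (mu y) (sg * x) (sg / x) ga be Q *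
    (V / (qpoch_inf (Q / S ^+ 2) Q * qpoch_inf Y Q)))); last by rewrite W1 mul1r.
rewrite /K /W NE; move: d1 d2 d3 d4 d5 d6 n0 s1 s2 s3 s4.
move: (askey_wilson _ _ _ _ _ _ _) (tri_const _ _ _ _) (g ^ _) (A ^ _) ((_ * (h1 / h2 / g ^+ 3)) ^- p) ((-1) ^ m).
move: (_ ^ (- m)) (g ^ _).
move: (qpoch_inf (Q / _) _) (qpoch_inf Y _) (qpoch_inf (B * x) Q) (qpoch_inf (B / x) Q) (qpoch_inf (al * y) Q)
  (qpoch_inf (al / y) Q) (qpoch_inf Q Q) (qpoch_inf (sg * x * y) Q) (qpoch_inf (sg / x * y) Q)
  (qpoch_inf (sg * x / y) Q) (qpoch_inf (sg / x / y) Q).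
move=> G1 G2 G3 G4 G5 G6 G7 G8 G9 G10 G11 F1 F2 F3 F4 F5 F6 F7 F8 d1 d2 d3 d4 d5 d6 n0 s1 s2 s3 s4.
by field; rewrite d1 d2 d3 d4 d5 d6 n0 s1 s2 s3 s4.
Qed.

End Translation.

(** * The complex numbers as a complete field *)

Section ComplexInstance.
Variable R : realType.
Implicit Types (z : R[i]) (u : nat -> R[i]).

Definition modulus z : R := complex.Re `|z|.

Lemma modulusE z : `|z| = (modulus z)%:C%C.
Proof. by rewrite /modulus RRe_real // normr_real. Qed.

Lemma modulus_Re z : `|complex.Re z| <= modulus z.
Proof. by rewrite -lecR -modulusE normc_ge_Re. Qed.

Lemma modulus_Im z : `|complex.Im z| <= modulus z.
Proof.
have -> : modulus z = modulus ('i%C * z).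
  apply: complexI; rewrite -!modulusE normrM.
  by rewrite [X in _ = X * _]normc_def /= expr0n expr1n /= add0r sqrtr1 mul1r.
rewrite (le_trans _ (modulus_Re _)) //; case: z => a b /=.
by rewrite mul0r mul1r sub0r normrN.
Qed.

Lemma modulus_le_ReIm z : modulus z <= `|complex.Re z| + `|complex.Im z|.
Proof.
rewrite -lecR -modulusE rmorphD /=; case: z => a b /=.
have -> : Complex a b = a%:C%C + 'i%C * b%:C%C.
  by apply/eqP; rewrite eq_complex /= !(mul0r, mul1r, subr0, addr0, add0r, mulr0) !eqxx.
rewrite (le_trans (ler_normD _ _)) // normrM [`|'i%C|]normc_def /= expr0n expr1n /= add0r sqrtr1 mul1r.
by rewrite !normc_def /= !expr0n /= !addr0 !sqrtr_sqr.
Qed.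

Lemma Re_series u n : complex.Re (series u n) = series (fun k => complex.Re (u k)) n.
Proof.
elim: n => [|n IH]; first by rewrite /series /= !big_geq.
by rewrite !seriesSr -IH; case: (series u n) => a b; case: (u n).
Qed.

Lemma Im_series u n : complex.Im (series u n) = series (fun k => complex.Im (u k)) n.
Proof.
elim: n => [|n IH]; first by rewrite /series /= !big_geq.
by rewrite !seriesSr -IH; case: (series u n) => a b; case: (u n).
Qed.

Lemma real_dominated (u M : nat -> R) : (forall n, `|u n| <= M n) ->
  cvgn (series M) -> cvgn (series u).
Proof.
move=> uM cM; apply: normed_cvg; apply: (series_le_cvg _ _ _ cM) => n //=.
by rewrite (le_trans (normr_ge0 _) (uM n)).
Qed.

Lemma modulus_complete u (M : nat -> R) : (forall n, modulus (u n) <= M n) ->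
  cvgn (series M) -> exists l : R[i], forall e : R, 0 < e ->
    \forall n \near \oo, modulus (series u n - l) <= e.
Proof.
move=> uM cM.
have /cvg_ex[a ca] : cvgn (series (fun n => complex.Re (u n))).
  by apply: real_dominated cM => n; exact: le_trans (modulus_Re _) _.
have /cvg_ex[b cb] : cvgn (series (fun n => complex.Im (u n))).
  by apply: real_dominated cM => n; exact: le_trans (modulus_Im _) _.
exists (Complex a b) => e e0; have e2 : 0 < e / 2 by rewrite divr_gt0.
move/cvgrPdist_le: ca => /(_ _ e2) ca; move/cvgrPdist_le: cb => /(_ _ e2) cb.
near=> n; rewrite (le_trans (modulus_le_ReIm _)) // (splitr e) lerD //.
  have -> : complex.Re (series u n - Complex a b) = series (fun n => complex.Re (u n)) n - a.
    by rewrite -Re_series; case: (series u n).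
  by rewrite distrC; near: n; exact: ca.
have -> : complex.Im (series u n - Complex a b) = series (fun n => complex.Im (u n)) n - b.
  by rewrite -Im_series; case: (series u n).
by rewrite distrC; near: n; exact: cb.
Unshelve. all: by end_near. Qed.

Definition complex_field : completeField R :=
  @CompleteField R (Cplx R) (real_complex R) modulus (@lecR R) modulusE modulus_complete.

Lemma modulus_expi (t : R) : cabs (expi t : complex_field) = 1.
Proof.
by apply: (@complexI R); rewrite -[LHS]modulusE normc_def /= cos2Dsin2 sqrtr1.
Qed.

End ComplexInstance.

(** * Powers of q and the theorem *)

Section Powers.
Variables (R : realType) (C : completeField R) (q : R).
Hypotheses (q0 : 0 < q).
Local Notation g := (cfR C q).
Local Notation Q := (cfR C (q ^+ 2)).
Variables (k1 k2 : R) (m : int).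
Local Notation M := (m%:~R : R).
Local Notation r t := (cfR C (q `^ t)).
Local Notation h1 := (cfR C (q `^ (2 * k1))).
Local Notation h2 := (cfR C (q `^ (2 * k2))).

Lemma cfR_powR_neq0 t : r t != 0.
Proof. by rewrite ofR_eq0 gt_eqF // powR_gt0. Qed.

(** All exponents in the theorem are integral combinations of 2 k_1, 2 k_2 and 1, so
    that k_1 and k_2 enter only through two nonzero numbers h1 and h2. *)
Lemma cfR_powR (a b c : int) t : t = a%:~R * (2 * k1) + b%:~R * (2 * k2) + c%:~R ->
  cfR C (q `^ t) = h1 ^ a * h2 ^ b * g ^ c.
Proof.
move=> ->; have qn : q != 0 by rewrite gt_eqF.
rewrite !powRD ?qn ?implybT // !rmorphM; congr (_ * _ * _).
- by rewrite (mulrC a%:~R) (powRrM q (2 * k1)) powR_intmul ?powR_ge0 // fmorphXz.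
- by rewrite (mulrC b%:~R) (powRrM q (2 * k2)) powR_intmul ?powR_ge0 // fmorphXz.
- by rewrite powR_intmul ?ltW // fmorphXz.
Qed.

Let g0 : g != 0. Proof. by rewrite ofR_eq0 gt_eqF. Qed.
Let QE : Q = g ^ 2. Proof. by rewrite rmorphXn. Qed.

Variables (n p : nat).
Lemma powR_al : r (2 * k1 - 2 * k2 + 2 * M + 1) = h1 / h2 * Q ^ m * g.
Proof.
rewrite (@cfR_powR 1 (-1) (2 * m + 1)); last by ring.
by rewrite expr1z -[h2 ^ -1]invr_expz expfzDr // !expr1z QE exprz_exp; ring.
Qed.
Lemma powR_be : r (2 * k1 + 2 * k2 - 1) = h1 * h2 / g.
Proof. by rewrite (@cfR_powR 1 1 (-1)); last by ring. Qed.
Lemma powR_ga : r (2 * k2 - 2 * k1 + 1) = h2 / h1 * g.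
Proof.
rewrite (@cfR_powR (-1) 1 1); last by ring.
by rewrite !expr1z -[h1 ^ -1]invr_expz; ring.
Qed.
Lemma powR_A : r (2 * k1 - 2 * k2) = h1 / h2.
Proof.
rewrite (@cfR_powR 1 (-1) 0); last by ring.
by rewrite expr0z mulr1.
Qed.
Lemma powR_Ap : r (2 * k1 - 2 * k2 - 2 * p%:R) = h1 / h2 / Q ^+ p.
Proof.
rewrite (@cfR_powR 1 (-1) (- (2 * p%:Z))); last by ring.
by rewrite expr1z -[h2 ^ -1]invr_expz expr1z -invr_expz QE -!exprnP -exprM.
Qed.
Lemma powR_Bp : r (2 * k1 + 2 * k2 + 2 * p%:R) = h1 * h2 * Q ^+ p.
Proof.
rewrite (@cfR_powR 1 1 (2 * p%:Z)); last by ring.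
by rewrite !expr1z QE -!exprnP -exprM.
Qed.
Lemma powR_h2V : r (- (2 * k2)) = h2^-1.
Proof.
rewrite (@cfR_powR 0 (-1) 0); last by ring.
by rewrite !expr0z mul1r mulr1.
Qed.
Lemma powR_h2p : r (2 * k2 + 2 * p%:R) = h2 * Q ^+ p.
Proof.
rewrite (@cfR_powR 0 1 (2 * p%:Z)); last by ring.
by rewrite !expr1z expr0z mul1r QE -!exprnP -exprM.
Qed.
Lemma powR_Y : r (2 * k2 - 2 * k1 - 2 * M + 2) = h2 / h1 * Q ^ (1 - m).
Proof.
rewrite (@cfR_powR (-1) 1 (2 * (1 - m))); last by ring.
by rewrite expr1z -[h1 ^ -1]invr_expz expr1z QE exprz_exp (mulrC h2).
Qed.
Lemma powR_n : r (n%:R * (2 * k2 + 1)) = (h2 * g) ^+ n.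
Proof.
rewrite (@cfR_powR 0 n%:Z n%:Z); last by ring.
by rewrite expr0z mul1r -!exprnP exprMn.
Qed.
Lemma powR_4k2 : r (4 * k2) = h2 ^+ 2.
Proof.
rewrite (@cfR_powR 0 2 0); last by ring.
by rewrite !expr0z mul1r mulr1.
Qed.
Lemma powR_p : r (2 * k1 - 2 * k2 - 3) = h1 / h2 / g ^+ 3.
Proof. by rewrite (@cfR_powR 1 (-1) (-3)); last by ring. Qed.
Lemma powR_inf1 : r (2 + 2 * M + 2 * n%:R) = Q ^ (1 + (n%:Z + m)).
Proof.
rewrite (@cfR_powR 0 0 (2 * (1 + (n%:Z + m)))); last by ring.
by rewrite !expr0z !mul1r QE exprz_exp.
Qed.
Lemma powR_inf2 : r (4 * k1 + 2 * M + 2 * n%:R) = h1 ^+ 2 * Q ^ (n%:Z + m).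
Proof.
rewrite (@cfR_powR 2 0 (2 * (n%:Z + m))); last by ring.
by rewrite expr0z mulr1 QE exprz_exp.
Qed.

End Powers.

(* Syntactic occurrences only, so that powers of q with different exponents are
   never compared up to conversion. *)
Ltac subst_eq e :=
  match type of e with ?t = _ => pattern t; refine (eq_ind_r _ _ e); cbv beta end.

Section RealParameters.
Variables (R : realType) (C : completeField R) (ex : R -> C) (cj : {rmorphism C -> C}).
Hypotheses (exD : forall a b, ex (a + b) = ex a * ex b)
  (ex1 : forall a, cabs (ex a) = 1)
  (exC : forall t, cfR C (cos t) *+ 2 = ex t + cj (ex t))
  (cjR : forall a, cj (cfR C a) = cfR C a)
  (cj_abs : forall z, cabs (cj z) = cabs z)
  (cj_norm : forall z, `|z| ^+ 2 = z * cj z).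
Variables (q k1 k2 s theta psi : R) (m : int) (p : nat).
Local Notation Q := (cfR C (q ^+ 2)).
Local Notation M := (m%:~R : R).
Local Notation S := (cfR C s).
Local Notation r t := (cfR C (q `^ t)).
Hypotheses (hq0 : 0 < q) (hq1 : q < 1) (hk1 : 0 < k1) (hk12 : k1 <= k2)
  (hs : q^-1 <= `|s|).
Let coefC n : C :=
  (-1) ^ (n%:Z + m) * r (n%:R * (2 * k2 + 1))
  * cfR C (q ^ (n%:Z * (n%:Z - 1) - m * (m - 1) + 2 * (p%:Z * (p%:Z - 1))))
  / qpochs [:: Q; r (4 * k2)] Q n
  * (S * r (2 * k1 - 2 * k2)) ^ (- m)
  * (S ^+ 2 * r (2 * k1 - 2 * k2 - 3)) ^- p
  * (qpochs_inf [:: r (2 + 2 * M + 2 * n%:R);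
                    r (4 * k1 + 2 * M + 2 * n%:R)] Q
     * qpochs [:: r (4 * k2)] Q p
     / qpochs_inf [:: Q / S ^+ 2;
                      r (2 * k2 - 2 * k1 - 2 * M + 2) * ex theta / S] Q)
  * `| qpochs_inf [:: cfR C q * ex (psi + theta) / S;
                      cfR C q * ex (psi - theta) / S] Q
       / qpochs_inf [:: r (2 * k1 + 2 * k2 + 2 * p%:R) * ex theta / S;
                        r (2 * k1 - 2 * k2 + 2 * M + 1) * ex psi] Q | ^+ 2.

Lemma ex_neq0 t : ex t != 0.
Proof. by rewrite -cabs_eq0 ex1 oner_neq0. Qed.

Lemma ex0 : ex 0 = 1.
Proof. by apply: (mulfI (ex_neq0 0)); rewrite -exD addr0 mulr1. Qed.

Lemma exN t : ex (- t) = (ex t)^-1.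
Proof. by apply: (mulfI (ex_neq0 t)); rewrite -exD subrr ex0 divff // ex_neq0. Qed.

Lemma cj_ex t : cj (ex t) = (ex t)^-1.
Proof.
apply: (mulfI (ex_neq0 t)); rewrite -cj_norm cabs_normE ex1 rmorph1 expr1n.
by rewrite divff // ex_neq0.
Qed.

Lemma exE t : cfR C (cos t) = mu (ex t).
Proof. by rewrite /mu -cj_ex -exC -mulr_natr mulfK // pnatr_eq0. Qed.

Lemma cj_qpoch_inf z : cj (qpoch_inf z Q) = qpoch_inf (cj z) Q.
Proof.
have qr0 : 0 < q ^+ 2 by rewrite exprn_gt0.
have qr1 : q ^+ 2 < 1 by rewrite exprn_ilt1 // ltW.
apply: (tends_unique _ (tends_qpoch qr0 qr1 (cj z))).
have /tends_cabsP h := tends_qpoch qr0 qr1 z.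
apply/tends_cabsP => e e0; apply: filterS (h e e0) => n.
have -> : qpoch (cj z) Q n = cj (qpoch z Q n).
  rewrite rmorph_prod; apply: eq_bigr => j _.
  by rewrite rmorphB rmorph1 (rmorphM cj) (rmorphXn cj) /= cjR.
by rewrite -rmorphB cj_abs.
Qed.

(** Conjugation commutes with (.; Q)_oo as Q is real, and maps e^(it) to its
    inverse. *)
Lemma norm_qpoch_infE a t : `|qpoch_inf (cfR C a * ex t) Q| ^+ 2 =
  qpoch_inf (cfR C a * ex t) Q * qpoch_inf (cfR C a / ex t) Q.
Proof. by rewrite cj_norm cj_qpoch_inf (rmorphM cj) /= cjR cj_ex. Qed.

(** The theorem over a complete field with a conjugation cj and a character ex of
    modulus 1. *)
Lemma trilinear_sum_powers :
  qpochs_inf [:: Q / S ^+ 2; r (2 * k2 - 2 * k1 - 2 * M + 2) * ex theta / S] Q != 0 ->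
  qpochs_inf [:: r (2 * k1 + 2 * k2 + 2 * p%:R) * ex theta / S;
                 r (2 * k1 - 2 * k2 + 2 * M + 1) * ex psi] Q != 0 ->
  sums (fun n : nat => coefC n
    * al_salam_chihara (n%:Z + m) (cfR C (cos theta))
        (S * r (2 * k1 - 2 * k2 - 2 * p%:R))
        (r (2 * k1 + 2 * k2 + 2 * p%:R) / S) Q
    * al_salam_chihara n%:Z (mu (r (2 * k2 + 2 * p%:R) / S))
        (S * r (- (2 * k2))) (r (- (2 * k2)) / S) Q^-1
    * cdual_qHahn n (cfR C (cos psi))
        (r (2 * k1 - 2 * k2 + 2 * M + 1)) (r (2 * k1 + 2 * k2 - 1))
        (r (2 * k2 - 2 * k1 + 1)) Q)
  (askey_wilson p (cfR C (cos psi))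
        (cfR C q * ex theta / S) (cfR C q * ex (- theta) / S)
        (r (2 * k2 - 2 * k1 + 1)) (r (2 * k1 + 2 * k2 - 1)) Q
      * phi22 (cfR C q * ex (theta - psi) / S)
          (cfR C q * ex (theta + psi) / S)
          (Q / S ^+ 2) (r (2 * k2 - 2 * k1 - 2 * M + 2) * ex theta / S)
          Q (r (2 * k2 - 2 * k1 - 2 * M + 2) * ex (- theta) / S)).
Proof.
move=> hd1 hd2.
have s0 : s != 0 by rewrite -normr_eq0 gt_eqF // (lt_le_trans _ hs) // invr_gt0.
have S0 : S != 0 by rewrite ofR_eq0.
have sg1 : cabs (cfR C q / S) < 1.
  rewrite -fmorphV -rmorphM cabs_ofR normrM normfV (gtr0_norm hq0).
  rewrite ltr_pdivrMr ?normr_gt0 // mul1r (lt_le_trans hq1) // (le_trans _ hs) //.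
  by rewrite invf_ge1 // ltW.
have hh1 := cfR_powR_neq0 C hq0 (2 * k1).
have hh2 := cfR_powR_neq0 C hq0 (2 * k2).
have qr0 : 0 < q ^+ 2 by rewrite exprn_gt0.
have qr1 : q ^+ 2 < 1 by rewrite exprn_ilt1 // ltW.
have h2n k : qpoch (r (2 * k2) ^+ 2) Q k != 0.
  apply: (qpoch_neq0_small qr0 qr1); rewrite cabsX cabs_ofR ger0_norm ?powR_ge0 //.
  rewrite exprn_ilt1 // ?powR_ge0 // /powR gt_eqF // expR_lt1 pmulr_rlt0 ?ln_lt0 ?hq0 //.
  by rewrite mulr_gt0 // (lt_le_trans hk1).
move: hd1 hd2; rewrite /qpochs_inf !big_cons !big_nil !mulr1 => hd1 hd2.
have x1 := ex1 theta; have y1 := ex1 psi.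
have := @trilinear_sum R C q hq0 hq1 (ex theta) (ex psi) S (r (2 * k1)) (r (2 * k2)) m p x1 y1 S0 sg1 hh1 hh2 h2n.
pose normsq := `| qpochs_inf [:: cfR C q * ex (psi + theta) / S;
                      cfR C q * ex (psi - theta) / S] Q
       / qpochs_inf [:: r (2 * k1 + 2 * k2 + 2 * p%:R) * ex theta / S;
                        r (2 * k1 - 2 * k2 + 2 * M + 1) * ex psi] Q | ^+ 2.
move=> /(_ normsq) H.
have EB : r (2 * k1 + 2 * k2 + 2 * p%:R) * ex theta / S =
   cfR C (q `^ (2 * k1 + 2 * k2 + 2 * p%:R) / s) * ex theta.
  by rewrite rmorphM fmorphV mulrAC.
have EB' : r (2 * k1 + 2 * k2 + 2 * p%:R) / S * (ex theta)^-1 =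
   cfR C (q `^ (2 * k1 + 2 * k2 + 2 * p%:R) / s) / ex theta.
  by rewrite rmorphM fmorphV.
have Eq t : cfR C q * ex t / S = cfR C (q / s) * ex t.
  by rewrite rmorphM fmorphV mulrAC.
have norm_neq0 a t : qpoch_inf (cfR C a * ex t) Q != 0 -> qpoch_inf (cfR C a / ex t) Q != 0.
  move=> h; have := norm_qpoch_infE a t; apply: contra_eqN => /eqP->.
  by rewrite mulr0 expf_neq0 // normr_eq0.
have NE : normsq = qpoch_inf (cfR C q / S * ex theta * ex psi) Q
    * qpoch_inf (cfR C q / S / ex theta * ex psi) Q
    * qpoch_inf (cfR C q / S * ex theta / ex psi) Q
    * qpoch_inf (cfR C q / S / ex theta / ex psi) Q /
  (qpoch_inf (r (2 * k1 + 2 * k2 + 2 * p%:R) / S * ex theta) Q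
   * qpoch_inf (r (2 * k1 + 2 * k2 + 2 * p%:R) / S / ex theta) Q
   * qpoch_inf (r (2 * k1 - 2 * k2 + 2 * M + 1) * ex psi) Q
   * qpoch_inf (r (2 * k1 - 2 * k2 + 2 * M + 1) / ex psi) Q).
  rewrite /normsq /qpochs_inf !big_cons !big_nil !mulr1 normf_div !normrM expr_div_n !exprMn.
  rewrite !Eq EB EB' !norm_qpoch_infE.
  have Es t : cfR C q / S * t = cfR C (q / s) * t by rewrite rmorphM fmorphV.
  have -> : r (2 * k1 + 2 * k2 + 2 * p%:R) / S * ex theta =
     cfR C (q `^ (2 * k1 + 2 * k2 + 2 * p%:R) / s) * ex theta by rewrite rmorphM fmorphV.
  rewrite !exD !exN !invfM !invrK !Es.
  move: (ex theta) (ex psi) (cfR C (q / s)) => x y g.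
  have -> : g / x * y = g * (y / x) by ring.
  have -> : g * x / y = g * (y^-1 * x) by ring.
  have -> : g / x / y = g * (y^-1 / x) by ring.
  have -> : g * x * y = g * (y * x) by ring.
  by clear; ring.
move: hd1 hd2; rewrite !mulf_eq0 !negb_or => /andP[d1 d2] /andP[d3 d4].
have d3' : qpoch_inf (r (2 * k1 + 2 * k2 + 2 * p%:R) / S / ex theta) Q != 0.
  by rewrite EB'; apply: norm_neq0; rewrite -EB.
have {}d3 : qpoch_inf (r (2 * k1 + 2 * k2 + 2 * p%:R) / S * ex theta) Q != 0.
  by rewrite mulrAC.
have d4' := norm_neq0 _ _ d4.
have {}d2 : qpoch_inf (r (2 * k2) / r (2 * k1) * Q ^ (1 - m) * ex theta / S) Q != 0.
  by rewrite -(powR_Y C hq0).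
move: d3 d3' d4 d4' NE; rewrite (powR_al C hq0) (powR_Bp C hq0) => d3 d3' d4 d4' NE.
have {}H := H d1 d2 d3 d3' d4 d4' NE.
rewrite !exE exN !exD exN.
subst_eq (powR_al C hq0 k1 k2 m); subst_eq (powR_Bp C hq0 k1 k2 p); subst_eq (powR_be C hq0 k1 k2).
subst_eq (powR_ga C hq0 k1 k2); subst_eq (powR_Y C hq0 k1 k2 m); subst_eq (powR_Ap C hq0 k1 k2 p).
subst_eq (powR_h2p C hq0 k1 k2 p); subst_eq (powR_h2V C hq0 k1 k2).
apply: (eq_sums H) => n; rewrite /coefC -/normsq.
subst_eq (powR_n C hq0 k1 k2 n); subst_eq (powR_4k2 C hq0 k1 k2); subst_eq (powR_p C hq0 k1 k2).
subst_eq (powR_inf1 C hq0 k1 k2 m n); subst_eq (powR_inf2 C hq0 k1 k2 m n).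
subst_eq (powR_A C hq0 k1 k2); subst_eq (powR_Y C hq0 k1 k2 m).
by rewrite fmorphXz.
Qed.
End RealParameters.

Section ComplexExp.
Variable R : realType.
Local Notation C := (complex_field R).

Lemma expiD (a b : R) : expi (a + b) = expi a * expi b.
Proof. by rewrite /expi cosD sinD [sin a * cos b + _]addrC. Qed.

Lemma expi_conj (t : R) : of_real (cos t) *+ 2 = expi t + conjc (expi t).
Proof. by apply/eqP; rewrite mulr2n eq_complex /= addr0 subrr !eqxx. Qed.

Lemma modulus_conj (z : C) : cabs (conjc z : C) = cabs z.
Proof. by apply: (@complexI R); rewrite -!modulusE normcJ. Qed.

Lemma norm_conj (z : C) : `|z| ^+ 2 = z * conjc z.
Proof. exact: (@sqr_normc R z). Qed.

Lemma conj_real (a : R) : conjc (cfR C a) = cfR C a.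
Proof. exact: conjc_real. Qed.

End ComplexExp.

Theorem theorem3p9 (R : realType) (q k1 k2 s theta psi : R) (m : int) (p : nat)
  (Q := of_real (q ^+ 2)) (M : R := m%:~R) (S := of_real s)
  (qr := fun x : R => of_real (q `^ x))
  (hq0 : 0 < q) (hq1 : q < 1) (hk1 : 0 < k1) (hk12 : k1 <= k2)
  (hs : q^-1 <= `|s|)
  (htheta : 0 <= theta <= pi) (hpsi : 0 <= psi <= pi)
  (hden1 : qpochs_inf [:: Q / S ^+ 2;
             qr (2 * k2 - 2 * k1 - 2 * M + 2) * expi theta / S] Q != 0)
  (hden2 : qpochs_inf [:: qr (2 * k1 + 2 * k2 + 2 * p%:R) * expi theta / S;
             qr (2 * k1 - 2 * k2 + 2 * M + 1) * expi psi] Q != 0) :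
  series (fun n : nat =>
    coef q k1 k2 s theta psi m p n
    * al_salam_chihara (n%:Z + m) (of_real (cos theta))
        (S * qr (2 * k1 - 2 * k2 - 2 * p%:R))
        (qr (2 * k1 + 2 * k2 + 2 * p%:R) / S) Q
    * al_salam_chihara n%:Z (mu (qr (2 * k2 + 2 * p%:R) / S))
        (S * qr (- (2 * k2))) (qr (- (2 * k2)) / S) Q^-1
    * cdual_qHahn n (of_real (cos psi))
        (qr (2 * k1 - 2 * k2 + 2 * M + 1)) (qr (2 * k1 + 2 * k2 - 1))
        (qr (2 * k2 - 2 * k1 + 1)) Q) @ \oo
  --> askey_wilson p (of_real (cos psi))
        (of_real q * expi theta / S) (of_real q * expi (- theta) / S)
        (qr (2 * k2 - 2 * k1 + 1)) (qr (2 * k1 + 2 * k2 - 1)) Q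
      * phi22 (of_real q * expi (theta - psi) / S)
          (of_real q * expi (theta + psi) / S)
          (Q / S ^+ 2) (qr (2 * k2 - 2 * k1 - 2 * M + 2) * expi theta / S)
          Q (qr (2 * k2 - 2 * k1 - 2 * M + 2) * expi (- theta) / S).
Proof.
have /tendsP H := @trilinear_sum_powers R (complex_field R) expi
   (@conjc R : {rmorphism R[i] -> R[i]}) (@expiD R) (@modulus_expi R) (@expi_conj R) (@conj_real R)
  (@modulus_conj R) (@norm_conj R) q k1 k2 s theta psi m p hq0 hq1 hk1 hk12 hs hden1 hden2.
exact: H.
Qed.
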